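(* Let $N(c)$ be a $(2m+1)$-dimensional $(\kappa,\mu)$-contact space form of constant $\varphi$-sectional curvature $c$, endowed with the connection $\overline{\nabla}_XY=\widehat{\overline{\nabla}}_XY+\lambda_1\pi(Y)X-\lambda_2 g(X,Y)P$, and let $M^n$, $n\ge 3$, be an $n$-dimensional submanifold of $N(c)$, with $n+p=2m+1$. Let $x\in M$. Then: (i) For each unit vector $X\in T_xM$, \begin{align*} \mathrm{Ric}(X)\le{}& \frac{(n-1)(c+3)}{4}+\frac{3(c-1)}{4}\|\widehat{P}X\|^2-\frac{c+3-4\kappa}{4}\left[(n-2)\eta(X)^2+\|\xi^\top\|^2\right]\\ &+\frac12\left[\|(\varphi h'X)^\top\|^2-\|(h'X)^\top\|^2+g(X,h'X)\mathrm{tr}((h')^\top)-g(X,\varphi h'X)\mathrm{tr}((\varphi h')^\top)\right]\\ &+(n-2-\|\xi^\top\|^2+\mu\|\xi^\top\|^2)g(X,h'X)+(1-\eta(X)^2+\mu\eta(X)^2)\mathrm{tr}((h')^\top)\\ &+(2-2\mu)\eta(X)g(X,h'(\xi^\top))-\lambda_1\lambda+[\lambda_1-\lambda_2(n-1)]\alpha(X,X)\\ &-\lambda_2(\lambda_1-\lambda_2)(n-1)\beta(X,X)-n(\lambda_1-\lambda_2)\pi(H)+(\lambda_1-\lambda_2)\pi(h(X,X))+\frac{n^2}{4}\|H\|^2 . \end{align*} (ii) If $H(x)=0$, then a unit tangent vector $X$ at $x$ satisfies the equality case of the inequality in (i) if and only if $X\in\mathcal N(x)=\{X\in T_xM\mid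 h(X,Y)=0\ \ \forall\, Y\in T_xM\}$. (iii) Equality in the inequality in (i) holds for all unit tangent vectors at $x$ if and only if $h^r_{ij}=0$ for all $i,j=1,\dots,n$ and $r=n+1,\dots,n+p$.
   Context: **Ambient manifold.** A Riemannian manifold $(N^{2m+1},g)$ has an almost contact metric structure $(\varphi,\xi,\eta,g)$ if $\varphi$ is a $(1,1)$-tensor field, $\xi$ a vector field, $\eta$ a $1$-form with $\varphi^2X=-X+\eta(X)\xi$, $\eta(\xi)=1$, $\varphi\xi=0$, $\eta\circ\varphi=0$, $g(X,\varphi Y)=-g(\varphi X,Y)$, $g(X,\xi)=\eta(X)$. It is a contact metric manifold if $\Phi=d\eta$, where $\Phi(X,Y)=g(X,\varphi Y)$. Let $\widehat{\overline{\nabla}}$ be the Levi-Civita connection of $g$ and $\widehat{\overline{R}}$ its curvature tensor. The tensor $h'$ defined by $2h'=\mathcal L_\xi\varphi$ is symmetric, and $h'\xi=0$, $h'\varphi+\varphi h'=0$, $\widehat{\overline{\nabla}}\xi=-\varphi-\varphi h'$, and $h'$ and $\varphi h'$ are trace-free on $TN$. $N$ is a $(\kappa,\mu)$-contact metric manifold ($\kappa,\mu$ real constants) if $\widehat{\overline{R}}(X,Y)\xi=\kappa[\eta(Y)X-\eta(X)Y]+\mu[\eta(Y)h'X-\eta(X)h'Y]$. A $\varphi$-section is a plane spanned by $X,\varphi X$ with $X$ a unit vector orthogonal to $\xi$; its sectional curvature is a $\varphi$-sectional curvature. If a $(\kappa,\mu)$-contact metric manifold has constant $\varphi$-sectional curvature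 $c$ it is called a $(\kappa,\mu)$-contact space form $N(c)$, and its Levi-Civita curvature tensor is \begin{align*}\widehat{\overline{R}}(X,Y)Z={}&\tfrac{c+3}{4}[g(Y,Z)X-g(X,Z)Y]+\tfrac{c+3-4\kappa}{4}[\eta(X)\eta(Z)Y-\eta(Y)\eta(Z)X+g(X,Z)\eta(Y)\xi-g(Y,Z)\eta(X)\xi]\\ &+\tfrac{c-1}{4}[2g(X,\varphi Y)\varphi Z+g(X,\varphi Z)\varphi Y-g(Y,\varphi Z)\varphi X]\\ &+\tfrac12[g(h'Y,Z)h'X-g(h'X,Z)h'Y+g(\varphi h'X,Z)\varphi h'Y-g(\varphi h'Y,Z)\varphi h'X]\\ &-g(X,Z)h'Y+g(Y,Z)h'X+\eta(X)\eta(Z)h'Y-\eta(Y)\eta(Z)h'X-g(h'X,Z)Y+g(h'Y,Z)X\\ &-g(h'Y,Z)\eta(X)\xi+g(h'X,Z)\eta(Y)\xi\\ &+\mu[\eta(Y)\eta(Z)h'X-\eta(X)\eta(Z)h'Y+g(h'Y,Z)\eta(X)\xi-g(h'X,Z)\eta(Y)\xi].\end{align*} **Connection.** $P$ is a vector field on $N$, $\pi(X)=g(P,X)$, $\lambda_1,\lambda_2$ are real constants, and $\overline{\nabla}_XY=\widehat{\overline{\nabla}}_XY+\lambda_1\pi(Y)X-\lambda_2g(X,Y)P$. Define the $(0,2)$-tensors $\alpha(X,Y)=(\widehat{\overline{\nabla}}_X\pi)(Y)-\lambda_1\pi(X)\pi(Y)+\frac{\lambda_2}{2}g(X,Y)\pi(P)$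 and $\beta(X,Y)=\frac{\pi(P)}{2}g(X,Y)+\pi(X)\pi(Y)$. **Submanifold.** For tangent $X,Y$ on $M$, $\overline{\nabla}_XY=\nabla_XY+h(X,Y)$ is the decomposition into tangential part (induced connection $\nabla$) and normal part $h$; one has $h=\widehat h-\lambda_2 g\,P^\bot$, with $\widehat h$ the usual second fundamental form and $P^\bot$ the normal part of $P$. $R(X,Y)Z=\nabla_X\nabla_YZ-\nabla_Y\nabla_XZ-\nabla_{[X,Y]}Z$ and $R(X,Y,Z,W)=g(R(X,Y)Z,W)$. Let $e_1,\dots,e_n$ be an orthonormal basis of $T_xM$ and $e_{n+1},\dots,e_{n+p}$ one of the normal space; $h^r_{ij}=g(h(e_i,e_j),e_r)$, $H=\frac1n\sum_i h(e_i,e_i)$. For a unit vector $X\in T_xM$, choosing the orthonormal basis with $e_1=X$, $\mathrm{Ric}(X)=\sum_{j=2}^nR(e_1,e_j,e_j,e_1)$. **Notation.** $\lambda=\mathrm{tr}(\alpha)=\sum_{i=1}^n\alpha(e_i,e_i)$ (trace over $T_xM$). $(\cdot)^\top$ denotes the tangential part; $\xi^\top$ is the tangential part of $\xi$; $\widehat PX=(\varphi X)^\top$, $(h')^\top X=(h'X)^\top$, $(\varphi h')^\top X=(\varphi h'X)^\top$ for tangent $X$; $\mathrm{tr}(\vartheta)=\sum_{i=1}^n g(e_i,\vartheta e_i)$ for $\vartheta\in\{(h')^\top,(\varphi h')^\top\}$. *)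

(* Defs.v *)
From HB Require Import structures.
From mathcomp Require Import all_boot all_order all_algebra.
From mathcomp Require Import all_classical all_reals all_analysis.

Set Implicit Arguments.
Unset Strict Implicit.
Unset Printing Implicit Defensive.

Import Order.TTheory GRing.Theory Num.Theory.
Import numFieldNormedType.Exports.

Local Open Scope classical_set_scope.
Local Open Scope ring_scope.

(** Conventions.  Tangent vectors are row vectors of components in a chart;
    an endomorphism, given by the matrix [A], acts by [v *m A]; a bilinear form,
    given by the matrix [B], is [(u, v) |-> u *m B *m v^T]; a 1-form is a column
    vector; the library's [jacobian F y] is the matrix of the differential of
    [F] at [y] acting on row vectors by [v *m jacobian F y]. *)

Section Smoothness.
Variable R : realType.

Fixpoint iter_partial d (s : seq 'I_d) (f : 'rV[R]_d -> R) : 'rV[R]_d -> R :=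
  if s is i :: s' then fun y => 'D_(delta_mx 0 i) (iter_partial s' f) y else f.

(** C^infinity on an open set [U]: all iterated partial derivatives are
    (Frechet) differentiable, hence continuous, at all points of [U]. *)
Definition smooth_on d (U : set 'rV[R]_d) (f : 'rV[R]_d -> R) : Prop :=
  forall (s : seq 'I_d) (y : 'rV[R]_d), U y ->
    differentiable (iter_partial s f) y.

Definition smooth_mx_on d k l (U : set 'rV[R]_d) (F : 'rV[R]_d -> 'M[R]_(k, l))
  : Prop := forall i j, smooth_on U (fun y => F y i j).

End Smoothness.

(** Smooth manifolds, given by a smooth atlas.  [chart_inv a] is a total
    function whose restriction to [chart_map a @` chart_dom a] is the inverse of
    the chart. *)

Record manifold (R : realType) (d : nat) := Manifold {
  carrier :> topologicalType;
  manifold_hausdorff : hausdorff_space carrier;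
  manifold_second_countable : @second_countable carrier;
  chart : Type;
  chart_dom : chart -> set carrier;
  chart_map : chart -> carrier -> 'rV[R]_d;
  chart_inv : chart -> 'rV[R]_d -> carrier;
  chart_dom_open : forall a, open (chart_dom a);
  chart_dom_cover : forall x, exists a, chart_dom a x;
  chart_codom_open : forall a, open (chart_map a @` chart_dom a);
  chart_mapK : forall a x, chart_dom a x -> chart_inv a (chart_map a x) = x;
  chart_map_continuous :
    forall a x, chart_dom a x -> {for x, continuous (chart_map a)};
  chart_inv_continuous :
    forall a y, (chart_map a @` chart_dom a) y ->
      {for y, continuous (chart_inv a)};
  transition_smooth : forall a b,
    smooth_mx_on (chart_map a @` (chart_dom a `&` chart_dom b))
      (chart_map b \o chart_inv a)
}.

Section Fields.
Variables (R : realType) (d : nat) (N : manifold R d).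

Definition chart_codom (a : chart N) : set 'rV[R]_d :=
  chart_map a @` chart_dom a.

Definition overlap (a b : chart N) : set 'rV[R]_d :=
  chart_map a @` (chart_dom a `&` chart_dom b).

Definition transition (a b : chart N) : 'rV[R]_d -> 'rV[R]_d :=
  chart_map b \o chart_inv a.

(** Smooth tensor fields on [N] are families of component functions, one for
    each chart, related by the usual transformation laws. *)

Record vector_field := VectorField {
  vf :> chart N -> 'rV[R]_d -> 'rV[R]_d;
  vf_smooth : forall a, smooth_mx_on (chart_codom a) (vf a);
  vf_transform : forall a b y, overlap a b y ->
    vf b (transition a b y) = vf a y *m jacobian (transition a b) y
}.

Record one_form := OneForm {
  covector :> chart N -> 'rV[R]_d -> 'cV[R]_d;
  form_smooth : forall a, smooth_mx_on (chart_codom a) (covector a);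
  form_transform : forall a b y, overlap a b y ->
    covector a y = jacobian (transition a b) y *m covector b (transition a b y)
}.

Record endo_field := EndoField {
  endo :> chart N -> 'rV[R]_d -> 'M[R]_d;
  endo_smooth : forall a, smooth_mx_on (chart_codom a) (endo a);
  endo_transform : forall a b y, overlap a b y ->
    endo a y *m jacobian (transition a b) y =
    jacobian (transition a b) y *m endo b (transition a b y)
}.

Record riemannian_metric := RiemannianMetric {
  metric_at :> chart N -> 'rV[R]_d -> 'M[R]_d;
  metric_smooth : forall a, smooth_mx_on (chart_codom a) (metric_at a);
  metric_transform : forall a b y, overlap a b y ->
    metric_at a y =
    jacobian (transition a b) y *m metric_at b (transition a b y)
      *m (jacobian (transition a b) y)^T;
  metric_sym : forall a y, chart_codom a y -> (metric_at a y)^T = metric_at a y;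
  metric_pos : forall a y, chart_codom a y -> forall v : 'rV[R]_d, v != 0 ->
    0 < (v *m metric_at a y *m v^T) 0 0
}.

End Fields.

Section LocalCalculus.
Variable R : realType.

Definition ip d (B : 'M[R]_d) (u v : 'rV[R]_d) : R := (u *m B *m v^T) 0 0.

Definition form_ev d (w : 'cV[R]_d) (v : 'rV[R]_d) : R := (v *m w) 0 0.

Definition bracket d (X Y : 'rV[R]_d -> 'rV[R]_d) : 'rV[R]_d -> 'rV[R]_d :=
  fun y => 'D_(X y) Y y - 'D_(Y y) X y.

(** The exterior derivative normalised with the factor 1/2; this is the
    normalisation for which [Phi = d eta] yields
    [nabla xi = - phi - phi h']. *)
Definition ext_deriv d (w : 'rV[R]_d -> 'cV[R]_d) (X Y : 'rV[R]_d -> 'rV[R]_d)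
    (y : 'rV[R]_d) : R :=
  2^-1 * ('D_(X y) (fun z => form_ev (w z) (Y z)) y
          - 'D_(Y y) (fun z => form_ev (w z) (X z)) y
          - form_ev (w y) (bracket X Y y)).

Definition lie_endo d (V : 'rV[R]_d -> 'rV[R]_d) (A : 'rV[R]_d -> 'M[R]_d)
    (X : 'rV[R]_d -> 'rV[R]_d) (y : 'rV[R]_d) : 'rV[R]_d :=
  bracket V (fun z => X z *m A z) y - bracket V X y *m A y.

Definition curvature d
    (nabla : ('rV[R]_d -> 'rV[R]_d) -> ('rV[R]_d -> 'rV[R]_d) ->
             ('rV[R]_d -> 'rV[R]_d))
    (X Y Z : 'rV[R]_d -> 'rV[R]_d) (y : 'rV[R]_d) : 'rV[R]_d :=
  nabla X (nabla Y Z) y - nabla Y (nabla X Z) y - nabla (bracket X Y) Z y.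

Definition christoffel d (G : 'rV[R]_d -> 'M[R]_d) (y : 'rV[R]_d)
    (i j k : 'I_d) : R :=
  2^-1 * \sum_(l < d) (invmx (G y)) k l *
    ('D_(delta_mx 0 i) (fun z => G z j l) y
     + 'D_(delta_mx 0 j) (fun z => G z i l) y
     - 'D_(delta_mx 0 l) (fun z => G z i j) y).

Definition christoffel_term d (G : 'rV[R]_d -> 'M[R]_d) (y u v : 'rV[R]_d)
    : 'rV[R]_d :=
  \row_k \sum_(i < d) \sum_(j < d) u 0 i * v 0 j * christoffel G y i j k.

Definition levi_civita d (G : 'rV[R]_d -> 'M[R]_d)
    (X Y : 'rV[R]_d -> 'rV[R]_d) : 'rV[R]_d -> 'rV[R]_d :=
  fun y => 'D_(X y) Y y + christoffel_term G y (X y) (Y y).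

(** The following objects are tensorial in the vectors they are applied to;
    their values on vectors at [y] are computed with the extensions of these
    vectors to fields with constant components. *)

Definition lc_curvature d (G : 'rV[R]_d -> 'M[R]_d) (y u v w : 'rV[R]_d)
    : 'rV[R]_d :=
  curvature (levi_civita G) (cst u) (cst v) (cst w) y.

Definition sectional d (G : 'rV[R]_d -> 'M[R]_d) (y u v : 'rV[R]_d) : R :=
  ip (G y) (lc_curvature G y u v v) u /
  (ip (G y) u u * ip (G y) v v - ip (G y) u v ^+ 2).

Definition hprime d (phi : 'rV[R]_d -> 'M[R]_d) (xi : 'rV[R]_d -> 'rV[R]_d)
    (y v : 'rV[R]_d) : 'rV[R]_d :=
  2^-1 *: lie_endo xi phi (cst v) y.

End LocalCalculus.

Record almost_contact_metric (R : realType) (d : nat) (N : manifold R d) :=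
  AlmostContactMetric {
  acm_g :> riemannian_metric N;
  acm_phi : endo_field N;
  acm_xi : vector_field N;
  acm_eta : one_form N;
  acm_phi2 : forall a y (v : 'rV[R]_d), chart_codom a y ->
    v *m acm_phi a y *m acm_phi a y =
    - v + form_ev (acm_eta a y) v *: acm_xi a y;
  acm_eta_xi : forall a y, chart_codom a y ->
    form_ev (acm_eta a y) (acm_xi a y) = 1;
  acm_phi_xi : forall a y, chart_codom a y -> acm_xi a y *m acm_phi a y = 0;
  acm_eta_phi : forall a y (v : 'rV[R]_d), chart_codom a y ->
    form_ev (acm_eta a y) (v *m acm_phi a y) = 0;
  acm_skew : forall a y (u v : 'rV[R]_d), chart_codom a y ->
    ip (acm_g a y) u (v *m acm_phi a y) = - ip (acm_g a y) (u *m acm_phi a y) v;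
  acm_g_xi : forall a y (v : 'rV[R]_d), chart_codom a y ->
    ip (acm_g a y) v (acm_xi a y) = form_ev (acm_eta a y) v
}.

Section ContactMetric.
Variables (R : realType) (d : nat) (N : manifold R d).
Variable S : almost_contact_metric N.

Definition contact_metric : Prop :=
  forall a y (u v : 'rV[R]_d), chart_codom a y ->
    ip (S a y) u (v *m acm_phi S a y) =
    ext_deriv (acm_eta S a) (cst u) (cst v) y.

Definition kappa_mu_contact (kappa mu : R) : Prop :=
  contact_metric /\
  forall a y (u v : 'rV[R]_d), chart_codom a y ->
    let eta := form_ev (acm_eta S a y) in
    let h' := hprime (acm_phi S a) (acm_xi S a) y in
    lc_curvature (S a) y u v (acm_xi S a y) =
    kappa *: (eta v *: u - eta u *: v) + mu *: (eta v *: h' u - eta u *: h' v).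

Definition kappa_mu_space_form (kappa mu c : R) : Prop :=
  kappa_mu_contact kappa mu /\
  forall a y (u : 'rV[R]_d), chart_codom a y ->
    ip (S a y) u u = 1 -> ip (S a y) u (acm_xi S a y) = 0 ->
    sectional (S a) y u (u *m acm_phi S a y) = c.

End ContactMetric.

(** The tensors [alpha] and [beta] attached to the connection
    [nabla-bar_X Y = nabla_X Y + l1 pi(Y) X - l2 g(X, Y) P], [nabla] being here the
    Levi-Civita connection. *)

Section ConnectionTensors.
Variables (R : realType) (d : nat).
Variables (G : 'rV[R]_d -> 'M[R]_d) (P : 'rV[R]_d -> 'rV[R]_d) (l1 l2 : R).

Definition pi_form (y v : 'rV[R]_d) : R := ip (G y) (P y) v.

Definition alpha (y u v : 'rV[R]_d) : R :=
  ('D_u (fun z => pi_form z v) y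
   - pi_form y (levi_civita G (cst u) (cst v) y))
  - l1 * pi_form y u * pi_form y v
  + l2 / 2 * ip (G y) u v * pi_form y (P y).

Definition beta (y u v : 'rV[R]_d) : R :=
  pi_form y (P y) / 2 * ip (G y) u v + pi_form y u * pi_form y v.

End ConnectionTensors.

(** Submanifolds: smooth immersions [f : M -> N].  All notions used are local,
    so injectivity of [f] is not required. *)

Definition local_expr (R : realType) (n d : nat) (M : manifold R n)
    (N : manifold R d) (f : M -> N) (a : chart M) (b : chart N)
    : 'rV[R]_n -> 'rV[R]_d :=
  chart_map b \o f \o chart_inv a.

Record submanifold (R : realType) (n d : nat) (M : manifold R n)
    (N : manifold R d) := Submanifold {
  incl :> M -> N;
  incl_continuous : continuous incl;
  incl_smooth : forall a b,
    smooth_mx_on (chart_map a @` (chart_dom a `&` incl @^-1` chart_dom b))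
      (local_expr incl a b);
  incl_immersive : forall a b y,
    (chart_map a @` (chart_dom a `&` incl @^-1` chart_dom b)) y ->
    row_free (jacobian (local_expr incl a b) y)
}.

(** Geometry of the submanifold in charts, [F] being the local expression of the
    immersion.  Vectors tangent to [M] are given by their components in the
    chart of [M] (row vectors of size [n]); [push] identifies them with vectors
    tangent to [N]. *)

Section LocalSubmanifold.
Variables (R : realType) (n d : nat).
Variables (G : 'rV[R]_d -> 'M[R]_d) (P : 'rV[R]_d -> 'rV[R]_d) (l1 l2 : R).
Variable F : 'rV[R]_n -> 'rV[R]_d.

Definition push (y : 'rV[R]_n) (v : 'rV[R]_n) : 'rV[R]_d := v *m jacobian F y.

Definition induced_metric (y : 'rV[R]_n) : 'M[R]_n :=
  jacobian F y *m G (F y) *m (jacobian F y)^T.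

(** [tangential y w] is the vector [t] tangent to [M] such that [w - push y t]
    is [G]-orthogonal to the image of [push y]. *)
Definition tangential (y : 'rV[R]_n) (w : 'rV[R]_d) : 'rV[R]_n :=
  w *m G (F y) *m (jacobian F y)^T *m invmx (induced_metric y).

Definition normal_part (y : 'rV[R]_n) (w : 'rV[R]_d) : 'rV[R]_d :=
  w - push y (tangential y w).

(** [nabla-bar_X V] for [X] tangent to [M] and [V] a field on [M] of vectors
    tangent to [N]; this is the value of [nabla-bar] on arbitrary extensions
    of [X] and [V] to [N]. *)
Definition nabla_bar (X : 'rV[R]_n -> 'rV[R]_n) (V : 'rV[R]_n -> 'rV[R]_d)
    : 'rV[R]_n -> 'rV[R]_d :=
  fun y =>
    'D_(X y) V y + christoffel_term G (F y) (push y (X y)) (V y)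
    + (l1 * pi_form G P (F y) (V y)) *: push y (X y)
    - (l2 * ip (G (F y)) (push y (X y)) (V y)) *: P (F y).

Definition nabla (X Y : 'rV[R]_n -> 'rV[R]_n) : 'rV[R]_n -> 'rV[R]_n :=
  fun y => tangential y (nabla_bar X (fun z => push z (Y z)) y).

Definition second_form (y u v : 'rV[R]_n) : 'rV[R]_d :=
  normal_part y (nabla_bar (cst u) (fun z => push z v) y).

Definition curv4 (y u v w z : 'rV[R]_n) : R :=
  ip (induced_metric y) (curvature nabla (cst u) (cst v) (cst w) y) z.

Definition tangent_frame (y : 'rV[R]_n) (e : 'I_n -> 'rV[R]_n) : Prop :=
  forall i j, ip (induced_metric y) (e i) (e j) = (i == j)%:R.

Definition normal_frame p (y : 'rV[R]_n) (nu : 'I_p -> 'rV[R]_d) : Prop :=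
  (forall r s, ip (G (F y)) (nu r) (nu s) = (r == s)%:R) /\
  (forall r (v : 'rV[R]_n), ip (G (F y)) (push y v) (nu r) = 0).

(** Some orthonormal basis of the tangent space of [M] whose first vector is
    [X]; one exists as soon as [X] is a unit vector, and [ricci] does not depend
    on which one is chosen. *)
Definition adapted_basis (y X : 'rV[R]_n) : {ffun 'I_n -> 'rV[R]_n} :=
  xget [ffun=> 0] [set e : {ffun 'I_n -> 'rV[R]_n} |
    tangent_frame y e /\ forall i : 'I_n, i = 0%N :> nat -> e i = X].

Definition ricci (y X : 'rV[R]_n) : R :=
  let e := adapted_basis y X in
  \sum_(j < n | (0 < j)%N) curv4 y X (e j) (e j) X.

Definition mean_curvature (y : 'rV[R]_n) (e : 'I_n -> 'rV[R]_n) : 'rV[R]_d :=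
  n%:R^-1 *: \sum_(i < n) second_form y (e i) (e i).

Definition tangential_trace (y : 'rV[R]_n) (e : 'I_n -> 'rV[R]_n)
    (A : 'rV[R]_d -> 'rV[R]_d) : R :=
  \sum_(i < n) ip (induced_metric y) (e i) (tangential y (A (push y (e i)))).

Definition alpha_trace (y : 'rV[R]_n) (e : 'I_n -> 'rV[R]_n) : R :=
  \sum_(i < n) alpha G P l1 l2 (F y) (push y (e i)) (push y (e i)).

End LocalSubmanifold.

(** The right-hand side of the Ricci inequality; [e] is an orthonormal basis of
    the tangent space of [M], used for the traces and the mean curvature. *)

Definition ricci_bound (R : realType) (n d : nat)
    (G phi : 'rV[R]_d -> 'M[R]_d) (xi : 'rV[R]_d -> 'rV[R]_d)
    (eta : 'rV[R]_d -> 'cV[R]_d) (kappa mu c : R)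
    (P : 'rV[R]_d -> 'rV[R]_d) (l1 l2 : R)
    (F : 'rV[R]_n -> 'rV[R]_d) (y : 'rV[R]_n) (e : 'I_n -> 'rV[R]_n)
    (X : 'rV[R]_n) : R :=
  let x := F y in
  let g := ip (G x) in
  let sqnorm_tan w :=
    ip (induced_metric G F y) (tangential G F y w) (tangential G F y w) in
  let Xb := push F y X in
  let xit := push F y (tangential G F y (xi x)) in
  let phi_ v := v *m phi x in
  let h' := hprime phi xi x in
  let etaX := form_ev (eta x) Xb in
  let tr := tangential_trace G F y e in
  let p_ := pi_form G P x in
  let h := second_form G P l1 l2 F y in
  let H := mean_curvature G P l1 l2 F y e in
  let al := alpha G P l1 l2 x Xb Xb in
  let be := beta G P x Xb Xb in
  (n%:R - 1) * (c + 3) / 4 + 3 * (c - 1) / 4 * sqnorm_tan (phi_ Xb)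
  - (c + 3 - 4 * kappa) / 4 * ((n%:R - 2) * etaX ^+ 2 + sqnorm_tan (xi x))
  + 2^-1 * (sqnorm_tan (phi_ (h' Xb)) - sqnorm_tan (h' Xb)
            + g Xb (h' Xb) * tr h'
            - g Xb (phi_ (h' Xb)) * tr (fun v => phi_ (h' v)))
  + (n%:R - 2 - sqnorm_tan (xi x) + mu * sqnorm_tan (xi x)) * g Xb (h' Xb)
  + (1 - etaX ^+ 2 + mu * etaX ^+ 2) * tr h'
  + (2 - 2 * mu) * etaX * g Xb (h' xit)
  - l1 * alpha_trace G P l1 l2 F y e
  + (l1 - l2 * (n%:R - 1)) * al
  - l2 * (l1 - l2) * (n%:R - 1) * be
  - n%:R * (l1 - l2) * p_ H
  + (l1 - l2) * p_ (h X X)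
  + n%:R ^+ 2 / 4 * g H H.

(* Main.v *)
Require Import Defs.
From mathcomp Require Import all_boot all_order all_algebra.
From mathcomp Require Import all_classical all_reals all_analysis.
From mathcomp Require Import ring lra.
Set Implicit Arguments.
Unset Strict Implicit.
Unset Printing Implicit Defensive.
Import Order.TTheory GRing.Theory Num.Theory.
Import numFieldNormedType.Exports.
Local Open Scope classical_set_scope.
Local Open Scope ring_scope.

(** A contact metric structure satisfies [nabla xi = S - phi] where [S = - phi h']
    is symmetric, kills [xi] and anticommutes with [phi].  The tensor
    [b = nabla phi - (g(T ., .) xi - eta T)], [T = 1 + h'], has vanishing cyclic sums,
    vanishes with [xi] and is of type (3,0) + (0,3) on the contact distribution; the
    first Bianchi identity for [R(X, Y) xi] gives [b(h' X, Y, Z) = 0], and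
    [h'^2 = (kappa - 1) phi^2] then forces [b = 0] (if [kappa = 1], then [h' = 0]
    and the same identity gives [b = 0] directly).  The Ricci identity for [phi]
    shows that, on the contact distribution, [R - T /\ T] is Kaehler-like, so that it
    is determined by its holomorphic sectional curvature; this is the curvature
    formula of a space form.

    For the submanifold, differentiating along the immersion gives the Gauss equation
    of the induced connection.  With an orthonormal basis starting with [X] and
    [tau = sum_i h(e_i, e_i) = n H], all the terms of the upper bound match those of
    [Ric X] except for
    [bound - Ric X = 1/4 |tau - 2 h(X, X)|^2 + sum_(j > 1) |h(X, e_j)|^2],
    and the three assertions are read off this identity. *)

(** * Calculus of matrix-valued maps *)

(** [kappa_mu_space_form] contains no curvature formula, so the formula has to be extracted from the
    constancy of the [phi]-sectional curvature. The Ricci curvature uses only values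
    [R(u, v, v, u)], which spares the polarisation to the full tensor. [S] is preferred to [h']
    because it is algebraic in [nabla xi] and [phi], and its symmetry is the contact condition
    itself; the Lie derivative defining [h'] is identified with [phi S] only once [nabla_xi phi = 0]
    is known. On the submanifold the induced connection is in general neither torsion free (torsion
    is proportional to [l1]) nor metric (the defect is proportional to [l1 - l2]), so the symmetries
    of its curvature cannot be invoked and the Gauss equation is expanded by hand. The constant 1/4
    completes a square: [Ric X] contains [g(h(X, X), tau) - |h(X, X)|^2], and adding [|tau|^2 / 4]
    to its opposite gives [|tau - 2 h(X, X)|^2 / 4]. The bound [3 <= n] decides the last assertion:
    equality at every [e_i] gives [tau = 2 h(e_i, e_i)], hence [n tau = 2 tau] after summation. *)

Section MatrixEntries.
Variables (R : realType) (k l : nat).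
Implicit Types A B : 'M[R]_(k, l).

Lemma mx_addE A B i j : (A + B) i j = A i j + B i j. Proof. by rewrite mxE. Qed.
Lemma mx_oppE A i j : (- A) i j = - A i j. Proof. by rewrite mxE. Qed.
Lemma mx_scaleE a A i j : (a *: A) i j = a * A i j. Proof. by rewrite mxE. Qed.
Lemma mx_trD A B : (A + B)^T = A^T + B^T. Proof. exact: linearD. Qed.
Lemma mx_trN A : (- A)^T = - A^T. Proof. exact: linearN. Qed.
Lemma mx_zeroE i j : (0 : 'M[R]_(k, l)) i j = 0. Proof. by rewrite mxE. Qed.

End MatrixEntries.

Section MatrixCalculus.
Variables (R : realType) (V : normedModType R).

Lemma differentiable_mxP k l (f : V -> 'M[R]_(k, l)) y :
  differentiable f y <-> forall i j, differentiable (fun z => f z i j) y.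
Proof.
split=> [df i j|df].
  apply: (@differentiable_comp _ _ _ _ f (fun N : 'M[R]_(k, l) => N i j)) => //.
  exact: differentiable_coord.
have -> : f = \sum_(i < k) \sum_(j < l) (fun z => f z i j *: delta_mx i j).
  apply/funext => z; rewrite fct_sumE [LHS]matrix_sum_delta.
  by apply: eq_bigr => i _; rewrite fct_sumE.
apply: differentiable_sum => i; apply: differentiable_sum => j.
exact: differentiableZl.
Qed.

Lemma derive_entry k l (f : V -> 'M[R]_(k, l)) y v i j : differentiable f y ->
  ('D_v f y) i j = 'D_v (fun z => f z i j) y.
Proof. by move=> df; rewrite derive_mx ?mxE//; exact: diff_derivable. Qed.

Lemma differentiable_big_sum (I : Type) (W : normedModType R) (s : seq I)
    (P : pred I) (f : I -> V -> W) y :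
  (forall i, P i -> differentiable (f i) y) ->
  differentiable (fun z => \sum_(i <- s | P i) f i z) y.
Proof.
move=> df; elim: s => [|i s IHs].
  rewrite (_ : (fun _ => _) = cst 0); first exact: differentiable_cst.
  by apply/funext => z; rewrite big_nil.
case Pi: (P i); under eq_fun do rewrite big_cons Pi; last by [].
exact: (differentiableD (df _ Pi)).
Qed.

Lemma derive_big_sum (I : Type) (s : seq I) (f : I -> V -> R) y v :
  (forall i, differentiable (f i) y) ->
  'D_v (fun z => \sum_(i <- s) f i z) y = \sum_(i <- s) 'D_v (f i) y.
Proof.
move=> df; elim: s => [|i s IHs].
  rewrite (_ : (fun _ => _) = cst 0); last by apply/funext => z; rewrite big_nil.
  by rewrite big_nil derive_cst.
under eq_fun do rewrite big_cons; rewrite big_cons -IHs.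
apply: deriveD; apply: diff_derivable => //.
exact: differentiable_big_sum.
Qed.

Lemma differentiable_big_prod (I : Type) (s : seq I) (f : I -> V -> R) y :
  (forall i, differentiable (f i) y) ->
  differentiable (fun z => \prod_(i <- s) f i z) y.
Proof.
move=> df; elim: s => [|i s IHs].
  rewrite (_ : (fun _ => _) = cst 1); first exact: differentiable_cst.
  by apply/funext => z; rewrite big_nil.
under eq_fun do rewrite big_cons.
exact: (differentiableM (df i)).
Qed.

Lemma differentiable_mulmx k l m (A : V -> 'M[R]_(k, l)) (B : V -> 'M[R]_(l, m)) y :
  differentiable A y -> differentiable B y ->
  differentiable (fun z => A z *m B z) y.
Proof.
move=> /differentiable_mxP dA /differentiable_mxP dB.
apply/differentiable_mxP => i j; under eq_fun do rewrite mxE.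
by apply: differentiable_big_sum => s _; exact: differentiableM.
Qed.

Lemma derive_mulmx k l m (A : V -> 'M[R]_(k, l)) (B : V -> 'M[R]_(l, m)) y v :
  differentiable A y -> differentiable B y ->
  'D_v (fun z => A z *m B z) y = 'D_v A y *m B y + A y *m 'D_v B y.
Proof.
move=> dA dB; apply/matrixP => i j.
rewrite derive_entry; last exact: differentiable_mulmx.
move: (dA) (dB) => /differentiable_mxP dA' /differentiable_mxP dB'.
under eq_fun do rewrite mxE.
rewrite derive_big_sum; last by move=> s; exact: differentiableM.
rewrite !mxE -big_split; apply: eq_bigr => s _.
rewrite /= !derive_entry//.
rewrite (@deriveM _ _ (fun z => A z i s) (fun z => B z s j)); do ?exact: diff_derivable.
by rewrite addrC; congr (_ + _); rewrite mulrC.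
Qed.

Lemma differentiable_trmx k l (A : V -> 'M[R]_(k, l)) y :
  differentiable A y -> differentiable (fun z => (A z)^T) y.
Proof.
move=> /differentiable_mxP dA; apply/differentiable_mxP => i j.
by under eq_fun do rewrite mxE.
Qed.

Lemma derive_trmx k l (A : V -> 'M[R]_(k, l)) y v :
  differentiable A y -> 'D_v (fun z => (A z)^T) y = ('D_v A y)^T.
Proof.
move=> dA; apply/matrixP => i j.
rewrite derive_entry; last exact: differentiable_trmx.
by rewrite mxE derive_entry//; under eq_fun do rewrite mxE.
Qed.

Lemma differentiable_scale k l (f : V -> R) (X : V -> 'M[R]_(k, l)) y :
  differentiable f y -> differentiable X y -> differentiable (fun z => f z *: X z) y.
Proof.
move=> df dX; apply/differentiable_mxP => i j; under eq_fun do rewrite mxE.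
by apply: differentiableM => //; move/differentiable_mxP: dX; exact.
Qed.

Lemma derive_scale k l (f : V -> R) (X : V -> 'M[R]_(k, l)) y v :
  differentiable f y -> differentiable X y ->
  'D_v (fun z => f z *: X z) y = 'D_v f y *: X y + f y *: 'D_v X y.
Proof.
move=> df dX; have dF := differentiable_scale df dX.
apply/matrixP => i j; rewrite derive_entry//; under eq_fun do rewrite mxE.
have dXij : differentiable (fun z => X z i j) y by move/differentiable_mxP: dX; exact.
rewrite (@deriveM _ _ f (fun z => X z i j)); [|exact: diff_derivable..].
by rewrite mx_addE !mx_scaleE derive_entry// addrC mulrC; congr (_ + _).
Qed.

Lemma differentiable_det k (A : V -> 'M[R]_k) y :
  differentiable A y -> differentiable (fun z => \det (A z)) y.
Proof.
move=> /differentiable_mxP dA; apply: differentiable_big_sum => s _.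
apply: differentiableM; first exact: differentiable_cst.
exact: differentiable_big_prod.
Qed.

(** [invmx] is defined by cases and agrees with Cramer's formula only where the matrix is
    invertible; transfers of this kind recur on open sets. The difference of the two maps vanishes
    near [y], so it has the zero map as differential by [diff_unique]. *)
Lemma near_eq_differentiable (W : normedModType R) (f g : V -> W) y :
  (\forall z \near y, f z = g z) -> differentiable f y -> differentiable g y.
Proof.
move=> fg df; have -> : g = f + (g - f) by rewrite addrC subrK.
apply: differentiableD => //; set h := g - f.
have h0 : \forall z \near y, h z = 0.
  by apply: filterS fg => z fgz; rewrite /h !fctE fgz subrr.
have E : h \o shift y = cst (h y) + (\0 : {linear V -> W}) +o_ 0 id.
  apply/eqaddoP => e e0; rewrite (nbhs_singleton h0).
  have := h0; rewrite (near_shift 0) subr0.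
  apply: filterS => z /= hz.
  have -> : (h \o shift y - (cst 0 + \0)) z = h (z + y) - (0 + 0) by [].
  by rewrite hz addr0 subr0 normr0 mulr_ge0// ltW.
have c0 : continuous (\0 : {linear V -> W}) by move=> z; exact: cvg_cst.
have dE := diff_unique c0 E.
by apply/diff_locallyP; rewrite dE.
Qed.

Lemma differentiable_invmx k (A : V -> 'M[R]_k) y :
  (\forall z \near y, A z \in unitmx) -> differentiable A y ->
  differentiable (fun z => invmx (A z)) y.
Proof.
move=> uA dA; have uy : A y \in unitmx by exact: nbhs_singleton uA.
apply: (@near_eq_differentiable _ (fun z => (\det (A z))^-1 *: \adj (A z))).
  by near=> z; rewrite /invmx; have -> : A z \in unitmx by near: z.
apply/differentiable_mxP => i j; under eq_fun do rewrite !mxE.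
apply: differentiableM.
  apply: differentiableV; first exact: differentiable_det.
  by move: uy; rewrite unitmxE unitfE.
apply: differentiableM; first exact: differentiable_cst.
apply: differentiable_det; apply/differentiable_mxP => i' j'.
by under eq_fun do rewrite !mxE; move/differentiable_mxP: dA; exact.
Unshelve. all: by end_near. Qed.

End MatrixCalculus.

Section DirectionalDerivatives.
Variables (R : realType) (V W : normedModType R).

Lemma derive_comp (U : normedModType R) (F : V -> U) (g : U -> W) y u :
  differentiable F y -> differentiable g (F y) ->
  'D_u (fun z => g (F z)) y = 'D_('D_u F y) g (F y).
Proof.
move=> dF dg; rewrite (@deriveE _ _ _ (g \o F)); last exact: differentiable_comp.
by rewrite diff_comp//= -!deriveE.
Qed.

Lemma derive_dirD (f : V -> W) y u v : differentiable f y ->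
  'D_(u + v) f y = 'D_u f y + 'D_v f y.
Proof. by move=> df; rewrite !deriveE// linearD. Qed.

Lemma derive_dirZ (f : V -> W) y a u : differentiable f y ->
  'D_(a *: u) f y = a *: 'D_u f y.
Proof. by move=> df; rewrite !deriveE// linearZ. Qed.

Lemma derive_dir_sum (I : Type) (s : seq I) (f : V -> W) y (a : I -> R)
    (u : I -> V) : differentiable f y ->
  'D_(\sum_(i <- s) a i *: u i) f y = \sum_(i <- s) a i *: 'D_(u i) f y.
Proof.
move=> df; rewrite deriveE// linear_sum; apply: eq_bigr => i _.
by rewrite linearZ deriveE.
Qed.

Lemma derive_line (f : V -> W) p u (s : R) : differentiable f (p + s *: u) ->
  is_derive s 1 (fun s => f (p + s *: u)) ('D_u f (p + s *: u)).
Proof.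
move=> df.
have dl : differentiable (fun s : R => p + s *: u) s.
  by apply: differentiableD; [exact: differentiable_cst|exact: differentiableZl].
apply: DeriveDef.
  by apply/diff_derivable/(@differentiable_comp _ _ _ _ (fun s : R => p + s *: u)).
rewrite deriveE; last exact/(@differentiable_comp _ _ _ _ (fun s : R => p + s *: u)).
rewrite (@diff_comp _ _ _ _ (fun s : R => p + s *: u) f)//= -!deriveE//.
congr ('D_ _ f _).
rewrite deriveD; [|exact: derivable_cst|exact/diff_derivable/differentiableZl].
rewrite derive_cst add0r deriveE; last exact: differentiableZl.
by rewrite diffZl// diff_val scale1r.
Qed.

End DirectionalDerivatives.

(** * Symmetry of second derivatives *)

Section Young.
Variables (R : realType) (V : normedModType R).

(** Alternating sum of [f] over the corners of the parallelogram spanned by [t *: u] and [t *: v];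
    its symmetry in [u] and [v] is what makes [young] work. *)
Let sec (f : V -> R) y u v (t : R) :=
  f (y + t *: u + t *: v) - f (y + t *: u) - f (y + t *: v) + f y.

(** The mean value theorem is applied in the direction [u] only; the linear approximation of
    ['D_u f] at the single point [y] does the rest, so second derivatives are used nowhere but at
    [y]. *)
Lemma second_difference (f : V -> R) y u v (e : R) : 0 < e ->
  (\forall z \near y, differentiable f z) -> differentiable ('D_u f) y ->
  \forall t \near 0^'+, `|sec f y u v t - t ^+ 2 * 'D_v ('D_u f) y| <= e * t ^+ 2.
Proof.
(* With [0 < c < t], the increments [c *: u + t *: v] and [c *: u] have norms adding up to at most
   [t * (2 |u| + |v|)]; the summand 1 makes [M] positive. *)
move=> e0 df dg; set g := 'D_u f; pose M := 2 * `|u| + `|v| + 1.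
have M0 : 0 < M by rewrite /M ltr_wpDl// addr_ge0// mulr_ge0.
have eM0 : 0 < e / M by rewrite divr_gt0.
have r0 : \forall x \near (0 : V), `|g (y + x) - g y - 'D_x g y| <= e / M * `|x|.
  have /eqaddoP /(_ _ eM0) := diff_locally dg.
  by apply: filterS => x; rewrite !fctE/= opprD addrA (addrC x) -deriveE.
have df0 : \forall h \near (0 : V), differentiable f (y + h).
  move: df; rewrite (near_shift 0) subr0; apply: filterS => h /=.
  by rewrite addrC.
have : nbhs (0 : V) (fun h => `|g (y + h) - g y - 'D_h g y| <= e / M * `|h| /\
    differentiable f (y + h)) by exact: filterI.
case/nbhs_ballP => d /= d0 Hd.
near=> t.
have t0 : 0 < t by near: t; exact: nbhs_right_gt.
have tM : t * M < d by rewrite -ltr_pdivlMr//; near: t; apply: nbhs_right_lt; rewrite divr_gt0.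
have small s (b : R) : 0 <= s <= t -> 0 <= b <= t -> ball (0 : V) d (s *: u + b *: v).
  move=> /andP[s0 st] /andP[b0 bt]; rewrite -ball_normE /= sub0r normrN.
  apply: le_lt_trans tM; apply: le_trans (ler_normD _ _) _; rewrite !normrZ.
  rewrite !ger0_norm//.
  have h1 := ler_wpM2r (normr_ge0 u) st; have h2 := ler_wpM2r (normr_ge0 v) bt.
  have h3 : 0 <= t * `|u| by rewrite mulr_ge0// ltW.
  apply: le_trans (lerD h1 h2) _; rewrite /M !mulrDr mulr1 mulrCA.
  move: h3 t0; clear; set a := t * `|u|; set b := t * `|v|; lra.
(* A single [c] serves both sides parallel to [u], because the theorem is applied to the difference
   [phi] of [f] along these sides. *)
have [c ct E] : exists2 c, c \in `]0, t[%R &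
    sec f y u v t = (g (y + (c *: u + t *: v)) - g (y + c *: u)) * t.
  pose phi (s : R) := f ((y + t *: v) + s *: u) - f (y + s *: u).
  have sE : sec f y u v t = phi t - phi 0.
    rewrite /sec /phi !scale0r !addr0 (addrAC y (t *: v)).
    by set a := f _; set b := f _; set c := f _; clear; ring.
  have dphi s : 0 <= s <= t -> is_derive s 1 phi (g (y + t *: v + s *: u) - g (y + s *: u)).
    move=> st; apply: is_deriveB; apply: derive_line.
      have [_] := Hd _ (small s t st (introT andP (conj (ltW t0) (lexx t)))).
      by rewrite /= addrA addrAC.
    have [_] := Hd _ (small s 0 st (introT andP (conj (lexx 0) (ltW t0)))).
    by rewrite /= scale0r addr0.
  have [|||c cin cE] := @MVT R phi (fun s => g (y + t *: v + s *: u) - g (y + s *: u)) 0 t.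
  - exact: t0.
  - by move=> s; rewrite in_itv /= => /andP[s0 st]; apply: dphi; rewrite !ltW.
  - apply: continuous_in_subspaceT => s; rewrite inE /= in_itv /= => st.
    by apply: differentiable_continuous; apply/derivable1_diffP; case: (dphi s st).
  - by exists c => //; rewrite sE cE subr0 addrA addrAC.
have /andP[c0 ct'] : 0 < c < t by move: ct; rewrite in_itv.
have cle : 0 <= c <= t by rewrite !ltW.
have [r1 _] := Hd _ (small c t cle (introT andP (conj (ltW t0) (lexx t)))).
have [r2 _] := Hd _ (small c 0 cle (introT andP (conj (lexx 0) (ltW t0)))).
move: r2; rewrite scale0r addr0 => r2; move: r1.
rewrite derive_dirD// (derive_dirZ t)// => r1; rewrite E.
set D := 'D_v g y in r1 *; set D' := 'D_(c *: u) g y in r1 r2 *.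
set g1 := g (y + (c *: u + t *: v)) in r1 *; set g2 := g (y + c *: u) in r2 *.
have -> : (g1 - g2) * t - t ^+ 2 * D =
  t * ((g1 - g y - (D' + t *: D)) - (g2 - g y - D')).
  by rewrite /GRing.scale/=; clear; ring.
rewrite normrM gtr0_norm//.
have -> : e * t ^+ 2 = t * (e / M * (t * M)) by rewrite (mulrC t M) (mulrA (e / M)) divfK ?gt_eqF// expr2 mulrCA.
apply: ler_wpM2l; first exact: ltW.
apply: le_trans (ler_normB _ _) _; apply: le_trans (lerD r1 r2) _.
rewrite -mulrDr; apply: ler_wpM2l; first exact: ltW.
have := ler_normD (c *: u) (t *: v); rewrite !normrZ !gtr0_norm// => h1.
have h2 := ler_wpM2r (normr_ge0 u) (ltW ct').
apply: le_trans (lerD h1 (lexx _)) _; rewrite /M !mulrDr mulr1 mulrCA.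
by move: h2 t0; clear; set a := t * `|u|; set b := t * `|v|; set b' := c * `|u|; lra.
Unshelve. all: by end_near. Qed.

(** For small [t > 0], [t ^+ 2] times either mixed derivative is within [e / 2 * t ^+ 2] of the same
    number [sec f y u v t]. *)
Lemma young (f : V -> R) y u v :
  (\forall z \near y, differentiable f z) -> differentiable ('D_u f) y ->
  differentiable ('D_v f) y -> 'D_v ('D_u f) y = 'D_u ('D_v f) y.
Proof.
move=> df du dv; apply/eqP; rewrite -subr_eq0 -normr_le0.
apply/ler_addgt0Pl => e e0; rewrite addr0.
have e2 : 0 < e / 2 by rewrite divr_gt0.
have H1 := second_difference v e2 df du.
have H2 := second_difference u e2 df dv.
have Hex : \forall t \near (0 : R)^'+,
    [/\ `|sec f y u v t - t ^+ 2 * 'D_v ('D_u f) y| <= e / 2 * t ^+ 2,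
       `|sec f y v u t - t ^+ 2 * 'D_u ('D_v f) y| <= e / 2 * t ^+ 2 & 0 < t].
  apply: filter_app H1; apply: filter_app H2; apply: filterS (nbhs_right_gt (0 : R)).
  by move=> t t0 h2 h1; split; [exact: h1|exact: h2|exact: t0].
have [t [h1 h2 t0]] := @filter_ex _ _ (at_right_proper_filter (0 : R)) _ Hex.
have sE : sec f y v u t = sec f y u v t.
  by rewrite /sec (addrAC y (t *: v)); set a := f _; set b := f _; set c := f _; clear; ring.
rewrite sE in h2; set a := 'D_v _ _ in h1 *; set b := 'D_u _ _ in h2 *.
have : t ^+ 2 * `|a - b| <= t ^+ 2 * e.
  rewrite -[X in X * `|_|]gtr0_norm ?exprn_gt0// -normrM.
  have -> : t ^+ 2 * (a - b) = (sec f y u v t - t ^+ 2 * b) - (sec f y u v t - t ^+ 2 * a) by clear; ring.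
  apply: le_trans (ler_normB _ _) _; apply: le_trans (lerD h2 h1) _.
  by clear; lra.
by rewrite ler_pM2l ?exprn_gt0.
Qed.

Lemma young_mx k l (f : V -> 'M[R]_(k, l)) y u v :
  (\forall z \near y, differentiable f z) -> differentiable ('D_u f) y ->
  differentiable ('D_v f) y -> 'D_v ('D_u f) y = 'D_u ('D_v f) y.
Proof.
move=> df du dv; apply/matrixP => i j.
have Ew w : \forall z \near y, ('D_w f) z i j = 'D_w (fun z => f z i j) z.
  by apply: filterS df => z dz; rewrite derive_entry.
have dw w : differentiable ('D_w f) y -> differentiable ('D_w (fun z => f z i j)) y.
  by move=> /differentiable_mxP/(_ i j); apply: near_eq_differentiable.
have E w w' : differentiable ('D_w f) y ->
    'D_w' ('D_w f) y i j = 'D_w' ('D_w (fun z => f z i j)) y.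
  by move=> dd; apply: etrans (derive_entry w' i j dd) (near_eq_derive _ (Ew w)).
apply: etrans (E u v du) (etrans _ (esym (E v u dv))).
apply: young; [|exact: (dw u du)|exact: (dw v dv)].
by apply: filterS df => z /differentiable_mxP.
Qed.

End Young.

(** * Stability of smoothness under differentiation *)

Section Smooth.
Variables (R : realType) (d : nat) (U : set 'rV[R]_d).
Hypothesis oU : open U.

Lemma smooth_on_differentiable (f : 'rV[R]_d -> R) y :
  smooth_on U f -> U y -> differentiable f y.
Proof. by move=> sf Uy; exact: (sf [::] y Uy). Qed.

Lemma derive_partial (W : normedModType R) (f : 'rV[R]_d -> W) y v :
  differentiable f y ->
  'D_v f y = \sum_i v 0 i *: 'D_(delta_mx 0 i) f y.
Proof.
by move=> df; rewrite {1}(row_sum_delta v) derive_dir_sum.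
Qed.

(** [iter_partial] applies the head of the list last, so a derivative taken first is appended by
    [rcons]; no partial derivatives have to be exchanged. *)
Lemma smooth_on_derive (f : 'rV[R]_d -> R) v :
  smooth_on U f -> smooth_on U ('D_v f).
Proof.
move=> sf.
have H s y : U y -> iter_partial s ('D_v f) y =
    \sum_i v 0 i * iter_partial (rcons s i) f y.
  elim: s y => [|i s IHs] y Uy /=.
    by rewrite derive_partial//; exact: (sf [::]).
  have near_E : \forall z \near y, iter_partial s ('D_v f) z =
      \sum_j v 0 j * iter_partial (rcons s j) f z.
    by near=> z; apply: IHs; near: z; exact: open_nbhs_nbhs.
  rewrite (near_eq_derive _ near_E) derive_big_sum; last first.
    move=> j; apply: differentiableM; first exact: differentiable_cst.
    exact: sf.
  apply: eq_bigr => j _.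
  by apply: (deriveZ (v 0 j)); apply: diff_derivable; exact: sf.
move=> s y Uy; apply: (@near_eq_differentiable _ _ _ (fun z =>
    \sum_j v 0 j * iter_partial (rcons s j) f z)).
  by near=> z; apply/esym/H; near: z; exact: open_nbhs_nbhs.
apply: differentiable_big_sum => j _; apply: differentiableM.
  exact: differentiable_cst.
exact: sf.
Unshelve. all: by end_near. Qed.

Lemma smooth_mx_differentiable k l (f : 'rV[R]_d -> 'M[R]_(k, l)) y :
  smooth_mx_on U f -> U y -> differentiable f y.
Proof.
move=> sf Uy; apply/differentiable_mxP => i j.
exact: smooth_on_differentiable.
Qed.

(** Identities such as [push F z u = 'D_u F z] hold on the open set only, while [smooth_on] speaks
    of total functions. *)
Lemma smooth_on_eq (f g : 'rV[R]_d -> R) :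
  (forall y, U y -> f y = g y) -> smooth_on U f -> smooth_on U g.
Proof.
move=> fg sf.
have H s y : U y -> iter_partial s f y = iter_partial s g y.
  elim: s y => [|i s IHs] y Uy /=; first exact: fg.
  apply: near_eq_derive; near=> z; apply: IHs; near: z; exact: open_nbhs_nbhs.
move=> s y Uy; apply: near_eq_differentiable (sf s y Uy).
by near=> z; apply: H; near: z; exact: open_nbhs_nbhs.
Unshelve. all: by end_near. Qed.

Lemma smooth_mx_derive k l (f : 'rV[R]_d -> 'M[R]_(k, l)) v :
  smooth_mx_on U f -> smooth_mx_on U ('D_v f).
Proof.
move=> sf i j; apply: smooth_on_eq (smooth_on_derive v (sf i j)) => y Uy.
by rewrite derive_entry//; exact: smooth_mx_differentiable.
Qed.

Lemma smooth_mx_young k l (f : 'rV[R]_d -> 'M[R]_(k, l)) u v y :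
  smooth_mx_on U f -> U y -> 'D_v ('D_u f) y = 'D_u ('D_v f) y.
Proof.
move=> sf Uy; apply: young_mx.
- near=> z; apply: smooth_mx_differentiable => //; near: z; exact: open_nbhs_nbhs.
- by apply: smooth_mx_differentiable => //; exact: smooth_mx_derive.
- by apply: smooth_mx_differentiable => //; exact: smooth_mx_derive.
Unshelve. all: by end_near. Qed.

End Smooth.

#[local] Opaque derive.

(** * Levi-Civita connection in a chart *)

(** Matrix products and derivatives become opaque atoms; what remains is an identity in an abelian
    group, checked entry by entry. *)
Ltac mx_abel :=
  repeat match goal with |- context [@mulmx ?r ?a ?b ?c ?A ?B] =>
    let x := fresh in set x := (@mulmx r a b c A B); clearbody x end;
  repeat match goal with |- context [@derive ?r ?v ?w ?f ?a ?x] =>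
    let x' := fresh in set x' := (@derive r v w f a x); clearbody x' end;
  apply/matrixP => ? ?; rewrite ?(mx_addE, mx_oppE, mx_scaleE, mx_zeroE); ring.

Section BilinearForm.
Variables (R : realType) (d : nat) (B : 'M[R]_d).
Implicit Types u v w : 'rV[R]_d.

Lemma ipDl u v w : ip B (u + v) w = ip B u w + ip B v w.
Proof. by rewrite /ip !mulmxDl mxE. Qed.
Lemma ipDr u v w : ip B w (u + v) = ip B w u + ip B w v.
Proof. by rewrite /ip linearD mulmxDr mxE. Qed.
Lemma ipNl u w : ip B (- u) w = - ip B u w.
Proof. by rewrite /ip !mulNmx mxE. Qed.
Lemma ipNr u w : ip B w (- u) = - ip B w u.
Proof. by rewrite /ip linearN mulmxN mxE. Qed.
Lemma ipZl a u w : ip B (a *: u) w = a * ip B u w.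
Proof. by rewrite /ip -!scalemxAl mxE. Qed.
Lemma ipZr a u w : ip B w (a *: u) = a * ip B w u.
Proof. by rewrite /ip linearZ -scalemxAr mxE. Qed.
Lemma ip0l w : ip B 0 w = 0.
Proof. by rewrite /ip !mul0mx mxE. Qed.
Lemma ip0r w : ip B w 0 = 0.
Proof. by rewrite /ip trmx0 mulmx0 mxE. Qed.
Lemma ip_sumr (I : Type) (s : seq I) (F : I -> 'rV[R]_d) w :
  ip B w (\sum_(i <- s) F i) = \sum_(i <- s) ip B w (F i).
Proof.
by elim: s => [|i s IH]; rewrite ?(big_nil, big_cons) ?ip0r// ipDr IH.
Qed.

Definition ip_lin := (ipDl, ipDr, ipNl, ipNr, ipZl, ipZr, ip0l, ip0r).

Lemma ip_sym u v : B^T = B -> ip B u v = ip B v u.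
Proof.
by move=> sB; rewrite /ip -[in LHS](trmxK (u *m B *m v^T)) mxE !trmx_mul trmxK sB mulmxA.
Qed.

Lemma ip_eq u v : (forall w, w != 0 -> 0 < ip B w w) ->
  (forall w, ip B u w = ip B v w) -> u = v.
Proof.
move=> pB H; apply/eqP; rewrite -subr_eq0; apply/eqP/eqP/negPn/negP => /pB.
by rewrite ipDl ipNl H subrr ltxx.
Qed.

Lemma posdef_unitmx : (forall w, w != 0 -> 0 < ip B w w) -> B \in unitmx.
Proof.
move=> pB; rewrite -row_free_unit -kermx_eq0; apply/eqP/row_matrixP => i.
rewrite row0; apply/eqP/negPn/negP => /pB; rewrite /ip.
have /sub_kermxP -> : (row i (kermx B) <= kermx B)%MS by exact: row_sub.
by rewrite mul0mx mxE ltxx.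
Qed.

End BilinearForm.

Lemma ip_congr (R : realType) d k (B : 'M[R]_d) (E : 'M[R]_(k, d)) u v :
  ip (E *m B *m E^T) u v = ip B (u *m E) (v *m E).
Proof. by rewrite /ip trmx_mul !mulmxA. Qed.

Section LeviCivita.
Variables (R : realType) (d : nat) (U : set 'rV[R]_d).
Hypothesis oU : open U.
Variable G : 'rV[R]_d -> 'M[R]_d.
Hypothesis sG : smooth_mx_on U G.
Hypothesis symG : forall z, U z -> (G z)^T = G z.
Hypothesis posG : forall z, U z -> forall v : 'rV[R]_d, v != 0 -> 0 < ip (G z) v v.
Implicit Types (u v w : 'rV[R]_d) (y z : 'rV[R]_d).

(** The connection form in the direction [u]. With it, covariant derivatives and curvature become
    matrix expressions that need no index computations. *)
Definition Gam u y : 'M[R]_d := \matrix_(j, k) \sum_i u 0 i * christoffel G y i j k.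

Lemma christoffel_termE y u v : christoffel_term G y u v = v *m Gam u y.
Proof.
apply/rowP => k; rewrite !mxE exchange_big; apply: eq_bigr => j _.
rewrite mxE mulr_sumr; apply: eq_bigr => i _; ring.
Qed.

Lemma GamD u v y : Gam (u + v) y = Gam u y + Gam v y.
Proof.
apply/matrixP => j k; rewrite !mxE -big_split; apply: eq_bigr => i _.
by rewrite /= !mxE mulrDl.
Qed.

Lemma GamZ a u y : Gam (a *: u) y = a *: Gam u y.
Proof.
apply/matrixP => j k; rewrite !mxE mulr_sumr; apply: eq_bigr => i _.
by rewrite /= !mxE mulrA.
Qed.

Lemma Gam0 y : Gam 0 y = 0.
Proof. by rewrite -(scale0r (0 : 'rV_d)) GamZ scale0r. Qed.

Lemma Gam_sum (I : Type) (s : seq I) (a : I -> R) (u : I -> 'rV[R]_d) y :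
  Gam (\sum_(i <- s) a i *: u i) y = \sum_(i <- s) a i *: Gam (u i) y.
Proof.
elim: s => [|i s IH]; first by rewrite !big_nil Gam0.
by rewrite !big_cons GamD GamZ IH.
Qed.

Lemma nbhsU y : U y -> \forall z \near y, U z.
Proof. by move=> Uy; exact: open_nbhs_nbhs. Qed.

Lemma metric_unit y : U y -> G y \in unitmx.
Proof. by move=> Uy; apply: posdef_unitmx; exact: posG. Qed.

Lemma dG_sym y i j l : U y ->
  'D_(delta_mx 0 l) (fun z => G z i j) y = 'D_(delta_mx 0 l) (fun z => G z j i) y.
Proof.
move=> Uy; apply: near_eq_derive; apply: filterS (nbhsU Uy) => z Uz.
by rewrite -[in LHS](symG Uz) mxE.
Qed.

Lemma christoffel_sym y i j k : U y -> christoffel G y i j k = christoffel G y j i k.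
Proof.
move=> Uy; rewrite /christoffel; congr (_ * _); apply: eq_bigr => l _.
by rewrite (dG_sym i j l Uy) [X in X - _]addrC.
Qed.

Lemma Gam_sym u v y : U y -> v *m Gam u y = u *m Gam v y.
Proof.
move=> Uy; rewrite -!christoffel_termE; apply/rowP => k; rewrite !mxE exchange_big.
apply: eq_bigr => j _; apply: eq_bigr => i _.
by rewrite (christoffel_sym _ _ _ Uy) (mulrC (u 0 _)).
Qed.

(** Lowering the index cancels [invmx (G y)] and leaves the Christoffel symbols of the first kind;
    in [metric_compat] their sum with the transpose retains only the derivative of [G]. *)
Lemma Gam_lower u y j m : U y -> (Gam u y *m G y) j m =
  \sum_i u 0 i * (2^-1 * ('D_(delta_mx 0 i) (fun z => G z j m) y
     + 'D_(delta_mx 0 j) (fun z => G z i m) y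
     - 'D_(delta_mx 0 m) (fun z => G z i j) y)).
Proof.
move=> Uy; rewrite mxE; under eq_bigr => k _ do rewrite mxE mulr_suml.
rewrite exchange_big; apply: eq_bigr => i _ /=.
under eq_bigr => k _ do rewrite -mulrA.
rewrite -mulr_sumr; congr (_ * _); rewrite /christoffel.
pose F l := 'D_(delta_mx 0 i) (fun z => G z j l) y
     + 'D_(delta_mx 0 j) (fun z => G z i l) y
     - 'D_(delta_mx 0 l) (fun z => G z i j) y.
rewrite -[X in _ * X]/(F m).
transitivity (2^-1 * \sum_l (\sum_k (invmx (G y)) k l * G y k m) * F l).
  rewrite mulr_sumr; under [RHS]eq_bigr => l _ do rewrite mulr_suml mulr_sumr.
  rewrite exchange_big; apply: eq_bigr => k _ /=.
  rewrite -mulrA mulr_suml mulr_sumr; apply: eq_bigr => l _; rewrite -/(F l); ring.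
congr (_ * _).
have D l : \sum_k (invmx (G y)) k l * G y k m = (m == l)%:R.
  have /matrixP/(_ m l) := mulmxV (metric_unit Uy); rewrite !mxE => E.
  apply: etrans E; apply: eq_bigr => k _; rewrite mulrC; congr (_ * _).
  by rewrite -[in LHS](symG Uy) mxE.
under eq_bigr => l _ do rewrite D.
rewrite (bigD1 m)//= eqxx mul1r big1 ?addr0// => l lm.
by rewrite eq_sym (negbTE lm) mul0r.
Qed.

Lemma dG y : U y -> differentiable G y.
Proof. exact: smooth_mx_differentiable. Qed.

Lemma metric_compat u y : U y ->
  'D_u G y = Gam u y *m G y + G y *m (Gam u y)^T.
Proof.
move=> Uy; apply/matrixP => j m; rewrite mx_addE.
have -> : G y *m (Gam u y)^T = (Gam u y *m G y)^T by rewrite trmx_mul symG.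
rewrite [X in _ + X]mxE !Gam_lower// (derive_partial _ (dG Uy)) summxE -big_split.
apply: eq_bigr => i _; rewrite mx_scaleE /= derive_entry; last exact: dG.
by rewrite (dG_sym m j i Uy); field.
Qed.

Lemma differentiable_Gam u y : U y -> differentiable (Gam u) y.
Proof.
move=> Uy; apply/differentiable_mxP => j k; under eq_fun do rewrite mxE.
apply: differentiable_big_sum => i _; apply: differentiableM.
  exact: differentiable_cst.
apply: differentiableM; first exact: differentiable_cst.
apply: differentiable_big_sum => l _; apply: differentiableM.
  have /differentiable_mxP : differentiable (fun z => invmx (G z)) y; last exact.
  apply: differentiable_invmx; last exact: dG.
  by apply: filterS (nbhsU Uy) => z; exact: metric_unit.
have H a b c : differentiable ('D_(delta_mx 0 a) (fun z => G z b c)) y.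
  exact: smooth_on_differentiable (smooth_on_derive oU _ (sG b c)) Uy.
by apply: differentiableB; first apply: differentiableD.
Qed.

(** Covariant derivatives of a vector field and of an endomorphism field; the latter is dictated by
    the Leibniz rule [rcov_mulmx]. [Om] is the curvature form [d omega + omega ^ omega].
    Endomorphisms act on the right, so products appear in the order opposite to the usual one. *)
Definition rcov u (X : 'rV[R]_d -> 'rV[R]_d) y := 'D_u X y + X y *m Gam u y.
Definition mcov u (A : 'rV[R]_d -> 'M[R]_d) y :=
  'D_u A y + A y *m Gam u y - Gam u y *m A y.
Definition Om u v y := 'D_u (Gam v) y - 'D_v (Gam u) y
  + Gam v y *m Gam u y - Gam u y *m Gam v y.

Lemma differentiable_cst_mulmx (k l : nat) (w : 'M[R]_(k, d))
    (A : 'rV[R]_d -> 'M[R]_(d, l)) y :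
  differentiable A y -> differentiable (fun z => w *m A z) y.
Proof. by apply: differentiable_mulmx; exact: differentiable_cst. Qed.

Lemma derive_cst_mulmx (k l : nat) (w : 'M[R]_(k, d))
    (A : 'rV[R]_d -> 'M[R]_(d, l)) u y : differentiable A y ->
  'D_u (fun z => w *m A z) y = w *m 'D_u A y :> 'M[R]_(k, l).
Proof.
move=> dA; rewrite (@derive_mulmx _ _ _ _ _ (cst w) A)//.
by rewrite derive_cst mul0mx add0r.
Qed.

Lemma rcov_mulmx u X A y : differentiable X y -> differentiable A y ->
  rcov u (fun z => X z *m A z) y = rcov u X y *m A y + X y *m mcov u A y.
Proof.
move=> dX dA; rewrite /rcov /mcov derive_mulmx// !(mulmxDl, mulmxDr, mulmxN, mulmxA).
mx_abel.
Qed.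

Lemma rcov_cst_mulmx u w A y : differentiable A y ->
  rcov u (fun z => w *m A z) y = w *m Gam u y *m A y + w *m mcov u A y.
Proof.
move=> dA; rewrite (@rcov_mulmx u (cst w))//.
by rewrite /rcov derive_cst add0r.
Qed.

Lemma mcov_mulmx u A B y : differentiable A y -> differentiable B y ->
  mcov u (fun z => A z *m B z) y = mcov u A y *m B y + A y *m mcov u B y.
Proof.
move=> dA dB; rewrite /mcov derive_mulmx//.
rewrite !(mulmxDl, mulmxDr, mulmxN, mulNmx, mulmxA); mx_abel.
Qed.

Lemma mcovD u A B y : differentiable A y -> differentiable B y ->
  mcov u (fun z => A z + B z) y = mcov u A y + mcov u B y.
Proof.
move=> dA dB; rewrite /mcov deriveD; [|exact: diff_derivable..].
rewrite !(mulmxDl, mulmxDr); mx_abel.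
Qed.

Lemma mcov_near u A B y : (\forall z \near y, A z = B z) -> mcov u A y = mcov u B y.
Proof.
by move=> AB; rewrite /mcov (near_eq_derive _ AB) (nbhs_singleton AB).
Qed.

Lemma rcov_near u A B y : (\forall z \near y, A z = B z) -> rcov u A y = rcov u B y.
Proof.
by move=> AB; rewrite /rcov (near_eq_derive _ AB) (nbhs_singleton AB).
Qed.

(** The parameter space and the matrix [Gu] are left free so that one computation serves both the
    ambient chart and fields along an immersion. *)
Lemma derive_form k (W : 'rV[R]_k) (B : 'rV[R]_k -> 'M[R]_d) (X Y : 'rV[R]_k -> 'rV[R]_d)
    (y : 'rV[R]_k) (Gu : 'M[R]_d) :
  differentiable B y -> differentiable X y -> differentiable Y y ->
  'D_W B y = Gu *m B y + B y *m Gu^T ->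
  'D_W (fun z : 'rV[R]_k => ip (B z) (X z) (Y z)) y =
  ip (B y) ('D_W X y + X y *m Gu) (Y y) + ip (B y) (X y) ('D_W Y y + Y y *m Gu).
Proof.
move=> dB dX dY E.
have dXB : differentiable (fun z : 'rV[R]_k => X z *m B z) y by exact: differentiable_mulmx.
have dYt : differentiable (fun z : 'rV[R]_k => (Y z)^T) y by exact: differentiable_trmx.
rewrite /ip -derive_entry; last exact: differentiable_mulmx.
rewrite derive_mulmx// derive_mulmx// derive_trmx// E mx_trD trmx_mul.
rewrite !(mulmxDl, mulmxDr, mulmxA) -!mx_addE; congr (fun_of_matrix _ 0 0); mx_abel.
Qed.

Lemma derive_metric u X Y y : U y -> differentiable X y -> differentiable Y y ->
  'D_u (fun z => ip (G z) (X z) (Y z)) y =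
  ip (G y) (rcov u X y) (Y y) + ip (G y) (X y) (rcov u Y y).
Proof.
by move=> Uy dX dY; apply: derive_form => //; [exact: dG|exact: metric_compat].
Qed.

Lemma lc_curvatureE y u v w : U y -> lc_curvature G y u v w = w *m Om u v y.
Proof.
move=> Uy; have E a : levi_civita G (cst a) (cst w) = fun z => w *m Gam a z.
  by apply/funext => z; rewrite /levi_civita derive_cst add0r christoffel_termE.
rewrite /lc_curvature /curvature !E /levi_civita !christoffel_termE.
rewrite !derive_cst_mulmx; [|exact: differentiable_Gam..].
rewrite /bracket !derive_cst subrr Gam0 mulmx0 /Om.
rewrite !(mulmxDr, mulmxN, mulmxA); mx_abel.
Qed.

Lemma Om_skew u v y : Om v u y = - Om u v y.
Proof. by rewrite /Om; mx_abel. Qed.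

Lemma smooth_Gam_sym u v w y : U y -> w *m 'D_u (Gam v) y = v *m 'D_u (Gam w) y.
Proof.
move=> Uy; rewrite -!derive_cst_mulmx; [|exact: differentiable_Gam..].
by apply: near_eq_derive; apply: filterS (nbhsU Uy) => z; exact: Gam_sym.
Qed.

(** Torsion-freeness cancels the quadratic terms, and its derivative [smooth_Gam_sym] cancels the
    terms with derivatives of [Gam]. *)
Lemma bianchi u v w y : U y ->
  w *m Om u v y + u *m Om v w y + v *m Om w u y = 0.
Proof.
move=> Uy; rewrite /Om !(mulmxDr, mulmxN, mulmxA).
rewrite (smooth_Gam_sym u v w Uy) (smooth_Gam_sym v w u Uy) (smooth_Gam_sym w u v Uy).
rewrite (Gam_sym u v Uy) (Gam_sym u w Uy) (Gam_sym v w Uy).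
mx_abel.
Qed.

(** The second derivatives of [G] commute; expanding both orders by [metric_compat] leaves exactly
    this identity. *)
Lemma Om_G_skew u v y : U y -> Om u v y *m G y + G y *m (Om u v y)^T = 0.
Proof.
move=> Uy; have := smooth_mx_young oU u v sG Uy.
have E a b : 'D_b ('D_a G) y = 'D_b (Gam a) y *m G y + Gam a y *m (Gam b y *m G y + G y *m (Gam b y)^T) +
   ((Gam b y *m G y + G y *m (Gam b y)^T) *m (Gam a y)^T + G y *m ('D_b (Gam a) y)^T).
  have N : \forall z \near y, 'D_a G z = Gam a z *m G z + G z *m (Gam a z)^T.
    by apply: filterS (nbhsU Uy) => z; exact: metric_compat.
  have dg := differentiable_Gam a Uy; have dgt := differentiable_trmx dg.
  have dGy := dG Uy.
  rewrite (near_eq_derive _ N) deriveD; last 2 first.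
  - by apply: diff_derivable; exact: differentiable_mulmx.
  - by apply: diff_derivable; exact: differentiable_mulmx.
  rewrite (derive_mulmx b dg dGy) (derive_mulmx b dGy dgt) (derive_trmx b dg).
  by rewrite (metric_compat b Uy).
rewrite (E u v) (E v u) /Om => /eqP; rewrite -subr_eq0 => /eqP H.
apply: oppr_inj; rewrite oppr0 -[RHS]H.
rewrite !(mx_trD, mx_trN) !trmx_mul.
rewrite !(mulmxDl, mulmxDr, mulmxN, mulNmx, mulmxA); mx_abel.
Qed.

Lemma Om_ip_skew u v w z y : U y ->
  ip (G y) (w *m Om u v y) z = - ip (G y) w (z *m Om u v y).
Proof.
move=> Uy; apply/eqP; rewrite -subr_eq0 opprK /ip trmx_mul !mulmxA -mx_addE -mulmxDl.
have -> : w *m Om u v y *m G y + w *m G y *m (Om u v y)^T = 0.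
  by rewrite -!mulmxA -mulmxDr Om_G_skew// mulmx0.
by rewrite mul0mx mxE.
Qed.

(** The directions have constant components, so their bracket vanishes and the commutator needs no
    correction term. *)
Lemma ricci_identity_row X u v y : U y -> smooth_mx_on U X ->
  rcov u (rcov v X) y - rcov v (rcov u X) y = X y *m Om u v y.
Proof.
move=> Uy sX.
have dX z : U z -> differentiable X z by exact: smooth_mx_differentiable.
have dDX a : differentiable ('D_a X) y.
  by apply: smooth_mx_differentiable Uy; exact: smooth_mx_derive.
have E a b : 'D_b (rcov a X) y =
    'D_b ('D_a X) y + ('D_b X y *m Gam a y + X y *m 'D_b (Gam a) y).
  have dg := differentiable_Gam a Uy.
  rewrite /rcov deriveD; [|exact: diff_derivable|]; last first.
    by apply: diff_derivable; apply: differentiable_mulmx => //; exact: dX.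
  by rewrite derive_mulmx//; exact: dX.
rewrite {1 3}/rcov !E (smooth_mx_young oU u v sX Uy) /rcov /Om.
rewrite !(mulmxDl, mulmxDr, mulmxN, mulNmx, mulmxA); mx_abel.
Qed.

Lemma ricci_identity_mx A u v y : U y -> smooth_mx_on U A ->
  mcov u (mcov v A) y - mcov v (mcov u A) y = A y *m Om u v y - Om u v y *m A y.
Proof.
move=> Uy sA.
have dA z : U z -> differentiable A z by exact: smooth_mx_differentiable.
have dDA a : differentiable ('D_a A) y.
  by apply: smooth_mx_differentiable Uy; exact: smooth_mx_derive.
have E a b : 'D_b (mcov a A) y = 'D_b ('D_a A) y
    + ('D_b A y *m Gam a y + A y *m 'D_b (Gam a) y)
    - ('D_b (Gam a) y *m A y + Gam a y *m 'D_b A y).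
  have dg := differentiable_Gam a Uy; have dAy := dA y Uy.
  have d1 : differentiable (fun z => A z *m Gam a z) y by exact: differentiable_mulmx.
  have d2 : differentiable (fun z => Gam a z *m A z) y by exact: differentiable_mulmx.
  rewrite /mcov deriveB; [|apply: diff_derivable; exact: differentiableD|exact: diff_derivable].
  by rewrite deriveD ?derive_mulmx//; exact: diff_derivable.
rewrite {1 3}/mcov !E (smooth_mx_young oU u v sA Uy) /mcov /Om.
rewrite !(mulmxDl, mulmxDr, mulmxN, mulNmx, mulmxA); mx_abel.
Qed.

End LeviCivita.

(** * Contact metric structures at a point *)

Section InnerProduct.
Variables (R : realFieldType) (V : lmodType R) (g : V -> V -> R).

(** Definiteness is recorded as nondegeneracy, the form in which the pointwise algebra uses it:
    vectors are compared by pairing them with an arbitrary [w]. *)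
Definition inner_product :=
  [/\ forall u v w, g (u + v) w = g u w + g v w,
      forall a u w, g (a *: u) w = a * g u w,
      forall u v, g u v = g v u &
      forall u v, (forall w, g u w = g v w) -> u = v].

Hypothesis gP : inner_product.

Lemma g_sym u v : g u v = g v u. Proof. by case: gP. Qed.
Lemma g_inj u v : (forall w, g u w = g v w) -> u = v. Proof. by case: gP => _ _ _; apply. Qed.
Lemma gDl u v w : g (u + v) w = g u w + g v w. Proof. by case: gP. Qed.
Lemma gZl a u w : g (a *: u) w = a * g u w. Proof. by case: gP. Qed.
Lemma gDr u v w : g w (u + v) = g w u + g w v.
Proof. by rewrite !(g_sym w) gDl. Qed.
Lemma gZr a u w : g w (a *: u) = a * g w u.
Proof. by rewrite !(g_sym w) gZl. Qed.
Lemma g0l w : g 0 w = 0. Proof. by rewrite -(scale0r (0 : V)) gZl mul0r. Qed.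
Lemma g0r w : g w 0 = 0. Proof. by rewrite g_sym g0l. Qed.
Lemma gNl u w : g (- u) w = - g u w. Proof. by rewrite -scaleN1r gZl mulN1r. Qed.
Lemma gNr u w : g w (- u) = - g w u. Proof. by rewrite g_sym gNl g_sym. Qed.

Definition gE := (gDl, gDr, gZl, gZr, gNl, gNr, g0l, g0r).

End InnerProduct.

(** * Pointwise identities leading to the formula for [nabla phi] *)

Section AlmostContact.
Variables (R : realFieldType) (V : lmodType R) (g : V -> V -> R).
Hypothesis gP : inner_product g.
Variables (J : {linear V -> V}) (xi : V).
Hypothesis J2 : forall v, J (J v) = - v + g v xi *: xi.
Hypothesis xi_unit : g xi xi = 1.
Hypothesis Jxi : J xi = 0.
Hypothesis Jskew : forall u v, g (J u) v = - g u (J v).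

Local Notation gE := (gE gP).
Local Notation g_sym := (g_sym gP).
Local Notation g_inj := (g_inj gP).

Lemma Jhor u : g (J u) xi = 0.
Proof. by rewrite Jskew Jxi gE oppr0. Qed.

(** First-order data of a contact metric structure at a point:
    [A u = nabla_u xi] and [nJ u v = (nabla_u phi) v]. *)
Variables (A S : {linear V -> V}) (nJ : V -> {linear V -> V}).
Hypothesis SE : forall u, S u = A u + J u.
Hypothesis Ahor : forall u, g (A u) xi = 0.
Hypothesis A_alt : forall u v, g (A u) v - g (A v) u = 2 * g u (J v).
Hypothesis nJ_skew : forall u v w, g (nJ u v) w = - g v (nJ u w).
Hypothesis nJ_cyc : forall u v w, g (nJ u v) w + g (nJ v w) u + g (nJ w u) v = 0.
Hypothesis nJ_J : forall u v,
  J (nJ u v) + nJ u (J v) = g (A u) v *: xi + g v xi *: A u.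
Hypothesis nJ_xi : forall u, nJ u xi = - J (A u).

(** The integral curves of [xi] are geodesics: in [A_alt] at [xi] the terms [g (A w) xi] and
    [g xi (J w)] both vanish. *)
Lemma A_xi : A xi = 0.
Proof.
apply: g_inj => w; have := A_alt xi w; have := Ahor w; have := Jhor w.
by rewrite (g_sym xi) gE; lra.
Qed.

(** By [A_alt] the skew part of [A] is [- J], so [S = A + J] is its symmetric part. *)
Lemma S_sym u v : g (S u) v = g u (S v).
Proof.
rewrite !SE !gE; have := A_alt u v; have := Jskew u v; rewrite (g_sym u (A v)); lra.
Qed.

Lemma S_xi : S xi = 0.
Proof. by rewrite SE A_xi Jxi addr0. Qed.

Lemma Shor u : g (S u) xi = 0.
Proof. by rewrite S_sym S_xi gE. Qed.

(** This is the cyclic identity [nJ_cyc], i.e. the closedness of the fundamental form, with [xi] in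
    one slot. *)
Lemma nJ_xi_JS v : nJ xi v = - (J (S v) + S (J v)).
Proof.
have AE u : A u = S u - J u by rewrite SE addrK.
have JJ u w : g (J (J u)) w = g u (J (J w)) by rewrite !Jskew opprK.
apply: g_inj => w; have := nJ_cyc xi v w.
rewrite (nJ_skew v w xi) !nJ_xi !AE !linearB !gE (JJ w v).
rewrite [g (J (S w)) v]Jskew S_sym (g_sym (J (S v))) (g_sym (S (J v))); lra.
Qed.

(** The derivative of [phi^2 = -1 + eta (x) xi] along [xi] says that [nJ xi] anticommutes with [J].
    Inserting [nJ xi = - (J S + S J)] turns this into [J S J = S], and one more [J] gives the
    claim. *)
Lemma JS_anti v : J (S v) = - S (J v).
Proof.
have JSJ : J (S (J v)) = S v.
  have := nJ_J xi v; rewrite A_xi scaler0 gE scale0r addr0 !nJ_xi_JS => E.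
  apply: g_inj => w; have := congr1 (g ^~ w) E.
  have -> : J (- (J (S v) + S (J v))) = S v - J (S (J v)).
    by rewrite linearN linearD J2 Shor scale0r addr0 opprD opprK.
  have -> : S (J (J v)) = - S v by rewrite J2 linearD linearN linearZ /= S_xi scaler0 addr0.
  rewrite !gE; lra.
have := J2 (S (J v)); rewrite JSJ Shor scale0r addr0 => ->; by [].
Qed.

Lemma nJ_xi0 v : nJ xi v = 0.
Proof. by rewrite nJ_xi_JS JS_anti addNr oppr0. Qed.

Variable T : V -> V.
Hypothesis TE : forall u, T u = u + J (S u).

Lemma JS_sym u v : g (J (S u)) v = g u (J (S v)).
Proof. by rewrite Jskew S_sym JS_anti gE. Qed.

Lemma T_sym u v : g (T u) v = g u (T v).
Proof. by rewrite !TE !gE JS_sym. Qed.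

(** As [T = 1 + h'], this is the classical [nabla xi = - phi - phi h']. *)
Lemma J_T u : J (T u) = - A u.
Proof.
rewrite TE linearD J2 Shor scale0r addr0 -opprB; congr (- _).
by rewrite SE addrK.
Qed.

Lemma T_xi u : g (T u) xi = g u xi.
Proof. by rewrite TE !gE Jhor addr0. Qed.

Let b u v w := g (nJ u v) w - (g (T u) v * g w xi - g v xi * g (T u) w).

Let b_skew u v w : b u v w = - b u w v.
Proof. rewrite /b nJ_skew (g_sym v); ring. Qed.

Let b_cyc u v w : b u v w + b v w u + b w u v = 0.
Proof.
have := nJ_cyc u v w; rewrite /b (T_sym v w) (T_sym w u) (T_sym v u).
rewrite (g_sym v (T w)) (g_sym w (T u)) (g_sym v (T u)); lra.
Qed.

Let bD2 u v v' w : b u (v + v') w = b u v w + b u v' w.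
Proof. by rewrite /b linearD !gE; ring. Qed.

Let bZ2 u a v w : b u (a *: v) w = a * b u v w.
Proof. by rewrite /b linearZ !gE; ring. Qed.

Let b_xi u w : b u xi w = 0.
Proof.
rewrite /b nJ_xi gE.
have -> : J (A u) = T u - g u xi *: xi.
  have -> : A u = S u - J u by rewrite SE addrK.
  by rewrite linearB J2 TE opprD opprK addrA (addrC u).
by rewrite !gE xi_unit T_xi (g_sym xi); ring.
Qed.

Let bN2 u v w : b u (- v) w = - b u v w.
Proof. by rewrite -scaleN1r bZ2 mulN1r. Qed.

Let b_JJ u v w : b u (J (J v)) w = - b u v w.
Proof. by rewrite J2 bD2 bZ2 b_xi mulr0 addr0 bN2. Qed.

Let b_J u v w : b u (J v) w = b u v (J w).
Proof.
have := congr1 (g ^~ w) (nJ_J u v); rewrite !gE Jskew /b !Jhor.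
have E x : g (T u) (J x) = g (A u) x.
  by have := Jskew (T u) x; rewrite J_T gE; lra.
by rewrite !E (g_sym xi); lra.
Qed.

Let b_JJ3 u v w : b u (J v) (J w) = - b u v w.
Proof. by rewrite -b_J b_JJ. Qed.

(** Combines the cyclic identity with its versions where [J] sits in two of the three slots. It is
    the argument by which almost Kaehler structures are quasi-Kaehler; afterwards [J] moves freely
    between all slots of [b]. *)
Let b_quasi u v w : b (J u) (J v) w = - b u v w.
Proof.
have := b_cyc (J u) (J v) w; have := b_cyc (J u) v (J w).
have := b_cyc u (J v) (J w); have := b_cyc u v w.
rewrite !b_JJ3 -(b_J (J u) v w) -(b_J (J v) w u) -(b_J (J w) u v).
have := b_JJ3 v w u; have := b_JJ3 w u v; lra.
Qed.

Let b_J1 u v w : b (J u) v w = b u (J v) w.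
Proof. by have := b_quasi u (J v) w; rewrite b_JJ; lra. Qed.

(** [nS u v = (nabla_u S) v], [R3 u v = R(u, v) xi]. *)
Variables (nS : V -> {linear V -> V}) (kappa mu : R).
Hypothesis nS_sym : forall u v w, g (nS u v) w = g v (nS u w).
Hypothesis nS_xi : forall u, nS u xi = - S (A u).
Hypothesis nS_J : forall u v,
  nS u (J v) + S (nJ u v) + nJ u (S v) + J (nS u v) = 0.
Hypothesis Rxi : forall u v,
  (nS u v - nJ u v) - (nS v u - nJ v u) =
  kappa *: (g v xi *: u - g u xi *: v)
  + mu *: (g v xi *: J (S u) - g u xi *: J (S v)).

(** [Rxi] at [(u, xi)] expresses the Jacobi operator of [xi]. There [S^2] and the identity commute
    with [J], while [nS xi] and [J S] anticommute with it; comparing the equation for [u] with the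
    image under [J] of the one for [J u] isolates [S^2]. *)
Lemma S_square u : g u xi = 0 -> S (S u) = (1 - kappa) *: u.
Proof.
move=> hu.
have E x : g x xi = 0 -> - S (S x) + x - nS xi x = kappa *: x + mu *: J (S x).
  move=> hx; have := Rxi x xi; rewrite xi_unit hx !scale0r !subr0 !scale1r => <-.
  rewrite nJ_xi0 nS_xi nJ_xi.
  have -> : A x = S x - J x by rewrite SE addrK.
  rewrite !linearB J2 hx scale0r addr0 JS_anti; apply: g_inj => w; rewrite !gE; ring.
have hN : g (nS xi u) xi = 0 by rewrite nS_sym nS_xi A_xi linear0 oppr0 gE.
have NJ : nS xi (J u) = - J (nS xi u).
  by have /eqP := nS_J xi u; rewrite !nJ_xi0 linear0 !addr0 addr_eq0 => /eqP.
apply: g_inj => w; rewrite gE.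
have E1 := congr1 (g ^~ w) (E u hu).
have E2 : - J (S (S u)) + J u + J (nS xi u) = kappa *: J u + mu *: S u.
  have := E (J u) (Jhor u); rewrite NJ opprK.
  have -> : S (S (J u)) = J (S (S u)) by rewrite !JS_anti linearN opprK.
  have -> // : J (S (J u)) = S u.
  by rewrite JS_anti J2 hu scale0r addr0 linearN opprK.
have := congr1 (fun x => g (J x) w) E2.
rewrite !linearD linearN !linearZ /= !J2 hu hN Shor !scale0r !addr0 !gE.
by move: E1; rewrite !gE; lra.
Qed.

Let C u v w := g (nS u v) w.

(** A Codazzi equation: on the contact distribution [Rxi] has zero right-hand side, and the skew
    part of [nJ] is reduced to one value of [b] by [b_cyc]. *)
Let E1 u v w : g u xi = 0 -> g v xi = 0 -> C u v w - C v u w = - b w u v.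
Proof.
move=> hu hv; have := congr1 (g ^~ w) (Rxi u v).
rewrite hu hv !scale0r !subr0 !scaler0 addr0 !gE => E.
have := b_cyc u v w; rewrite (b_skew v w u) /C {1 2}/b hu hv (T_sym u v) (g_sym u); lra.
Qed.

Let E2 u v w : g v xi = 0 -> g w xi = 0 ->
  C u (J v) w - C u v (J w) = - b u v (S w) - b u (S v) w.
Proof.
move=> hv hw; have := congr1 (g ^~ w) (nS_J u v).
by rewrite !gE Jskew S_sym /C /b hv hw !Shor; lra.
Qed.

Let b_SJ u v w : g u xi = 0 -> g v xi = 0 -> g w xi = 0 -> b (S (J w)) u v = 0.
Proof.
move=> hu hv hw; have hJ := Jhor.
have e1 := E1 w hu hv; have e2 := E1 w (hJ u) (hJ v).
have e3 := E1 (J w) (hJ u) hv; have e4 := E1 (J w) hu (hJ v).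
have f1 := E2 u hv (hJ w); have f2 := E2 (J u) hv hw.
have f3 := E2 v hu (hJ w); have f4 := E2 (J v) hu hw.
have CJ x y : C x y (J (J w)) = - C x y w by rewrite J2 hw scale0r addr0 /C gE.
have bs x y : b (J x) y (S w) = - b x y (S (J w)).
  by rewrite b_J1 b_J JS_anti (b_skew x y) bN2 -b_skew.
have bs' x y : b (J x) (S y) w = b x (S y) (J w) by rewrite b_J1 b_J.
rewrite !CJ in f1 f3; rewrite !bs !bs' in f2 f4.
have q2 : b w (J u) (J v) = - b w u v by exact: b_JJ3.
have q3 : b (J w) (J u) v = - b w u v by exact: b_quasi.
have q4 : b (J w) u (J v) = - b w u v by rewrite -b_J b_quasi.
(* In [f1 - f3 - f2 + f4] the [C] terms add up to those of [e1 - e2 + e3 + e4], whose right-hand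
   sides cancel. What is left is [b u v (S (J w)) = b v u (S (J w))], which is the claim in view of
   this cyclic sum. *)
have := b_cyc (S (J w)) u v; rewrite (b_skew v).
move: e1 e2 e3 e4 f1 f2 f3 f4 q2 q3 q4; lra.
Qed.

Lemma nabla_phi u v : kappa != 1 \/ (forall u v, nS u v = 0) ->
  nJ u v = g (T u) v *: xi - g v xi *: T u.
Proof.
move=> cases.
suff b0 : forall x y z, b x y z = 0.
  apply: g_inj => w; rewrite !gE (g_sym xi); have := b0 u v w; rewrite /b; lra.
move=> x0 y0 z0; pose p v := v - g v xi *: xi.
have hp x : g (p x) xi = 0 by rewrite !gE xi_unit mulr1 subrr.
have p2 x y z : b x (p y) z = b x y z by rewrite bD2 bN2 bZ2 b_xi mulr0 oppr0 addr0.
have p3 x y z : b x y (p z) = b x y z by rewrite b_skew p2 -b_skew.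
have p1 x y z : b (p x) y z = b x y z.
  (* [xi] is known to be killed in the last two slots; the cyclic sum carries this to the first
     one. *)
  by have := b_cyc x y z; have := b_cyc (p x) y z; rewrite p2 p3; lra.
rewrite -p1 -p2 -p3; move: (p x0) (p y0) (p z0) (hp x0) (hp y0) (hp z0).
move=> u' v' w' hu hv hw; case: cases => [k1|nS0].
  have k0 : 1 - kappa != 0 by rewrite subr_eq0 eq_sym.
  (* [J (J (S u')) = - S u'] and [S^2 = 1 - kappa] on the contact distribution, so [u'] lies in the
     image of [S J] and [b_SJ] applies. *)
  have -> : u' = S (J (- (1 - kappa)^-1 *: J (S u'))).
    rewrite linearZ /= J2 Shor scale0r addr0 scalerN scaleNr opprK linearZ /=.
    by rewrite S_square// scalerA mulVf// scale1r.
  by apply: b_SJ => //; rewrite gE Jhor mulr0.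
by have := E1 u' hv hw; rewrite /C !nS0 !gE; lra.
Qed.

End AlmostContact.

(** * Curvature of a space form at a point *)

Section CurvatureLike.
Variables (R : realFieldType) (V : lmodType R).

(** Linearity is imposed on one slot; the symmetries and [cl_pair] carry it to the others. *)
Definition curvature_like (q : V -> V -> V -> V -> R) :=
  [/\ forall a u u' v w z, q (a *: u + u') v w z = a * q u v w z + q u' v w z,
      forall u v w z, q v u w z = - q u v w z,
      forall u v w z, q u v z w = - q u v w z &
      forall u v w z, q u v w z + q v w u z + q w u v z = 0].

Variable q : V -> V -> V -> V -> R.
Hypothesis qP : curvature_like q.

Lemma cl_skew12 u v w z : q v u w z = - q u v w z. Proof. by case: qP. Qed.
Lemma cl_skew34 u v w z : q u v z w = - q u v w z. Proof. by case: qP. Qed.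
Lemma cl_bianchi u v w z : q u v w z + q v w u z + q w u v z = 0.
Proof. by case: qP. Qed.

Lemma cl_pair u v w z : q u v w z = q w z u v.
Proof.
have b1 := cl_bianchi u v w z; have b2 := cl_bianchi v w z u.
have b3 := cl_bianchi w z u v; have b4 := cl_bianchi z u v w.
rewrite (cl_skew12 u w v z) in b1.
rewrite (cl_skew34 v w u z) (cl_skew34 w z u v) (cl_skew12 v z w u) (cl_skew34 v z u w) in b2.
rewrite (cl_skew12 u z w v) (cl_skew34 u z v w) (cl_skew34 u w v z) in b3.
rewrite (cl_skew12 u z v w) (cl_skew34 u v w z) in b4.
lra.
Qed.

Lemma cl_D1 u u' v w z : q (u + u') v w z = q u v w z + q u' v w z.
Proof. by case: qP => qL _ _ _; have := qL 1 u u' v w z; rewrite scale1r mul1r. Qed.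
Lemma cl_Z1 a u v w z : q (a *: u) v w z = a * q u v w z.
Proof.
case: qP => qL _ _ _; have := qL 1 0 0 v w z; rewrite scale1r addr0 mul1r => E.
by rewrite -[a *: u]addr0 qL; move: E; lra.
Qed.
Lemma cl_D2 u u' v w z : q v (u + u') w z = q v u w z + q v u' w z.
Proof. by rewrite !(cl_skew12 _ v) cl_D1 opprD. Qed.
Lemma cl_Z2 a u v w z : q v (a *: u) w z = a * q v u w z.
Proof. by rewrite !(cl_skew12 _ v) cl_Z1 mulrN. Qed.
Lemma cl_D3 u u' v w z : q v w (u + u') z = q v w u z + q v w u' z.
Proof. by rewrite !(cl_pair v) cl_D1. Qed.
Lemma cl_Z3 a u v w z : q v w (a *: u) z = a * q v w u z.
Proof. by rewrite !(cl_pair v) cl_Z1. Qed.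
Lemma cl_D4 u u' v w z : q v w z (u + u') = q v w z u + q v w z u'.
Proof. by rewrite !(cl_pair v) cl_D2. Qed.
Lemma cl_Z4 a u v w z : q v w z (a *: u) = a * q v w z u.
Proof. by rewrite !(cl_pair v) cl_Z2. Qed.
Lemma cl_N1 u v w z : q (- u) v w z = - q u v w z.
Proof. by rewrite -scaleN1r cl_Z1 mulN1r. Qed.
Lemma cl_N2 u v w z : q v (- u) w z = - q v u w z.
Proof. by rewrite -scaleN1r cl_Z2 mulN1r. Qed.
Lemma cl_N3 u v w z : q v w (- u) z = - q v w u z.
Proof. by rewrite -scaleN1r cl_Z3 mulN1r. Qed.
Lemma cl_N4 u v w z : q v w z (- u) = - q v w z u.
Proof. by rewrite -scaleN1r cl_Z4 mulN1r. Qed.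

Definition cl_lin := (cl_D1, cl_D2, cl_D3, cl_D4, cl_Z1, cl_Z2, cl_Z3, cl_Z4,
  cl_N1, cl_N2, cl_N3, cl_N4).

Section Kaehler.
Variable J : {linear V -> V}.
Hypothesis qJ : forall u v w z, q u v (J w) z = - q u v w (J z).
Hypothesis qJJ : forall u v w z, q (J (J u)) v w z = - q u v w z.
Hypothesis hol0 : forall u, q u (J u) (J u) u = 0.

Let qJ1 u v w z : q (J u) v w z = - q u (J v) w z.
Proof. by rewrite cl_pair qJ cl_pair. Qed.

Let qJJ2 u v w z : q v (J (J u)) w z = - q v u w z.
Proof. by rewrite cl_skew12 qJJ -cl_skew12. Qed.

Let qJJ3 u v w z : q v w (J (J u)) z = - q v w u z.
Proof. by rewrite cl_pair qJJ cl_pair. Qed.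

(** The part of degree two in [y] of the holomorphic curvature along [x + y], isolated by adding the
    expansion along [x - y]. *)
Let polar x y : q x (J y) (J y) x + q x (J x) (J y) y + q x (J y) (J x) y = 0.
Proof.
have h1 := hol0 (x + y); have h2 := hol0 (x - y).
rewrite !linearD !cl_lin !hol0 in h1.
rewrite !linearB !cl_lin !hol0 in h2.
have e1 : q y (J y) (J x) x = q x (J x) (J y) y.
  by rewrite cl_pair cl_skew12 cl_skew34 opprK.
have e2 : q y (J x) (J y) x = q x (J y) (J x) y.
  by rewrite cl_pair cl_skew12 cl_skew34 opprK.
have e3 : q y (J x) (J x) y = q x (J y) (J y) x.
  rewrite -[q y (J x) _ _]opprK -qJ1 qJ opprK cl_pair cl_skew12 cl_skew34 opprK.
  by [].
lra.
Qed.

(** The two polarisations and the Bianchi identity make every mixed term a multiple of [q x y y x].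
    Replacing [y] by [J y] yields the reverse relation, so [q x y y x] equals 25 times itself and
    vanishes. *)
Let ratio x y : q x (J y) (J y) x = 5 * q x y y x.
Proof.
have h1 := polar x y; have h2 := polar x (J y).
rewrite !(qJJ2, qJJ3) in h2.
have b := cl_bianchi x (J x) (J y) y.
have b1 : q (J x) (J y) x y = - q x y y x.
  by rewrite qJ1 qJJ2 opprK cl_skew34.
have b2 : q (J y) x (J x) y = - q x (J y) (J x) y by rewrite cl_skew12.
have h3 : q x (J x) y (J y) = - q x (J x) (J y) y by rewrite qJ opprK.
have h4 : q x y (J x) (J y) = - q x y y x.
  by rewrite qJ cl_skew34 opprK qJJ3 cl_skew34.
lra.
Qed.

Lemma kaehler_zero x y : q x y y x = 0.
Proof.
by have := ratio x y; have := ratio x (J y); rewrite qJJ2 qJJ3; lra.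
Qed.

End Kaehler.
End CurvatureLike.

(** * Sectional values of the curvature of a space form *)

Section SpaceFormCurvature.
Variables (R : rcfType) (V : lmodType R) (g : V -> V -> R).
Hypothesis gP : inner_product g.
Hypothesis gpos : forall u, u != 0 -> 0 < g u u.
Variables (J S : {linear V -> V}) (xi : V).
Hypothesis J2 : forall v, J (J v) = - v + g v xi *: xi.
Hypothesis xi_unit : g xi xi = 1.
Hypothesis Jxi : J xi = 0.
Hypothesis Jskew : forall u v, g (J u) v = - g u (J v).
Hypothesis Ssym : forall u v, g (S u) v = g u (S v).
Hypothesis Sxi : S xi = 0.
Hypothesis JSa : forall v, J (S v) = - S (J v).
Variable T : V -> V.
Hypothesis TE : forall u, T u = u + J (S u).
Variable Rm : V -> V -> V -> V -> R.
Hypothesis RmP : curvature_like Rm.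
Variables (kappa mu c : R).
Hypothesis Rm_xi : forall u v z, Rm u v xi z =
  kappa * (g v xi * g u z - g u xi * g v z)
  + mu * (g v xi * g (J (S u)) z - g u xi * g (J (S v)) z).
Hypothesis Rm_J : forall u v w z,
  g u xi = 0 -> g v xi = 0 -> g w xi = 0 -> g z xi = 0 ->
  Rm u v (J w) z + Rm u v w (J z) =
  - (g (T v) w * g (J (T u)) z) + g (T u) w * g (J (T v)) z
  + g (J (T u)) w * g (T v) z - g (J (T v)) w * g (T u) z.
Hypothesis Rm_hol : forall u, g u u = 1 -> g u xi = 0 -> Rm u (J u) (J u) u = c.

Local Notation gE := (gE gP).
Local Notation g_sym := (g_sym gP).

Let Jh u : g (J u) xi = 0. Proof. by rewrite Jskew Jxi gE oppr0. Qed.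
Let Sh u : g (S u) xi = 0. Proof. by rewrite Ssym Sxi gE. Qed.
Let JSs u v : g (J (S u)) v = g u (J (S v)).
Proof. by rewrite Jskew Ssym JSa gE. Qed.
Let Ts u v : g (T u) v = g u (T v). Proof. by rewrite !TE !gE JSs. Qed.

(** [W] is [T /\ T] and has exactly the defect of [J]-invariance required by [Rm_J]; [K] and [H]
    have none on the contact distribution. For a horizontal unit vector [K] has holomorphic value 4.
    The coefficient of [H] is chosen to cancel the squares of [g (J (S u)) u] and [g (S u) u]
    produced by [W], so that [W - H / 2] has holomorphic value 1 and [R0] has value [c]. *)
Let W u v w z := g (T v) w * g (T u) z - g (T u) w * g (T v) z.
Let K u v w z := g v w * g u z - g u w * g v z + 2 * g u (J v) * g (J w) z
  + g u (J w) * g (J v) z - g v (J w) * g (J u) z.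
Let H u v w z := g (J (S v)) w * g (J (S u)) z - g (J (S u)) w * g (J (S v)) z
  + g (S v) w * g (S u) z - g (S u) w * g (S v) z.
Let R0 u v w z := W u v w z + (c - 1) / 4 * K u v w z - 2^-1 * H u v w z.
Let p u := u - g u xi *: xi.
(** The projections [p] make the horizontal hypotheses available for arbitrary arguments, as
    [kaehler_zero] demands. *)
Let Q u v w z := Rm (p u) (p v) (p w) (p z) - R0 (p u) (p v) (p w) (p z).

Let ph u : g (p u) xi = 0. Proof. by rewrite /p !gE xi_unit mulr1 subrr. Qed.
Let pJ u : p (J u) = J u. Proof. by rewrite /p Jh scale0r subr0. Qed.
Let Jp u : J (p u) = J u. Proof. by rewrite /p linearB linearZ /= Jxi scaler0 subr0. Qed.
Let JJ u : J (J u) = - p u. Proof. by rewrite /p opprB addrC J2. Qed.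
Let ppE u : p (p u) = p u. Proof. by rewrite {1}/p ph scale0r subr0. Qed.
Let pN u : p (- u) = - p u. Proof. by rewrite /p !gE scaleNr opprD. Qed.

Let R0_like : curvature_like R0.
Proof.
split.
- move=> a u u' v w z; rewrite /R0 /W /K /H !TE !linearP !gE; ring.
- move=> u v w z; rewrite /R0 /W /K /H.
  have -> : g v (J u) = - g u (J v) by rewrite g_sym Jskew.
  ring.
- move=> u v w z; rewrite /R0 /W /K /H.
  have E a b : g a (J b) = - g b (J a) by rewrite g_sym Jskew.
  rewrite !Jskew (E z w); ring.
- move=> u v w z; rewrite /R0 /W /K /H.
  rewrite (Ts v w) (Ts w u) (Ts u v) !(g_sym _ (T _)) !(JSs _ u) (JSs v w).
  rewrite !(g_sym _ (J (S _))) (Ssym v w) (Ssym w u) (Ssym u v) !(g_sym _ (S _)).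
  rewrite (g_sym v w) (g_sym w u) (g_sym u v).
  have E a b : g a (J b) = - g b (J a) by rewrite g_sym Jskew.
  rewrite (E v w) (E w u) (E u v).
  ring.
Qed.

Let Q_like : curvature_like Q.
Proof.
have pL a u u' : p (a *: u + u') = a *: p u + p u'.
  rewrite /p !gE scalerDl -!scalerA scalerBr opprD -!addrA; congr (_ + _).
  by rewrite addrCA addrA addrC !addrA addrAC.
have [r1 r2 r3 r4] := RmP; have [s1 s2 s3 s4] := R0_like; split.
- by move=> a u u' v w z; rewrite /Q pL r1 s1; ring.
- by move=> u v w z; rewrite /Q r2 s2; ring.
- by move=> u v w z; rewrite /Q r3 s3; ring.
- move=> u v w z; have := r4 (p u) (p v) (p w) (p z).
  by have := s4 (p u) (p v) (p w) (p z); rewrite /Q; lra.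
Qed.

Let JTs u v : g (T u) (J v) = - g (J (T u)) v. Proof. by rewrite Jskew opprK. Qed.

Let R0_J u v w z :
  g u xi = 0 -> g v xi = 0 -> g w xi = 0 -> g z xi = 0 ->
  R0 u v (J w) z + R0 u v w (J z) =
  - (g (T v) w * g (J (T u)) z) + g (T u) w * g (J (T v)) z
  + g (J (T u)) w * g (T v) z - g (J (T v)) w * g (T u) z.
Proof.
move=> hu hv hw hz; rewrite /R0 /W /K /H !JTs.
have E a b : g a (J b) = - g (J a) b by rewrite Jskew opprK.
have E1 a : g a xi = 0 -> J (J a) = - a by move=> h; rewrite J2 h scale0r addr0.
rewrite !E (E1 _ hu) (E1 _ hv) (E1 _ (Sh u)) (E1 _ (Sh v)).
rewrite (E1 _ hw) !gE; ring.
Qed.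

Let R0_hol u : g u xi = 0 -> R0 u (J u) (J u) u = c * (g u u) ^+ 2.
Proof.
move=> hu; rewrite /R0 /W /K /H.
have E1 a : g a xi = 0 -> J (J a) = - a by move=> h; rewrite J2 h scale0r addr0.
have SJ : S (J u) = - J (S u) by rewrite JSa opprK.
have JSJ : J (S (J u)) = S u by rewrite SJ linearN (E1 _ (Sh u)) opprK.
have f0 : g u (J u) = 0 by have := Jskew u u; rewrite g_sym; lra.
have f0' : g (J u) u = 0 by rewrite g_sym.
have f1 : g (J u) (J u) = g u u by rewrite Jskew (E1 _ hu) gE opprK.
have f2 : g (S u) (J u) = - g (J (S u)) u by rewrite Jskew opprK.
have f3 : g (J (S u)) (J u) = g (S u) u by rewrite Jskew (E1 _ hu) gE opprK.
by rewrite !TE !JSJ !SJ (E1 _ hu) !gE f0 f0' f1 f2 f3; field.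
Qed.

Let Rm_sect_hor u v : g u xi = 0 -> g v xi = 0 -> Rm u v v u = R0 u v v u.
Proof.
move=> hu hv; have pE a : g a xi = 0 -> p a = a by rewrite /p => ->; rewrite scale0r subr0.
suff : Q u v v u = 0 by rewrite /Q !pE// => /subr0_eq.
apply: (kaehler_zero Q_like (J := J)).
- move=> a b w z; rewrite /Q !pJ.
  have := Rm_J (ph a) (ph b) (ph w) (ph z); have := R0_J (ph a) (ph b) (ph w) (ph z).
  by rewrite !Jp; lra.
- by move=> a b w z; rewrite /Q JJ pN ppE (cl_N1 RmP) (cl_N1 R0_like); ring.
- move=> a; rewrite /Q pJ -(Jp a).
  have [->|a0] := eqVneq (p a) 0.
    by rewrite linear0 -(scale0r (0 : V)) (cl_Z1 RmP) (cl_Z1 R0_like) !mul0r subrr.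
  (* The holomorphic curvature is prescribed on unit vectors; it is homogeneous of degree 4, which
     allows a rescaling. *)
  pose n := Num.sqrt (g (p a) (p a)).
  have n0 : n != 0 by rewrite sqrtr_eq0 -ltNge gpos.
  have n2 : n ^+ 2 = g (p a) (p a) by rewrite sqr_sqrtr// ltW// gpos.
  have h1 : g (n^-1 *: p a) (n^-1 *: p a) = 1 by rewrite (gZl gP) (gZr gP) -n2; field.
  have hom t w : Rm (t *: w) (J (t *: w)) (J (t *: w)) (t *: w) =
      t ^+ 4 * Rm w (J w) (J w) w.
    by rewrite !linearZ /= !(cl_lin RmP); ring.
  have := Rm_hol h1; rewrite gE ph mulr0 => /(_ erefl).
  by rewrite (R0_hol (ph a)) -n2 hom => <-; field.
Qed.

Theorem sectional_formula u v : Rm u v v u =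
  (c + 3) / 4 * (g u u * g v v - g u v ^+ 2)
  + (c + 3 - 4 * kappa) / 4 * (2 * (g u xi * g v xi * g u v)
      - g v xi ^+ 2 * g u u - g u xi ^+ 2 * g v v)
  + 3 * (c - 1) / 4 * g (J u) v ^+ 2
  + 2^-1 * (g (J (S v)) v * g (J (S u)) u - g (J (S u)) v ^+ 2
            + g (S u) v ^+ 2 - g (S v) v * g (S u) u)
  - g u v * g (J (S v)) u + g v v * g (J (S u)) u
  + g u xi * g v xi * g (J (S v)) u - g v xi ^+ 2 * g (J (S u)) u
  - g (J (S u)) v * g u v + g (J (S v)) v * g u u
  - g (J (S v)) v * g u xi ^+ 2 + g (J (S u)) v * g u xi * g v xi
  + mu * (g v xi ^+ 2 * g (J (S u)) u - g u xi * g v xi * g (J (S v)) u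
          + g (J (S v)) v * g u xi ^+ 2 - g (J (S u)) v * g u xi * g v xi).
Proof.
have dec w : w = p w + g w xi *: xi by rewrite /p subrK.
have x0 a b z : g a xi = 0 -> g b xi = 0 -> Rm a b xi z = 0.
  by move=> ha hb; rewrite Rm_xi ha hb; ring.
(* The [xi] components are removed from the last two slots, then, after pair symmetry, from the
   first two. Values with one [xi] and three horizontal vectors vanish by [x0]. *)
have e1 : Rm u v v u = g v xi * Rm u v xi u - g u xi * Rm u v xi (p v)
    + R0 (p u) (p v) (p v) (p u).
  have d3 a b w z : Rm a b w z = Rm a b (p w) z + g w xi * Rm a b xi z.
    by rewrite -(cl_Z3 RmP) -(cl_D3 RmP) -dec.
  have d4 a b w z : Rm a b w z = Rm a b w (p z) - g z xi * Rm a b xi w.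
    by rewrite -mulrN -(cl_skew34 RmP) -(cl_Z4 RmP) -(cl_D4 RmP) -dec.
  rewrite (d3 u v v u) (d4 u v (p v) u) (cl_pair RmP u v (p v)) (d3 _ _ u v).
  rewrite (d4 _ _ (p u) v) !(x0 (p v) (p u)) ?ph// (cl_pair RmP (p v)) -(Rm_sect_hor (ph u) (ph v)).
  ring.
have Sp a : S (p a) = S a by rewrite /p linearB linearZ /= Sxi scaler0 subr0.
rewrite e1 !Rm_xi /R0 /W /K /H !TE !Sp !Jp /p.
have f3 a : g xi (J a) = 0 by rewrite g_sym.
rewrite !gE !Jh !f3 xi_unit !(g_sym xi) ?Jh ?Sh.
have f5 : g v (J v) = 0 by have := Jskew v v; rewrite g_sym; lra.
have f6 : g u (J v) = - g (J u) v by rewrite Jskew opprK.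
have f7 : g (J v) u = - g (J u) v by rewrite g_sym.
have k1 : g (J (S v)) u = g (J (S u)) v by rewrite JSs g_sym.
have k2 : g (S v) u = g (S u) v by rewrite Ssym g_sym.
rewrite f5 f6 f7 k1 k2 (g_sym v u).
by field.
Qed.

End SpaceFormCurvature.

(** * Contact metric structures in a chart *)

Section MoreLeviCivita.
Variables (R : realType) (d : nat) (U : set 'rV[R]_d).
Hypothesis oU : open U.
Variable G : 'rV[R]_d -> 'M[R]_d.
Hypothesis sG : smooth_mx_on U G.
Hypothesis symG : forall z, U z -> (G z)^T = G z.
Hypothesis posG : forall z, U z -> forall v : 'rV[R]_d, v != 0 -> 0 < ip (G z) v v.
Implicit Types (u v w : 'rV[R]_d) (y z : 'rV[R]_d) (X Y : 'rV[R]_d -> 'rV[R]_d).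

Lemma rcov_cst u w y : rcov G u (cst w) y = w *m Gam G u y.
Proof. by rewrite /rcov derive_cst add0r. Qed.

Lemma rcovD u X Y y : differentiable X y -> differentiable Y y ->
  rcov G u (fun z => X z + Y z) y = rcov G u X y + rcov G u Y y.
Proof.
move=> dX dY; rewrite /rcov deriveD; [|exact: diff_derivable..].
by rewrite mulmxDl addrACA.
Qed.

Lemma rcovN u X y : differentiable X y ->
  rcov G u (fun z => - X z) y = - rcov G u X y.
Proof.
move=> dX; rewrite /rcov deriveN; last exact: diff_derivable.
by rewrite mulNmx opprD.
Qed.

Lemma rcovZ u (f : 'rV[R]_d -> R) X y : differentiable f y -> differentiable X y ->
  rcov G u (fun z => f z *: X z) y = 'D_u f y *: X y + f y *: rcov G u X y.
Proof.
by move=> df dX; rewrite /rcov derive_scale// -scalemxAl scalerDr addrA.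
Qed.

Lemma differentiable_ip X Y y : U y -> differentiable X y -> differentiable Y y ->
  differentiable (fun z => ip (G z) (X z) (Y z)) y.
Proof.
move=> Uy dX dY.
have /differentiable_mxP : differentiable (fun z => X z *m G z *m (Y z)^T) y.
  apply: differentiable_mulmx; last exact: differentiable_trmx.
  by apply: differentiable_mulmx => //; exact: smooth_mx_differentiable sG Uy.
exact.
Qed.

Lemma rcov_mx X y u : U y -> differentiable X y ->
  u *m (\matrix_i rcov G (delta_mx 0 i) X y) = rcov G u X y.
Proof.
move=> Uy dX; rewrite mulmx_sum_row; under eq_bigr do rewrite rowK.
have -> : rcov G u X y = \sum_i u 0 i *: 'D_(delta_mx 0 i) X y
    + X y *m (\sum_i u 0 i *: Gam G (delta_mx 0 i) y).
  by rewrite -Gam_sum -row_sum_delta /rcov (derive_partial _ dX).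
rewrite mulmx_sumr -big_split; apply: eq_bigr => i _.
by rewrite /= scalerDr scalemxAr.
Qed.

Lemma differentiable_rcov X y u : U y -> smooth_mx_on U X ->
  differentiable (rcov G u X) y.
Proof.
move=> Uy sX; apply: differentiableD.
  by apply: smooth_mx_differentiable Uy; exact: smooth_mx_derive.
apply: differentiable_mulmx; first exact: smooth_mx_differentiable Uy.
exact: differentiable_Gam Uy.
Qed.

Lemma differentiable_mcov A y u : U y -> smooth_mx_on U A ->
  differentiable (mcov G u A) y.
Proof.
move=> Uy sA; have dA : differentiable A y by exact: smooth_mx_differentiable Uy.
have dg : differentiable (Gam G u) y by exact: differentiable_Gam Uy.
apply: differentiableB; last exact: differentiable_mulmx.
apply: differentiableD; last exact: differentiable_mulmx.
by apply: smooth_mx_differentiable Uy; exact: smooth_mx_derive.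
Qed.

(** The sign [s] treats the skew [phi] ([s = -1]) and the symmetric [S] ([s = 1]) together. *)
Lemma adjoint_mcov (s : R) A y t v w : U y -> differentiable A y ->
  (forall z v w, U z -> ip (G z) (v *m A z) w = s * ip (G z) v (w *m A z)) ->
  ip (G y) (v *m mcov G t A y) w = s * ip (G y) v (w *m mcov G t A y).
Proof.
move=> Uy dA adj.
have dAv x : differentiable (fun z => x *m A z) y.
  exact: (@differentiable_mulmx _ _ _ _ _ (cst x)).
have E : 'D_t (fun z => ip (G z) (v *m A z) w) y =
    s * 'D_t (fun z => ip (G z) v (w *m A z)) y.
  have -> : s * 'D_t (fun z => ip (G z) v (w *m A z)) y =
      'D_t (fun z => s *: ip (G z) v (w *m A z)) y.
    rewrite deriveZ//; apply: diff_derivable.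
    exact: (@differentiable_ip (cst v)).
  by apply: near_eq_derive; apply: filterS (nbhsU oU Uy) => z Uz; rewrite adj.
move: E; rewrite (@derive_metric _ _ _ oU _ sG symG posG t (fun z => v *m A z) (cst w))//.
rewrite (@derive_metric _ _ _ oU _ sG symG posG t (cst v) (fun z => w *m A z))//.
rewrite !rcov_cst !rcov_cst_mulmx// !ip_lin.
have := adj y (v *m Gam G t y) w Uy; have := adj y v (w *m Gam G t y) Uy.
rewrite mulrDr => -> ->; lra.
Qed.

Lemma Om_like y : U y ->
  curvature_like (fun u v w z => ip (G y) (w *m Om G u v y) z).
Proof.
move=> Uy; split.
- move=> a u u' v w z; rewrite -ipZl -ipDl; congr (ip _ _ _).
  rewrite scalemxAr -mulmxDr; congr (_ *m _); rewrite /Om.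
  have dg x : differentiable (Gam G x) y by exact: differentiable_Gam Uy.
  rewrite derive_dirD// derive_dirZ//.
  have -> : Gam G (a *: u + u') = a *: Gam G u + Gam G u'.
    by apply/funext => y'; rewrite GamD GamZ.
  rewrite deriveD; [|exact/diff_derivable/differentiableZ|exact: diff_derivable].
  rewrite deriveZ; last exact: diff_derivable.
  rewrite !fctE !(mulmxDl, mulmxDr) -!scalemxAl -!scalemxAr.
  mx_abel.
- by move=> u v w z; rewrite Om_skew mulmxN ipNl.
- move=> u v w z; rewrite (Om_ip_skew oU sG symG posG u v w z Uy) opprK.
  by rewrite (ip_sym _ _ (symG Uy)).
- by move=> u v w z; rewrite -!ipDl (bianchi oU sG symG posG u v w Uy) ip0l.
Qed.

Lemma ip_inner y : U y -> inner_product (ip (G y)).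
Proof.
move=> Uy; split.
- by move=> u v w; rewrite ipDl.
- by move=> a u w; rewrite ipZl.
- by move=> u v; rewrite ip_sym// symG.
- by move=> u v; apply: ip_eq; exact: posG.
Qed.

Lemma rcov_linear a u v X y : differentiable X y ->
  rcov G (a *: u + v) X y = a *: rcov G u X y + rcov G v X y.
Proof.
move=> dX; rewrite /rcov GamD GamZ derive_dirD// derive_dirZ// mulmxDr -scalemxAr.
by rewrite scalerDr addrACA.
Qed.

(** [alpha] differentiates the form [pi] against a constant extension; by metric compatibility this
    is the pairing with [nabla_u P], which makes bilinearity visible. *)
Lemma alphaE P l1 l2 y u v : U y -> differentiable P y ->
  alpha G P l1 l2 y u v = ip (G y) (rcov G u P y) v
  - l1 * pi_form G P y u * pi_form G P y v
  + l2 / 2 * ip (G y) u v * pi_form G P y (P y).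
Proof.
move=> Uy dP; rewrite /alpha; congr (_ - _ + _).
rewrite /pi_form (derive_metric oU sG symG posG u Uy dP (Y := cst v))//.
by rewrite rcov_cst /levi_civita derive_cst add0r christoffel_termE addrK.
Qed.

End MoreLeviCivita.

Definition cov_field (R : realType) d (G : 'rV[R]_d -> 'M[R]_d)
    (X : 'rV[R]_d -> 'rV[R]_d) z : 'M[R]_d := \matrix_i rcov G (delta_mx 0 i) X z.

(** In the notation of contact geometry, [S = nabla xi + phi = - phi h']. *)
Definition cov_plus_phi (R : realType) d (G F : 'rV[R]_d -> 'M[R]_d)
    (X : 'rV[R]_d -> 'rV[R]_d) z : 'M[R]_d := cov_field G X z + F z.

Definition one_plus_h (R : realType) d (G F : 'rV[R]_d -> 'M[R]_d)
    (X : 'rV[R]_d -> 'rV[R]_d) z : 'M[R]_d := 1%:M + cov_plus_phi G F X z *m F z.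

Section ContactChart.
Variables (R : realType) (d : nat) (U : set 'rV[R]_d).
Hypothesis oU : open U.
Variable G : 'rV[R]_d -> 'M[R]_d.
Hypothesis sG : smooth_mx_on U G.
Hypothesis symG : forall z, U z -> (G z)^T = G z.
Hypothesis posG : forall z, U z -> forall v : 'rV[R]_d, v != 0 -> 0 < ip (G z) v v.
Variables (F : 'rV[R]_d -> 'M[R]_d) (xi : 'rV[R]_d -> 'rV[R]_d)
  (eta : 'rV[R]_d -> 'cV[R]_d).
Hypothesis sF : smooth_mx_on U F.
Hypothesis sxi : smooth_mx_on U xi.
Hypothesis seta : smooth_mx_on U eta.
Hypothesis F2 : forall y (v : 'rV[R]_d), U y ->
  v *m F y *m F y = - v + form_ev (eta y) v *: xi y.
Hypothesis eta_xi : forall y, U y -> form_ev (eta y) (xi y) = 1.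
Hypothesis Fxi : forall y, U y -> xi y *m F y = 0.
Hypothesis Fskew : forall y (u v : 'rV[R]_d), U y ->
  ip (G y) u (v *m F y) = - ip (G y) (u *m F y) v.
Hypothesis gxi : forall y (v : 'rV[R]_d), U y ->
  ip (G y) v (xi y) = form_ev (eta y) v.
Hypothesis contact : forall y (u v : 'rV[R]_d), U y ->
  ip (G y) u (v *m F y) = ext_deriv eta (cst u) (cst v) y.
Variables kappa mu c : R.
Hypothesis kmu : forall y (u v : 'rV[R]_d), U y ->
  lc_curvature G y u v (xi y) =
  kappa *: (form_ev (eta y) v *: u - form_ev (eta y) u *: v)
  + mu *: (form_ev (eta y) v *: hprime F xi y u - form_ev (eta y) u *: hprime F xi y v).
Hypothesis hol : forall y (u : 'rV[R]_d), U y ->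
  ip (G y) u u = 1 -> ip (G y) u (xi y) = 0 -> sectional G y u (u *m F y) = c.
Implicit Types (u v w t : 'rV[R]_d) (y z : 'rV[R]_d).

Local Notation A := (cov_field G xi).
Local Notation S := (cov_plus_phi G F xi).
Local Notation T := (one_plus_h G F xi).

Let dF z : U z -> differentiable F z.
Proof. exact: smooth_mx_differentiable. Qed.
Let dxi z : U z -> differentiable xi z.
Proof. exact: smooth_mx_differentiable. Qed.

Let AE z u : U z -> u *m A z = rcov G u xi z.
Proof. by move=> Uz; apply: (rcov_mx (U := U)) => //; exact: dxi. Qed.

Let dA z : U z -> differentiable A z.
Proof.
move=> Uz; apply/differentiable_mxP => i j.
under eq_fun do rewrite mxE.
have /differentiable_mxP := differentiable_rcov oU sG posG (delta_mx 0 i) Uz sxi.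
exact.
Qed.

Let dS z : U z -> differentiable S z.
Proof. by move=> Uz; apply: differentiableD; [exact: dA|exact: dF]. Qed.

Let SE y u : u *m S y = u *m A y + u *m F y.
Proof. by rewrite mulmxDr. Qed.

Let TE z u : u *m T z = u + u *m S z *m F z.
Proof. by rewrite mulmxDr mulmx1 mulmxA. Qed.

Let dT z : U z -> differentiable T z.
Proof.
move=> Uz; apply: differentiableD; first exact: differentiable_cst.
by apply: differentiable_mulmx; [exact: dS|exact: dF].
Qed.

Let mcovS a y : U y -> mcov G a S y = mcov G a A y + mcov G a F y.
Proof. by move=> Uy; rewrite -mcovD; [|exact: dA|exact: dF]. Qed.

#[local] Opaque cov_field cov_plus_phi one_plus_h.

Let J2 y v : U y -> v *m F y *m F y = - v + ip (G y) v (xi y) *: xi y.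
Proof. by move=> Uy; rewrite F2// gxi. Qed.
Let xi1 y : U y -> ip (G y) (xi y) (xi y) = 1.
Proof. by move=> Uy; rewrite gxi// eta_xi. Qed.
Let Jskew y u v : U y -> ip (G y) (u *m F y) v = - ip (G y) u (v *m F y).
Proof. by move=> Uy; rewrite Fskew// opprK. Qed.

Let Ahor y u : U y -> ip (G y) (u *m A y) (xi y) = 0.
Proof.
move=> Uy; have := derive_metric oU sG symG posG u Uy (dxi Uy) (dxi Uy).
have N : \forall z \near y, ip (G z) (xi z) (xi z) = cst 1 z.
  by apply: filterS (nbhsU oU Uy) => z; exact: xi1.
rewrite (near_eq_derive _ N) derive_cst -!AE//.
by rewrite (ip_sym (xi y) _ (symG Uy)); lra.
Qed.

Let deta z : U z -> differentiable eta z.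
Proof. exact: smooth_mx_differentiable. Qed.

Let derive_form_ev v t y : U y ->
  'D_t (fun z => form_ev (eta z) v) y = (v *m 'D_t eta y) 0 0.
Proof.
move=> Uy; rewrite -(derive_cst_mulmx v t (deta Uy)) derive_entry//.
exact: (differentiable_cst_mulmx v (deta Uy)).
Qed.

Let contactE y u v : U y ->
  2 * ip (G y) u (v *m F y) = (v *m 'D_u eta y) 0 0 - (u *m 'D_v eta y) 0 0.
Proof.
move=> Uy; rewrite contact// /ext_deriv /= !derive_form_ev// /bracket !derive_cst.
have -> : form_ev (eta y) (0 - 0) = 0 by rewrite subrr /form_ev mul0mx mxE.
by rewrite subr0 mulrA divff// mul1r.
Qed.

(** The derivatives of [eta] are expressed by [nabla xi], and the Christoffel terms cancel by
    torsion-freeness. The factor 2 undoes the normalisation of [ext_deriv]. *)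
Let A_alt y u v : U y ->
  ip (G y) (u *m A y) v - ip (G y) (v *m A y) u = 2 * ip (G y) u (v *m F y).
Proof.
move=> Uy; rewrite (contactE u v Uy).
have E a b : (b *m 'D_a eta y) 0 0 =
    ip (G y) (b *m Gam G a y) (xi y) + ip (G y) b (a *m A y).
  have N : \forall z \near y, form_ev (eta z) b = ip (G z) (cst b z) (xi z).
    by apply: filterS (nbhsU oU Uy) => z Uz; rewrite gxi.
  apply: etrans (esym (derive_form_ev b a Uy)) (etrans (near_eq_derive _ N) _).
  rewrite (derive_metric oU sG symG posG a Uy (X := cst b))//; last exact: dxi.
  by rewrite rcov_cst -AE.
apply: etrans _ (esym (congr2 (fun a b => a - b) (E u v) (E v u))).
rewrite (Gam_sym oU symG u v Uy).
rewrite (ip_sym v (u *m A y) (symG Uy)) (ip_sym u (v *m A y) (symG Uy)); lra.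
Qed.

Let nJ_skew y u v w : U y ->
  ip (G y) (v *m mcov G u F y) w = - ip (G y) v (w *m mcov G u F y).
Proof.
move=> Uy; rewrite -mulN1r; apply: (adjoint_mcov oU sG symG posG) => //.
  exact: dF.
by move=> z a b Uz; rewrite mulN1r Jskew.
Qed.

Let dPhi y u v t : U y ->
  'D_t (fun z => ip (G z) u (v *m F z)) y =
  ip (G y) (u *m Gam G t y) (v *m F y) + ip (G y) u (v *m Gam G t y *m F y)
  + ip (G y) u (v *m mcov G t F y).
Proof.
move=> Uy.
rewrite (derive_metric oU sG symG posG t Uy (X := cst u) (Y := fun z => v *m F z))//.
  by rewrite rcov_cst rcov_cst_mulmx ?ip_lin ?addrA//; exact: dF.
exact: (differentiable_cst_mulmx v (dF Uy)).
Qed.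

(** This is [d (d eta) = 0]. Differentiating [contactE] produces second derivatives of [eta], which
    cancel cyclically; the Christoffel terms cancel because they are symmetric and the fundamental
    form is skew. *)
Let nJ_cyc y u v w : U y ->
  ip (G y) (v *m mcov G u F y) w + ip (G y) (w *m mcov G v F y) u
  + ip (G y) (u *m mcov G w F y) v = 0.
Proof.
move=> Uy.
pose D (a b x : 'rV[R]_d) : R := (x *m 'D_b ('D_a eta) y) 0 0.
pose Phi (a b : 'rV[R]_d) : R := ip (G y) a (b *m F y); pose N (t a b : 'rV[R]_d) : R := ip (G y) a (b *m mcov G t F y).
pose Ga (a t : 'rV[R]_d) := a *m Gam G t y.
have DC a b x : D a b x = D b a x.
  have H := smooth_mx_young oU a b seta Uy; rewrite /D H; reflexivity.
have PhiC a b : Phi a b = - Phi b a.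
  by rewrite /Phi ip_sym ?Jskew//; exact: symG.
have GaC a b : Ga a b = Ga b a by rewrite /Ga (Gam_sym oU symG b a Uy).
have E a b t : 2 * (Phi (Ga a t) b + Phi a (Ga b t) + N t a b) = D a t b - D b t a.
  have dd x : differentiable ('D_x eta) y.
    by apply: smooth_mx_differentiable Uy; exact: smooth_mx_derive.
  have dm x x' : differentiable (fun z => x' *m 'D_x eta z) y.
    exact: (differentiable_cst_mulmx x' (dd x)).
  rewrite /Phi /Ga /N -(dPhi a b t Uy) /D.
  rewrite -(derive_cst_mulmx b t (dd a)) -(derive_cst_mulmx a t (dd b)) -mx_oppE -mx_addE.
  rewrite -deriveB; [|exact: diff_derivable..].
  rewrite derive_entry; last by apply: differentiableB; exact: dm.
  have dp : differentiable (fun z => ip (G z) a (b *m F z)) y.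
    apply: (differentiable_ip sG (X := cst a) (Y := fun z => b *m F z) Uy) => //.
    exact: (differentiable_cst_mulmx b (dF Uy)).
  transitivity ('D_t (fun z => 2 *: ip (G z) a (b *m F z)) y).
    by rewrite deriveZ//; exact: diff_derivable.
  apply: near_eq_derive; apply: filterS (nbhsU oU Uy) => z Uz.
  by rewrite mx_addE mx_oppE -(contactE a b Uz).
have N' a b t : ip (G y) (a *m mcov G t F y) b = N t b a.
  by rewrite ip_sym//; exact: symG.
rewrite !N' -/N; clearbody D Phi N Ga => {N'}.
have := E w v u; have := E u w v; have := E v u w.
rewrite (GaC w u) (GaC w v) (GaC v u) (DC w u) (DC w v) (DC v u).
have := PhiC (Ga u v) w; have := PhiC (Ga u w) v; have := PhiC (Ga v w) u.
lra.
Qed.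

(** Covariant derivative of [phi^2 = -1 + eta (x) xi]. *)
Let nJ_J y u v : U y ->
  v *m mcov G u F y *m F y + v *m F y *m mcov G u F y =
  ip (G y) (u *m A y) v *: xi y + ip (G y) v (xi y) *: (u *m A y).
Proof.
move=> Uy.
have dFF : differentiable (fun z => F z *m F z) y by apply: differentiable_mulmx; exact: dF.
have df : differentiable (fun z => ip (G z) v (xi z)) y.
  by apply: (differentiable_ip sG (X := cst v) Uy) => //; exact: dxi.
have dxiy := dxi Uy.
have N : \forall z \near y, v *m (F z *m F z) = cst (- v) z + ip (G z) v (xi z) *: xi z.
  by apply: filterS (nbhsU oU Uy) => z Uz; rewrite mulmxA J2.
have := rcov_cst_mulmx G u v dFF; rewrite (rcov_near G u N).
rewrite rcovD//; last exact: differentiable_scale.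
rewrite rcov_cst rcovZ// (derive_metric oU sG symG posG u Uy (X := cst v))//.
rewrite rcov_cst -AE// mcov_mulmx; [|exact: dF..].
rewrite mulmxDr !mulmxA J2// mulNmx scalerDl.
rewrite (ip_sym v (u *m A y) (symG Uy)) => E.
apply: (addrI (- (v *m Gam G u y) + ip (G y) (v *m Gam G u y) (xi y) *: xi y)).
rewrite -[LHS]E; mx_abel.
Qed.

Let nJ_xi y u : U y -> xi y *m mcov G u F y = - (u *m A y *m F y).
Proof.
move=> Uy; have := rcov_mulmx G u (dxi Uy) (dF Uy).
have N : \forall z \near y, xi z *m F z = cst 0 z.
  by apply: filterS (nbhsU oU Uy) => z Uz; rewrite Fxi.
rewrite (rcov_near G u N) rcov_cst mul0mx -AE// => E.
by apply/eqP; rewrite -addr_eq0 addrC -E.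
Qed.


(** From here on the pointwise lemmas are instantiated at [y], endomorphisms being the right
    multiplications [mulmxr]. *)
Let Ssym y u v : U y -> ip (G y) (u *m S y) v = ip (G y) u (v *m S y).
Proof.
move=> Uy; exact: (S_sym (J := mulmxr (F y)) (A := mulmxr (A y)) (S := mulmxr (S y))
  (ip_inner symG posG Uy) (fun u v => Jskew u v Uy) (SE y)
  (fun u v => A_alt u v Uy) u v).
Qed.

Let Sxi y : U y -> xi y *m S y = 0.
Proof.
move=> Uy; exact: (S_xi (J := mulmxr (F y)) (A := mulmxr (A y)) (S := mulmxr (S y))
  (ip_inner symG posG Uy) (Fxi Uy) (fun u v => Jskew u v Uy) (SE y)
  (fun u => Ahor u Uy) (fun u v => A_alt u v Uy)).
Qed.

Let JSa y v : U y -> v *m S y *m F y = - (v *m F y *m S y).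
Proof.
move=> Uy; exact: (JS_anti (J := mulmxr (F y)) (A := mulmxr (A y)) (S := mulmxr (S y))
  (nJ := fun u => mulmxr (mcov G u F y))
  (ip_inner symG posG Uy) (fun v => J2 v Uy) (Fxi Uy) (fun u v => Jskew u v Uy) (SE y)
  (fun u => Ahor u Uy) (fun u v => A_alt u v Uy) (fun u v w => nJ_skew u v w Uy)
  (fun u v w => nJ_cyc u v w Uy) (fun u v => nJ_J u v Uy) (fun u => nJ_xi u Uy)).
Qed.

Let nJxi0 y v : U y -> v *m mcov G (xi y) F y = 0.
Proof.
move=> Uy; exact: (nJ_xi0 (J := mulmxr (F y)) (A := mulmxr (A y)) (S := mulmxr (S y))
  (nJ := fun u => mulmxr (mcov G u F y))
  (ip_inner symG posG Uy) (fun v => J2 v Uy) (Fxi Uy) (fun u v => Jskew u v Uy) (SE y)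
  (fun u => Ahor u Uy) (fun u v => A_alt u v Uy) (fun u v w => nJ_skew u v w Uy)
  (fun u v w => nJ_cyc u v w Uy) (fun u v => nJ_J u v Uy) (fun u => nJ_xi u Uy)).
Qed.

(** The Lie derivative of [phi] along [xi], applied to [v], is [(nabla_xi phi) v - nabla_(phi v) xi
    + phi (nabla_v xi)]. The first term vanishes; with [nabla xi = S - phi] and anticommutation the
    rest is [2 phi S v]. *)
Lemma hprimeE y v : U y -> hprime F xi y v = v *m S y *m F y.
Proof.
move=> Uy; rewrite /hprime /lie_endo /bracket /= derive_cst sub0r mulNmx opprK.
rewrite (derive_cst_mulmx v (xi y) (dF Uy)).
have e1 := AE (v *m F y) Uy; have e2 := AE v Uy.
have e3 := nJxi0 v Uy; rewrite /mcov mulmxDr mulmxDr mulmxN !mulmxA in e3.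
rewrite /rcov (Gam_sym oU symG (v *m F y) (xi y) Uy) in e1.
rewrite /rcov (Gam_sym oU symG v (xi y) Uy) in e2.
have -> : v *m 'D_(xi y) F y = v *m Gam G (xi y) y *m F y - v *m F y *m Gam G (xi y) y.
  by apply/eqP; rewrite -subr_eq0 opprB addrCA addrC -e3; apply/eqP; mx_abel.
have -> : 'D_(v *m F y) xi y = v *m F y *m A y - v *m F y *m Gam G (xi y) y.
  by rewrite e1 addrK.
have -> : 'D_v xi y = v *m A y - v *m Gam G (xi y) y by rewrite e2 addrK.
have AS w : w *m A y = w *m S y - w *m F y by rewrite SE addrK.
rewrite !AS mulmxBl mulmxBl -[v *m F y *m S y]opprK -JSa//.
have -> : v *m Gam G (xi y) y *m F y - v *m F y *m Gam G (xi y) y -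
  (- (v *m S y *m F y) - v *m F y *m F y - v *m F y *m Gam G (xi y) y) +
  (v *m S y *m F y - v *m F y *m F y - v *m Gam G (xi y) y *m F y) =
  2 *: (v *m S y *m F y) by mx_abel.
by rewrite scalerA mulVf// scale1r.
Qed.

Let nS_sym y u v w : U y ->
  ip (G y) (v *m mcov G u S y) w = ip (G y) v (w *m mcov G u S y).
Proof.
move=> Uy; rewrite -[RHS]mul1r.
apply: (adjoint_mcov (s := 1) oU sG symG posG u v w Uy (dS Uy)) => z a b Uz.
by rewrite mul1r; exact: Ssym.
Qed.

Let nS_xi y u : U y -> xi y *m mcov G u S y = - (u *m A y *m S y).
Proof.
move=> Uy; have := rcov_mulmx G u (dxi Uy) (dS Uy).
have N : \forall z \near y, xi z *m S z = cst 0 z.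
  by apply: filterS (nbhsU oU Uy) => z Uz; rewrite Sxi.
rewrite (rcov_near G u N) rcov_cst mul0mx -AE// => E.
by apply/eqP; rewrite -addr_eq0 addrC -E.
Qed.

Let mcov0 y u : mcov G u (cst 0) y = 0.
Proof. by rewrite /mcov derive_cst mulmx0 mul0mx subr0 addr0. Qed.

Let mx_ext (B C : 'M[R]_d) : (forall v, v *m B = v *m C) -> B = C.
Proof. by move=> E; apply/row_matrixP => i; rewrite !rowE. Qed.

Let nS_J y u v : U y ->
  v *m F y *m mcov G u S y + v *m mcov G u F y *m S y
  + v *m S y *m mcov G u F y + v *m mcov G u S y *m F y = 0.
Proof.
move=> Uy; have dSy := dS Uy; have dFy := dF Uy.
have N : \forall z \near y, S z *m F z + F z *m S z = cst 0 z.
  apply: filterS (nbhsU oU Uy) => z Uz; apply: mx_ext => w.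
  by rewrite mulmxDr !mulmxA JSa// addNr mulmx0.
have := mcov_near G u N; rewrite mcov0 mcovD; last 2 first.
- exact: differentiable_mulmx.
- exact: differentiable_mulmx.
rewrite !mcov_mulmx// => /(congr1 (mulmx v)).
have D4 (a b e f : 'M[R]_d) : v *m (a + b + (e + f)) = v *m a + v *m b + (v *m e + v *m f).
  by rewrite !mulmxDr.
rewrite mulmx0 D4 !mulmxA => <-; mx_abel.
Qed.

(** The Ricci identity for the field [xi] computes [R(u, v) xi] from [nabla (nabla xi)], and the
    [(kappa, mu)] condition prescribes it; [nabla xi] is then split as [S - phi]. *)
Let Rxi y u v : U y ->
  (v *m mcov G u S y - v *m mcov G u F y) - (u *m mcov G v S y - u *m mcov G v F y)
  = kappa *: (ip (G y) v (xi y) *: u - ip (G y) u (xi y) *: v)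
  + mu *: (ip (G y) v (xi y) *: (u *m S y *m F y)
           - ip (G y) u (xi y) *: (v *m S y *m F y)).
Proof.
move=> Uy; have := kmu u v Uy.
rewrite -!gxi// !hprimeE// => <-.
rewrite (lc_curvatureE oU sG posG u v (xi y) Uy).
rewrite -(ricci_identity_row oU sG posG u v Uy sxi).
have E a (b : 'rV[R]_d) : rcov G a (rcov G b xi) y = b *m Gam G a y *m A y + b *m mcov G a A y.
  rewrite -(rcov_cst_mulmx G a b (dA Uy)); apply: rcov_near.
  by apply: filterS (nbhsU oU Uy) => z Uz; rewrite AE.
have EA a (b : 'rV[R]_d) : b *m mcov G a S y = b *m mcov G a A y + b *m mcov G a F y.
  by rewrite mcovS// mulmxDr.
rewrite (E u v) (E v u) (EA u v) (EA v u).
rewrite (Gam_sym oU symG u v Uy).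
mx_abel.
Qed.

Let Ssq y u : U y -> ip (G y) u (xi y) = 0 ->
  u *m S y *m S y = (1 - kappa) *: u.
Proof.
move=> Uy; exact: (S_square (J := mulmxr (F y)) (A := mulmxr (A y)) (S := mulmxr (S y))
  (nJ := fun u => mulmxr (mcov G u F y)) (nS := fun u => mulmxr (mcov G u S y))
  (ip_inner symG posG Uy) (fun v => J2 v Uy) (xi1 Uy) (Fxi Uy)
  (fun u v => Jskew u v Uy) (SE y)
  (fun u => Ahor u Uy) (fun u v => A_alt u v Uy) (fun u v w => nJ_skew u v w Uy)
  (fun u v w => nJ_cyc u v w Uy) (fun u v => nJ_J u v Uy) (fun u => nJ_xi u Uy)
  (fun u v w => nS_sym u v w Uy) (fun u => nS_xi u Uy) (fun u v => nS_J u v Uy)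
  (fun u v => Rxi u v Uy)).
Qed.

(** For [kappa = 1], [S^2] vanishes on the contact distribution, and a symmetric operator of square
    zero vanishes by positivity. This happens on the whole chart, so the derivative of [S] vanishes
    too. *)
Let cases y : U y -> kappa != 1 \/ (forall u v, v *m mcov G u S y = 0).
Proof.
move=> Uy; have [k1|k1] := eqVneq kappa 1; [right|by left] => u v.
have N : \forall z \near y, S z = cst 0 z.
  apply: filterS (nbhsU oU Uy) => z Uz; apply: mx_ext => w.
  rewrite mulmx0; pose w' := w - ip (G z) w (xi z) *: xi z.
  have hw : ip (G z) w' (xi z) = 0 by rewrite /w' !ip_lin xi1// mulr1 subrr.
  have -> : w *m S z = w' *m S z.
    by rewrite /w' mulmxBl -scalemxAl Sxi// scaler0 subr0.
  apply/eqP/negPn/negP => /(posG Uz).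
  by rewrite Ssym// Ssq// k1 subrr scale0r ip0r ltxx.
by rewrite (mcov_near G u N) mcov0 mulmx0.
Qed.

Let nphi y u v : U y -> v *m mcov G u F y =
  ip (G y) (u *m T y) v *: xi y - ip (G y) v (xi y) *: (u *m T y).
Proof.
move=> Uy; exact: (nabla_phi (J := mulmxr (F y)) (A := mulmxr (A y)) (S := mulmxr (S y))
  (nJ := fun u => mulmxr (mcov G u F y)) (nS := fun u => mulmxr (mcov G u S y))
  (ip_inner symG posG Uy) (fun v => J2 v Uy) (xi1 Uy) (Fxi Uy)
  (fun u v => Jskew u v Uy) (SE y)
  (fun u => Ahor u Uy) (fun u v => A_alt u v Uy) (fun u v w => nJ_skew u v w Uy)
  (fun u v w => nJ_cyc u v w Uy) (fun u v => nJ_J u v Uy) (fun u => nJ_xi u Uy)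
  (TE y)
  (fun u v w => nS_sym u v w Uy) (fun u => nS_xi u Uy) (fun u v => nS_J u v Uy)
  (fun u v => Rxi u v Uy) u v (cases Uy)).
Qed.

(** The Ricci identity for [phi]: the commutator of the curvature with [phi] is the skew part of the
    second derivative of [phi], obtained by differentiating [nphi]. *)
Let Rm_J y u v w z : U y ->
  ip (G y) u (xi y) = 0 -> ip (G y) v (xi y) = 0 ->
  ip (G y) w (xi y) = 0 -> ip (G y) z (xi y) = 0 ->
  ip (G y) (w *m F y *m Om G u v y) z + ip (G y) (w *m Om G u v y) (z *m F y) =
  - (ip (G y) (v *m T y) w * ip (G y) (u *m T y *m F y) z)
  + ip (G y) (u *m T y) w * ip (G y) (v *m T y *m F y) z
  + ip (G y) (u *m T y *m F y) w * ip (G y) (v *m T y) z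
  - ip (G y) (v *m T y *m F y) w * ip (G y) (u *m T y) z.
Proof.
move=> Uy hu hv hw hz.
have AT (a : 'rV[R]_d) : a *m A y = - (a *m T y *m F y).
  rewrite TE mulmxDl F2// -gxi// Ssym// Sxi// ip0r scale0r addr0 opprB.
  by rewrite SE addrK.
(* The derivative of [T] survives nowhere: it occurs in a coefficient of [xi], which is orthogonal
   to [z], or with the factor [g(w, xi) = 0]. *)
have H (a b : 'rV[R]_d) : ip (G y) (w *m mcov G a (mcov G b F) y) z =
    ip (G y) (b *m T y) w * ip (G y) (a *m A y) z
    - ip (G y) w (a *m A y) * ip (G y) (b *m T y) z.
  have dm := differentiable_mcov oU sG posG b Uy sF.
  have dbT := differentiable_cst_mulmx b (dT Uy).
  have d1 : differentiable (fun z => ip (G z) (b *m T z) w) y.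
    exact: (differentiable_ip sG (X := fun z => b *m T z) (Y := cst w) Uy).
  have d2 : differentiable (fun z => ip (G z) w (xi z)) y.
    exact: (differentiable_ip sG (X := cst w) Uy _ (dxi Uy)).
  have N : \forall x \near y, w *m mcov G b F x =
      ip (G x) (b *m T x) w *: xi x + - (ip (G x) w (xi x) *: (b *m T x)).
    by apply: filterS (nbhsU oU Uy) => x Ux; rewrite nphi.
  have := rcov_cst_mulmx G a w dm; rewrite (rcov_near G a N).
  have d3 := differentiable_scale d1 (dxi Uy).
  have d4 := differentiable_scale d2 dbT.
  rewrite (rcovD G a d3 (differentiableN d4)) (rcovN G a d4).
  rewrite (rcovZ G a d1 (dxi Uy)) (rcovZ G a d2 dbT).
  rewrite (nphi b (w *m Gam G a y) Uy) -(AE a Uy) hw scale0r addr0.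
  rewrite (derive_metric oU sG symG posG a Uy (X := cst w) _ (dxi Uy))//.
  rewrite rcov_cst -(AE a Uy) => /(congr1 (fun x => ip (G y) x z)).
  rewrite !ip_lin (ip_sym (xi y) z (symG Uy)) hz; lra.
have D (a b a' b' : 'M[R]_d) : a - b = a' - b' -> ip (G y) (w *m a) z
    - ip (G y) (w *m b) z = ip (G y) (w *m a') z - ip (G y) (w *m b') z.
  by move=> E; rewrite -!ipNl -!ipDl -!mulmxBr E.
have := D _ _ _ _ (ricci_identity_mx oU sG posG u v Uy sF).
rewrite !mulmxA (H u v) (H v u) (Jskew _ _ Uy) opprK => <-.
rewrite !AT !ip_lin !(ip_sym w _ (symG Uy)); ring.
Qed.

Lemma hprime_sym y u v : U y ->
  ip (G y) (hprime F xi y u) v = ip (G y) u (hprime F xi y v).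
Proof.
by move=> Uy; rewrite !hprimeE// Jskew// Ssym// -[v *m F y *m S y]opprK -JSa// ipNr opprK.
Qed.

Lemma space_form_sectional y u v : U y ->
  let g := ip (G y) in let eta u := g u (xi y) in let h := hprime F xi y in
  let phi_h u := h u *m F y in
  g (lc_curvature G y u v v) u =
  (c + 3) / 4 * (g u u * g v v - g u v ^+ 2)
  + (c + 3 - 4 * kappa) / 4 * (2 * (eta u * eta v * g u v)
      - eta v ^+ 2 * g u u - eta u ^+ 2 * g v v)
  + 3 * (c - 1) / 4 * g (u *m F y) v ^+ 2
  + 2^-1 * (g (h v) v * g (h u) u - g (h u) v ^+ 2
            + g (phi_h u) v ^+ 2 - g (phi_h v) v * g (phi_h u) u)
  - g u v * g (h v) u + g v v * g (h u) u
  + eta u * eta v * g (h v) u - eta v ^+ 2 * g (h u) u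
  - g (h u) v * g u v + g (h v) v * g u u
  - g (h v) v * eta u ^+ 2 + g (h u) v * eta u * eta v
  + mu * (eta v ^+ 2 * g (h u) u - eta u * eta v * g (h v) u
          + g (h v) v * eta u ^+ 2 - g (h u) v * eta u * eta v).
Proof.
move=> Uy g eta' h phi_h.
have hE a : h a = a *m S y *m F y by rewrite /h hprimeE.
have pE a : phi_h a = - (a *m S y).
  by rewrite /phi_h hE J2// Ssym// Sxi// ip0r scale0r addr0.
have H := sectional_formula (ip_inner symG posG Uy) (posG Uy)
  (J := mulmxr (F y)) (S := mulmxr (S y)) (T := mulmxr (T y)) (c := c) (kappa := kappa) (mu := mu)
  (fun v => J2 v Uy) (xi1 Uy) (Fxi Uy) (fun u v => Jskew u v Uy)
  (fun u v => Ssym u v Uy) (Sxi Uy) (fun v => JSa v Uy) (TE y)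
  (Om_like oU sG symG posG Uy).
rewrite (lc_curvatureE oU sG posG u v v Uy) !hE !pE /g !ip_lin.
apply: etrans (H _ _ _ u v) _.
- move=> a b z; rewrite -(lc_curvatureE oU sG posG a b (xi y) Uy) kmu// !hprimeE//.
  by rewrite -!gxi// !ip_lin.
- by move=> a b w z; exact: Rm_J Uy.
- move=> a a1 ah; rewrite -(lc_curvatureE oU sG posG _ _ _ Uy) -(hol Uy a1 ah).
  have e1 : ip (G y) a (a *m F y) = 0.
    have := Jskew a a Uy; rewrite (ip_sym _ _ (symG Uy)); lra.
  have e2 : ip (G y) (a *m F y) (a *m F y) = 1.
    by rewrite Jskew// J2// ah scale0r addr0 ip_lin opprK.
  by rewrite /sectional a1 e1 e2 expr0n subr0 mulr1 divr1.
by rewrite /eta' /g /=; ring.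
Qed.

End ContactChart.

(** * Geometry of an immersion *)

Section Pullback.
Variables (R : realType) (n d : nat) (U : set 'rV[R]_d) (V : set 'rV[R]_n).
Hypothesis oU : open U.
Hypothesis oV : open V.
Variable G : 'rV[R]_d -> 'M[R]_d.
Hypothesis sG : smooth_mx_on U G.
Hypothesis symG : forall z, U z -> (G z)^T = G z.
Hypothesis posG : forall z, U z -> forall v : 'rV[R]_d, v != 0 -> 0 < ip (G z) v v.
Variable F : 'rV[R]_n -> 'rV[R]_d.
Hypothesis sF : smooth_mx_on V F.
Hypothesis FVU : forall z, V z -> U (F z).
Implicit Types (u v w : 'rV[R]_n) (y z : 'rV[R]_n).
Implicit Types (W X Y : 'rV[R]_n -> 'rV[R]_d).

(** The connection pulled back by [F], acting on ambient vectors attached to points of the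
    submanifold; no extension to the ambient chart is involved. *)
Definition pcov u W y := 'D_u W y + W y *m Gam G (push F y u) (F y).

Let dF z : V z -> differentiable F z.
Proof. exact: smooth_mx_differentiable. Qed.

Lemma pushE u y : V y -> push F y u = 'D_u F y.
Proof. by move=> Vy; rewrite /push deriveEjacobian//; exact: dF. Qed.

Lemma smooth_push u : smooth_mx_on V (fun z => push F z u).
Proof.
move=> i j; apply: smooth_on_eq (smooth_mx_derive oV u sF i j) => //.
by move=> z Vz; rewrite pushE.
Qed.

Lemma derive_along (k l : nat) (Q : 'rV[R]_d -> 'M[R]_(k, l)) u y : V y ->
  differentiable Q (F y) -> 'D_u (fun z => Q (F z)) y = 'D_(push F y u) Q (F y).
Proof. by move=> Vy dQ; rewrite (derive_comp u (dF Vy) dQ) pushE. Qed.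

Lemma differentiable_along (W : normedModType R) (Q : 'rV[R]_d -> W) y : V y ->
  differentiable Q (F y) -> differentiable (fun z => Q (F z)) y.
Proof. by move=> Vy dQ; exact: (differentiable_comp (dF Vy) dQ). Qed.

Lemma derive_along_metric u X Y y : V y -> differentiable X y ->
  differentiable Y y ->
  'D_u (fun z => ip (G (F z)) (X z) (Y z)) y =
  ip (G (F y)) (pcov u X y) (Y y) + ip (G (F y)) (X y) (pcov u Y y).
Proof.
move=> Vy dX dY; have dGy : differentiable G (F y).
  exact: smooth_mx_differentiable sG (FVU Vy).
apply: (derive_form (B := fun z => G (F z)) (Gu := Gam G (push F y u) (F y))) => //.
  exact: differentiable_along.
rewrite (derive_along u Vy dGy).
 exact: (metric_compat oU sG symG posG (push F y u) (FVU Vy)).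
Qed.

Lemma differentiable_along_ip X Y y : V y -> differentiable X y ->
  differentiable Y y -> differentiable (fun z => ip (G (F z)) (X z) (Y z)) y.
Proof.
move=> Vy dX dY.
have /differentiable_mxP : differentiable (fun z => X z *m G (F z) *m (Y z)^T) y.
  apply: differentiable_mulmx; last exact: differentiable_trmx.
  apply: differentiable_mulmx => //; apply: differentiable_along => //.
  exact: smooth_mx_differentiable sG (FVU Vy).
exact.
Qed.

Lemma pcovD u X Y y : differentiable X y -> differentiable Y y ->
  pcov u (fun z => X z + Y z) y = pcov u X y + pcov u Y y.
Proof.
move=> dX dY; rewrite /pcov deriveD; [|exact: diff_derivable..].
by rewrite mulmxDl addrACA.
Qed.

Lemma pcovN u X y : differentiable X y ->
  pcov u (fun z => - X z) y = - pcov u X y.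
Proof.
move=> dX; rewrite /pcov deriveN; last exact: diff_derivable.
by rewrite mulNmx opprD.
Qed.

Lemma pcovZ u (f : 'rV[R]_n -> R) X y : differentiable f y -> differentiable X y ->
  pcov u (fun z => f z *: X z) y = 'D_u f y *: X y + f y *: pcov u X y.
Proof.
by move=> df dX; rewrite /pcov derive_scale// -scalemxAl scalerDr addrA.
Qed.

Lemma pcov_near u X Y y : (\forall z \near y, X z = Y z) -> pcov u X y = pcov u Y y.
Proof.
by move=> E; rewrite /pcov (near_eq_derive _ E) (nbhs_singleton E).
Qed.

Lemma pcov_along u (Q : 'rV[R]_d -> 'rV[R]_d) y : V y -> differentiable Q (F y) ->
  pcov u (fun z => Q (F z)) y = rcov G (push F y u) Q (F y).
Proof. by move=> Vy dQ; rewrite /pcov (derive_along u Vy dQ). Qed.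

Lemma derive_push_sym u v y : V y ->
  'D_u (fun z => push F z v) y = 'D_v (fun z => push F z u) y.
Proof.
move=> Vy.
have E a : \forall z \near y, push F z a = 'D_a F z.
  by apply: filterS (nbhsU oV Vy) => z Vz; rewrite pushE.
rewrite (near_eq_derive _ (E u)) (near_eq_derive _ (E v)).
have -> := smooth_mx_young oV v u sF Vy.
reflexivity.
Qed.

Lemma pcov_push_sym u v y : V y ->
  pcov u (fun z => push F z v) y = pcov v (fun z => push F z u) y.
Proof.
move=> Vy; rewrite /pcov (derive_push_sym u v Vy).
by rewrite (Gam_sym oU symG (push F y u) (push F y v) (FVU Vy)).
Qed.

Let GamF u z := Gam G (push F z u) (F z).

Let GamFE u z : GamF u z = \sum_i push F z u 0 i *: Gam G (delta_mx 0 i) (F z).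
Proof. by rewrite /GamF {1}(row_sum_delta (push F z u)) Gam_sum. Qed.

Let dpush u y : V y -> differentiable (fun z => push F z u) y.
Proof. by move=> Vy; exact: smooth_mx_differentiable (smooth_push u) Vy. Qed.

Let dGam (a : 'rV[R]_d) y : V y -> differentiable (Gam G a) (F y).
Proof.
move=> Vy.
refine (differentiable_Gam oU sG posG a (FVU Vy)).
Qed.

Let dterm u y i : V y ->
  differentiable (fun z => push F z u 0 i *: Gam G (delta_mx 0 i) (F z)) y.
Proof.
move=> Vy; apply: differentiable_scale.
  by move/differentiable_mxP: (dpush u Vy); exact.
exact: (differentiable_along (Q := Gam G (delta_mx 0 i)) Vy (dGam _ Vy)).
Qed.

Let dGamF u y : V y -> differentiable (GamF u) y.
Proof.
move=> Vy; apply: (near_eq_differentiable (f := fun z =>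
    \sum_i push F z u 0 i *: Gam G (delta_mx 0 i) (F z))).
  by near=> z; rewrite GamFE.
by apply: differentiable_big_sum => i _; exact: dterm.
Unshelve. all: by end_near. Qed.

(** Both the direction [push F z u] and the base point [F z] move with [z]; the two terms account
    for one each. *)
Let derive_GamF u v y : V y -> 'D_v (GamF u) y =
  Gam G ('D_v (fun z => push F z u) y) (F y)
  + 'D_(push F y v) (Gam G (push F y u)) (F y).
Proof.
move=> Vy; have -> : GamF u = \sum_i (fun z => push F z u 0 i *: Gam G (delta_mx 0 i) (F z)).
  by apply/funext => z; rewrite GamFE fct_sumE.
rewrite derive_sum; last by move=> i; exact: diff_derivable (dterm u i Vy).
have -> : Gam G (push F y u) = \sum_i push F y u 0 i *: Gam G (delta_mx 0 i).
  apply/funext => x; rewrite {1}(row_sum_delta (push F y u)) Gam_sum fct_sumE.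
  by apply: eq_bigr.
rewrite derive_sum; last first.
  by move=> i; apply: derivableZ; exact: diff_derivable (dGam _ Vy).
rewrite {1}(row_sum_delta ('D_v (fun z => push F z u) y)) Gam_sum -big_split; apply: eq_bigr => i _ /=.
have dp : differentiable (fun z => push F z u 0 i) y.
  by move/differentiable_mxP: (dpush u Vy); exact.
rewrite derive_scale//; last exact: (differentiable_along Vy (dGam _ Vy)).
rewrite deriveZ; last exact: diff_derivable (dGam _ Vy).
by rewrite (derive_along v Vy (dGam _ Vy)) (derive_entry v 0 i (dpush u Vy)).
Qed.

Lemma differentiable_pcov u W y : V y -> smooth_mx_on V W ->
  differentiable (pcov u W) y.
Proof.
move=> Vy sW; apply: differentiableD.
  by apply: smooth_mx_differentiable Vy; exact: smooth_mx_derive.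
by apply: differentiable_mulmx; [exact: smooth_mx_differentiable Vy|exact: dGamF].
Qed.

(** The curvature of the pulled-back connection is the pulled-back curvature; derivatives of the
    pushed directions cancel by [derive_push_sym]. *)
Lemma pcov_curvature u v W y : V y -> smooth_mx_on V W ->
  pcov u (pcov v W) y - pcov v (pcov u W) y =
  W y *m Om G (push F y u) (push F y v) (F y).
Proof.
move=> Vy sW.
have dW z : V z -> differentiable W z by exact: smooth_mx_differentiable.
have dDW a : differentiable ('D_a W) y.
  by apply: smooth_mx_differentiable Vy; exact: smooth_mx_derive.
have E a b : 'D_b (pcov a W) y =
    'D_b ('D_a W) y + ('D_b W y *m GamF a y + W y *m 'D_b (GamF a) y).
  have dg := dGamF a Vy.
  rewrite [in LHS](_ : pcov a W = 'D_a W + (fun z => W z *m GamF a z))//.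
  rewrite deriveD; [|exact: diff_derivable|]; last first.
    by apply: diff_derivable; apply: differentiable_mulmx => //; exact: dW.
  by rewrite derive_mulmx//; exact: dW.
have Y := derive_push_sym v u Vy.
have P a b : pcov a (pcov b W) y = 'D_b ('D_a W) y + ('D_a W y *m GamF b y
   + W y *m (Gam G ('D_a (fun z => push F z b) y) (F y)
     + 'D_(push F y a) (Gam G (push F y b)) (F y)))
   + ('D_b W y + W y *m GamF b y) *m GamF a y.
  rewrite {1}/pcov E -(derive_GamF b a Vy) (smooth_mx_young oV b a sW Vy).
  by rewrite /pcov /GamF.
rewrite (P u v) (P v u) (smooth_mx_young oV u v sW Vy) Y /Om /GamF.
rewrite !(mulmxDl, mulmxDr, mulmxN, mulNmx, mulmxA); mx_abel.
Qed.

End Pullback.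

(** * Second fundamental form and Gauss equation of the induced connection *)

Section InducedGeometry.
Variables (R : realType) (n d : nat) (U : set 'rV[R]_d) (V : set 'rV[R]_n).
Hypothesis oU : open U.
Hypothesis oV : open V.
Variable G : 'rV[R]_d -> 'M[R]_d.
Hypothesis sG : smooth_mx_on U G.
Hypothesis symG : forall z, U z -> (G z)^T = G z.
Hypothesis posG : forall z, U z -> forall v : 'rV[R]_d, v != 0 -> 0 < ip (G z) v v.
Variable F : 'rV[R]_n -> 'rV[R]_d.
Hypothesis sF : smooth_mx_on V F.
Hypothesis FVU : forall z, V z -> U (F z).
Hypothesis immF : forall z, V z -> row_free (jacobian F z).
Variable P : 'rV[R]_d -> 'rV[R]_d.
Hypothesis sP : smooth_mx_on U P.
Variables l1 l2 : R.
Implicit Types (u v w t : 'rV[R]_n) (y z : 'rV[R]_n).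
Implicit Types (W X Y : 'rV[R]_n -> 'rV[R]_d).

Local Notation pc := (pcov G F).
Local Notation g y := (ip (G (F y))).
Local Notation pi y := (pi_form G P (F y)).

Lemma pushD y u v : push F y (u + v) = push F y u + push F y v.
Proof. exact: mulmxDl. Qed.

Lemma pushZ y a u : push F y (a *: u) = a *: push F y u.
Proof. by rewrite /push scalemxAl. Qed.

Lemma induced_ip y u v :
  ip (induced_metric G F y) u v = ip (G (F y)) (push F y u) (push F y v).
Proof. exact: ip_congr. Qed.

Lemma induced_pos y v : V y -> v != 0 -> 0 < ip (induced_metric G F y) v v.
Proof.
move=> Vy v0; rewrite induced_ip; apply: posG; first exact: FVU.
apply: contra_neq v0 => v0; apply: (row_free_inj (immF Vy)).
by rewrite mul0mx; exact: v0.
Qed.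

Lemma induced_unit y : V y -> induced_metric G F y \in unitmx.
Proof. by move=> Vy; apply: posdef_unitmx => w; exact: induced_pos. Qed.

Lemma tangential_ip y (w : 'rV[R]_d) t : V y ->
  ip (induced_metric G F y) (tangential G F y w) t = ip (G (F y)) w (push F y t).
Proof.
by move=> Vy; rewrite /ip /tangential mulmxKV ?induced_unit// /push trmx_mul !mulmxA.
Qed.

Lemma normal_orth y (w : 'rV[R]_d) t : V y ->
  ip (G (F y)) (normal_part G F y w) (push F y t) = 0.
Proof.
by move=> Vy; rewrite /normal_part ipDl ipNl -induced_ip tangential_ip// subrr.
Qed.

Lemma tangentialE y (w : 'rV[R]_d) : tangential G F y w =
  w *m (G (F y) *m (jacobian F y)^T *m invmx (induced_metric G F y)).
Proof. by rewrite /tangential !mulmxA. Qed.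

Lemma tangential_push y t : V y -> tangential G F y (push F y t) = t.
Proof.
move=> Vy; rewrite tangentialE /push !mulmxA.
have -> : t *m jacobian F y *m G (F y) *m (jacobian F y)^T = t *m induced_metric G F y.
  by rewrite /induced_metric !mulmxA.
by rewrite mulmxK// induced_unit.
Qed.

Lemma normalE y : exists Q : 'M[R]_d, forall w : 'rV[R]_d, normal_part G F y w = w *m Q.
Proof.
exists (1%:M - G (F y) *m (jacobian F y)^T *m invmx (induced_metric G F y) *m jacobian F y).
by move=> w; rewrite mulmxBr mulmx1 /normal_part /push tangentialE !mulmxA.
Qed.

Lemma normalD y (a b : 'rV[R]_d) :
  normal_part G F y (a + b) = normal_part G F y a + normal_part G F y b.
Proof. by have [Q QE] := normalE y; rewrite !QE mulmxDl. Qed.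

Lemma normalZ y c (a : 'rV[R]_d) :
  normal_part G F y (c *: a) = c *: normal_part G F y a.
Proof. by have [Q QE] := normalE y; rewrite !QE scalemxAl. Qed.

Lemma normal_push y t : V y -> normal_part G F y (push F y t) = 0.
Proof. by move=> Vy; rewrite /normal_part tangential_push// subrr. Qed.

Definition nbar u W y := pcov G F u W y
  + (l1 * pi y (W y)) *: push F y u - (l2 * g y (push F y u) (W y)) *: P (F y).

Lemma nabla_barE (X : 'rV[R]_n -> 'rV[R]_n) W y :
  nabla_bar G P l1 l2 F X W y = nbar (X y) W y.
Proof. by rewrite /nabla_bar /nbar christoffel_termE. Qed.

Lemma differentiable_push u y : V y -> differentiable (fun z => push F z u) y.
Proof. by move=> Vy; exact: smooth_mx_differentiable (smooth_push oV sF u) Vy. Qed.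

Lemma differentiable_jacobian y : V y -> differentiable (jacobian F) y.
Proof.
move=> Vy; apply/differentiable_mxP => i j.
apply: (near_eq_differentiable (f := fun z => push F z (delta_mx 0 i) 0 j)).
  by near=> z; rewrite /push -rowE mxE.
by move/differentiable_mxP: (differentiable_push (delta_mx 0 i) Vy); exact.
Unshelve. all: by end_near. Qed.

Let dGF y : V y -> differentiable (fun z => G (F z)) y.
Proof.
move=> Vy; refine (differentiable_along sF Vy _).
exact: smooth_mx_differentiable sG (FVU Vy).
Qed.

Let dPy y : V y -> differentiable P (F y).
Proof. by move=> Vy; exact: smooth_mx_differentiable sP (FVU Vy). Qed.

Let dPF y : V y -> differentiable (fun z => P (F z)) y.
Proof. by move=> Vy; refine (differentiable_along sF Vy (dPy Vy)). Qed.

Lemma differentiable_tangential W y : V y -> differentiable W y ->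
  differentiable (fun z => push F z (tangential G F z (W z))) y.
Proof.
move=> Vy dW; have dj := differentiable_jacobian Vy; have dg := dGF Vy.
have djt := differentiable_trmx dj.
have dI : differentiable (induced_metric G F) y.
  by apply: differentiable_mulmx djt; exact: differentiable_mulmx.
apply: differentiable_mulmx dj; apply: differentiable_mulmx.
  by apply: differentiable_mulmx djt; exact: differentiable_mulmx.
apply: differentiable_invmx dI.
by apply: filterS (nbhsU oV Vy) => z; exact: induced_unit.
Qed.

Let Ef v w z : 'rV[R]_d := nbar v (fun z => push F z w) z.
Local Notation h := (second_form G P l1 l2 F).

Lemma second_formE y v w : h y v w = normal_part G F y (nbar v (fun z => push F z w) y).
Proof. by rewrite /second_form nabla_barE. Qed.

Let d_ip X Y y : V y -> differentiable X y -> differentiable Y y ->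
  differentiable (fun z => g z (X z) (Y z)) y.
Proof. exact: differentiable_along_ip. Qed.

Let dE v w y : V y -> differentiable (Ef v w) y.
Proof.
move=> Vy; have dp a := differentiable_push a Vy; have dPFy := dPF Vy.
apply: differentiableB; last first.
  apply: differentiable_scale => //; apply: differentiableM.
    exact: differentiable_cst.
  exact: d_ip.
apply: differentiableD.
  refine (differentiable_pcov oU oV sG posG sF FVU v Vy (smooth_push oV sF w)).
apply: differentiable_scale => //; apply: differentiableM.
  exact: differentiable_cst.
exact: d_ip.
Qed.

Lemma nbarB u X Y y : differentiable X y -> differentiable Y y ->
  nbar u (fun z => X z - Y z) y = nbar u X y - nbar u Y y.
Proof.
move=> dX dY; rewrite /nbar (pcovD G F u dX (differentiableN dY)) (pcovN G F u dY).
rewrite /pi_form !ipDr !ipNr !mulrBr !scalerBl; mx_abel.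
Qed.

(** Weingarten formula, from differentiating [g(N, push t) = 0]. The [l1] comes from [nbar] itself,
    the [- l2] from the normal component of [P] contained in [h]. *)
Lemma nbar_normal (N : 'rV[R]_n -> 'rV[R]_d) u t y : V y -> differentiable N y ->
  (forall z s, V z -> g z (N z) (push F z s) = 0) ->
  g y (nbar u N y) (push F y t) =
  - g y (N y) (h y u t) + (l1 - l2) * pi y (N y) * g y (push F y u) (push F y t).
Proof.
move=> Vy dN N0.
have dpt := differentiable_push t Vy.
have := derive_along_metric oU sG symG posG sF FVU u Vy dN dpt.
have Z : \forall z \near y, g z (N z) (push F z t) = cst 0 z.
  by apply: filterS (nbhsU oV Vy) => z Vz; exact: N0.
rewrite (near_eq_derive _ Z) derive_cst => E1.
have sy a b : g y a b = g y b a by apply: ip_sym; exact: symG (FVU Vy).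
have : g y (N y) (h y u t) = g y (N y) (nbar u (fun z => push F z t) y).
  by rewrite second_formE /normal_part ipDr ipNr N0// subr0.
rewrite /nbar !ip_lin (sy (push F y u) (N y)) !(N0 y _ Vy) => ->.
rewrite /pcov ipDl ipDr in E1.
rewrite /pi_form (sy (N y) (P (F y))); lra.
Qed.

Let sy y a b : V y -> g y a b = g y b a.
Proof. by move=> Vy; apply: ip_sym; exact: symG (FVU Vy). Qed.

Lemma nbar0 W y : nbar 0 W y = 0.
Proof.
by rewrite /nbar /pcov /push derive0 mul0mx Gam0 mulmx0 scaler0 ip0l mulr0 scale0r subr0 !addr0.
Qed.

Lemma nbar_near u X Y y : (\forall z \near y, X z = Y z) -> nbar u X y = nbar u Y y.
Proof.
by move=> E; rewrite /nbar (pcov_near G F u E) (nbhs_singleton E).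
Qed.

(** The pushed induced derivative is [Ef b w - h b w]. Only its pairing with tangent vectors is
    required, so the derivative of the normal part is handled by [nbar_normal]. *)
Lemma curv4E y u v w t : V y ->
  curv4 G P l1 l2 F y u v w t =
  g y (nbar u (Ef v w) y - nbar v (Ef u w) y) (push F y t)
  + g y (h y v w) (h y u t) - g y (h y u w) (h y v t)
  - (l1 - l2) * (pi y (h y v w) * g y (push F y u) (push F y t)
                 - pi y (h y u w) * g y (push F y v) (push F y t)).
Proof.
move=> Vy; rewrite /curv4 /curvature.
have nablaE (a b : 'rV[R]_n -> 'rV[R]_n) z : nabla G P l1 l2 F a b z =
    tangential G F z (nbar (a z) (fun z => push F z (b z)) z).
  by rewrite /nabla nabla_barE.
rewrite !nablaE.
have -> : bracket (cst u) (cst v) y = 0 by rewrite /bracket !derive_cst subrr.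
have t0 : tangential G F y 0 = 0 by rewrite tangentialE mul0mx.
rewrite (nbar0 (fun z => push F z (cst w z)) y) t0 subr0 ipDl ipNl.
apply: etrans (congr2 (fun a b => a - b) (tangential_ip _ t Vy) (tangential_ip _ t Vy)) _.
have hE a b z : h z a b = Ef a b z - push F z (tangential G F z (Ef a b z)).
  by rewrite second_formE.
have dh a b : differentiable (fun z => h z a b) y.
  apply: (near_eq_differentiable (f := fun z =>
    Ef a b z - push F z (tangential G F z (Ef a b z)))).
    by near=> z; rewrite hE.
  by refine (differentiableB (dE a b Vy) (differentiable_tangential Vy (dE a b Vy))).
have K a b : g y (nbar a (fun z => push F z (nabla G P l1 l2 F (cst b) (cst w) z)) y) (push F y t)
   = g y (nbar a (Ef b w) y) (push F y t) + g y (h y b w) (h y a t)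
     - (l1 - l2) * pi y (h y b w) * g y (push F y a) (push F y t).
  have N : \forall z \near y, push F z (nabla G P l1 l2 F (cst b) (cst w) z) =
      Ef b w z - h z b w.
    by near=> z; rewrite nablaE hE opprB addrC subrK.
  rewrite (nbar_near a N) nbarB; [|exact: dE|exact: dh].
  rewrite ipDl ipNl (nbar_normal a t Vy (dh b w)); first by ring.
  by move=> z s Vz; rewrite second_formE normal_orth.
apply: etrans (congr2 (fun a b => a - b) (K u v) (K v u)) _.
generalize (h y v w) (h y u w) (h y u t) (h y v t).
generalize (nbar u (Ef v w) y) (nbar v (Ef u w) y).
generalize (push F y u) (push F y v) (push F y t).
move=> b1 b2 b3 a1 a2 h1 h2 h3 h4; rewrite /pi_form !ip_lin; ring.
Unshelve. all: by end_near. Qed.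

(** The symmetric or skew parts are not separated: this is [g(nabla_u P, w)], the leading term of
    [alpha]. *)
Let q y u w := g y (rcov G (push F y u) P (F y)) (push F y w).

Lemma nbar_curvature y u v w t : V y ->
  g y (nbar u (Ef v w) y - nbar v (Ef u w) y) (push F y t) =
  g y (push F y w *m Om G (push F y u) (push F y v) (F y)) (push F y t)
  + l1 * (q y u w * g y (push F y v) (push F y t) - q y v w * g y (push F y u) (push F y t))
  + l1 ^+ 2 * pi y (push F y w) * (pi y (push F y v) * g y (push F y u) (push F y t)
       - pi y (push F y u) * g y (push F y v) (push F y t))
  - l1 * l2 * pi y (P (F y)) * (g y (push F y v) (push F y w) * g y (push F y u) (push F y t)
       - g y (push F y u) (push F y w) * g y (push F y v) (push F y t))
  - l2 * (g y (push F y v) (push F y w) * q y u t - g y (push F y u) (push F y w) * q y v t)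
  + l2 ^+ 2 * (g y (push F y v) (push F y w) * pi y (push F y u)
       - g y (push F y u) (push F y w) * pi y (push F y v)) * pi y (push F y t).
Proof.
move=> Vy; have dp a := differentiable_push a Vy; have dPFy := dPF Vy.
set W := fun z => push F z w.
(* One iterated derivative is expanded; exchanging [a] and [b] and subtracting leaves [Om] and the
   terms in [P], since [pcov] is symmetric on pushed constant fields. *)
have K a b : g y (nbar a (Ef b w) y) (push F y t) =
    g y (pc a (pc b W) y) (push F y t)
  + l1 * (q y a w + pi y (pc a W y)) * g y (push F y b) (push F y t)
  + l1 * pi y (push F y w) * g y (pc a (fun z => push F z b) y) (push F y t)
  - l2 * (g y (pc a (fun z => push F z b) y) (push F y w) + g y (push F y b) (pc a W y))
     * pi y (push F y t)
  - l2 * g y (push F y b) (push F y w) * q y a t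
  + l1 * (pi y (pc b W y) + l1 * pi y (push F y w) * pi y (push F y b)
     - l2 * g y (push F y b) (push F y w) * pi y (P (F y))) * g y (push F y a) (push F y t)
  - l2 * (g y (push F y a) (pc b W y) + l1 * pi y (push F y w) * g y (push F y a) (push F y b)
     - l2 * g y (push F y b) (push F y w) * pi y (push F y a)) * pi y (push F y t).
  have dW : differentiable W y by exact: dp.
  have d1 : differentiable (fun z => l1 * pi z (W z)) y.
    by apply: differentiableM; [exact: differentiable_cst|exact: d_ip].
  have d2 : differentiable (fun z => l2 * g z (push F z b) (W z)) y.
    by apply: differentiableM; [exact: differentiable_cst|apply: d_ip].
  have d3 : differentiable (pc b W) y.
    refine (differentiable_pcov oU oV sG posG sF FVU b Vy (smooth_push oV sF w)).
  have d4 := differentiable_scale d1 (dp b).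
  have d5 := differentiable_scale d2 dPFy.
  have D1 : 'D_a (fun z => l1 * pi z (W z)) y = l1 * (q y a w + pi y (pc a W y)).
    have -> : 'D_a (fun z => l1 * pi z (W z)) y = l1 * 'D_a (fun z => pi z (W z)) y.
      by apply: (deriveZ l1); apply: diff_derivable; exact: d_ip.
    rewrite /pi_form (derive_along_metric oU sG symG posG sF FVU a Vy dPFy dW).
    by rewrite (pcov_along G sF a Vy (dPy Vy)).
  have D2 : 'D_a (fun z => l2 * g z (push F z b) (W z)) y =
      l2 * (g y (pc a (fun z => push F z b) y) (push F y w) + g y (push F y b) (pc a W y)).
    have -> : 'D_a (fun z => l2 * g z (push F z b) (W z)) y =
        l2 * 'D_a (fun z => g z (push F z b) (W z)) y.
      by apply: (deriveZ l2); apply: diff_derivable; exact: (d_ip Vy (dp b) dW).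
    by rewrite (derive_along_metric oU sG symG posG sF FVU a Vy (dp b) dW).
  rewrite {1}/nbar.
  have -> : pc a (Ef b w) y = pc a (pc b W) y
      + (l1 * (q y a w + pi y (pc a W y))) *: push F y b
      + (l1 * pi y (W y)) *: pc a (fun z => push F z b) y
      - (l2 * (g y (pc a (fun z => push F z b) y) (push F y w)
          + g y (push F y b) (pc a W y))) *: P (F y)
      - (l2 * g y (push F y b) (W y)) *: rcov G (push F y a) P (F y).
    rewrite -D1 -D2 -(pcov_along G sF a Vy (dPy Vy)).
    rewrite (pcovD G F a (differentiableD d3 d4) (differentiableN d5)).
    rewrite (pcovD G F a d3 d4) (pcovN G F a d5).
    rewrite (pcovZ G F a d1 (dp b)) (pcovZ G F a d2 dPFy).
    mx_abel.
  rewrite /Ef /nbar -/W /q.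
  set A1 := pc a (pc b W) y; set A2 := pc a (fun z => push F z b) y.
  set A3 := pc b W y; set A4 := pc a W y; set A5 := rcov G (push F y a) P (F y).
  clearbody A1 A2 A3 A4 A5.
  rewrite /pi_form !ip_lin (sy (push F y a) (P (F y)) Vy) /W; ring.
have B (a b t' : 'rV[R]_d) : g y (a - b) t' = g y a t' - g y b t' by rewrite ipDl ipNl.
apply: etrans (B _ _ _) _.
apply: etrans (congr2 (fun a b => a - b) (K u v) (K v u)) _.
rewrite (pcov_push_sym oU oV symG sF FVU v u Vy).
have := pcov_curvature oU oV sG posG sF FVU u v Vy (smooth_push oV sF w).
move=> /(congr1 (fun x => g y x (push F y t))); rewrite -/W ipDl ipNl => <-.
rewrite (sy (push F y v) (push F y u) Vy); ring.
Qed.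

Lemma second_form_orth y a b t : V y -> g y (h y a b) (push F y t) = 0.
Proof. by move=> Vy; rewrite second_formE normal_orth. Qed.

Lemma second_form_sym y a b : V y -> h y a b = h y b a.
Proof.
move=> Vy; rewrite !second_formE /nbar (pcov_push_sym oU oV symG sF FVU a b Vy).
rewrite (sy (push F y a) (push F y b) Vy) -!scaleNr !normalD !normalZ.
by rewrite !normal_push// !scaler0.
Qed.

Lemma second_form_linear y c a a' b : V y ->
  h y (c *: a + a') b = c *: h y a b + h y a' b.
Proof.
move=> Vy; rewrite !second_formE -normalZ -normalD; congr normal_part.
rewrite /nbar /pcov pushD pushZ GamD GamZ derive_dirD ?derive_dirZ; last 2 first.
- exact: differentiable_push.
- exact: differentiable_push.
rewrite !ip_lin mulmxDr -scalemxAr.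
mx_abel.
Qed.

(** The roles of [a] and [b] differ: the [l1] part of the connection differentiates [P] along [b],
    the [l2] part along [a]. The two [alpha] terms absorb all but [- l2 (l1 - l2)] times
    [|P|^2 / 2 + pi(a)^2], which is [beta(a, a)]. *)
Lemma gauss_sectional y a b : V y ->
  ip (induced_metric G F y) a a = 1 -> ip (induced_metric G F y) b b = 1 ->
  ip (induced_metric G F y) a b = 0 ->
  curv4 G P l1 l2 F y a b b a =
  g y (lc_curvature G (F y) (push F y a) (push F y b) (push F y b)) (push F y a)
  - l1 * alpha G P l1 l2 (F y) (push F y b) (push F y b)
  - l2 * alpha G P l1 l2 (F y) (push F y a) (push F y a)
  - l2 * (l1 - l2) * beta G P (F y) (push F y a) (push F y a)
  + g y (h y a a) (h y b b) - g y (h y a b) (h y a b)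
  - (l1 - l2) * pi y (h y b b).
Proof.
move=> Vy; rewrite !induced_ip => aa bb ab.
have ba : g y (push F y b) (push F y a) = 0 by rewrite sy.
apply: etrans (curv4E a b b a Vy) _.
move: (nbar_curvature a b b a Vy) (second_form_sym b a Vy) (sy (h y b b) (h y a a) Vy).
move: (alphaE oU sG symG posG l1 l2 (push F y b) (push F y b) (FVU Vy) (dPy Vy)).
move: (alphaE oU sG symG posG l1 l2 (push F y a) (push F y a) (FVU Vy) (dPy Vy)).
rewrite -/(q y a a) -/(q y b b).
move: (lc_curvatureE oU sG posG (push F y a) (push F y b) (push F y b) (FVU Vy)).
generalize (lc_curvature G (F y) (push F y a) (push F y b) (push F y b)).
generalize (push F y b *m Om G (push F y a) (push F y b) (F y)).
generalize (alpha G P l1 l2 (F y) (push F y a) (push F y a)).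
generalize (alpha G P l1 l2 (F y) (push F y b) (push F y b)).
generalize (nbar a (Ef b b) y - nbar b (Ef a b) y).
generalize (q y a b) (q y b b) (q y a a) (q y b a).
generalize (h y a a) (h y b b) (h y a b) (h y b a).
rewrite /beta aa bb ab ba.
move=> haa hbb hab hba q1 q2 q3 q4 x1 x2 x3 x4 x5 -> -> -> -> -> ->.
by field.
Qed.

End InducedGeometry.

(** * Orthonormal frames *)

Section OrthonormalFrames.
Variables (R : realType) (n : nat) (B : 'M[R]_n).
Hypothesis symB : B^T = B.
Hypothesis posB : forall w : 'rV[R]_n, w != 0 -> 0 < ip B w w.
Implicit Types (u v w X : 'rV[R]_n) (e f : 'I_n -> 'rV[R]_n).

Definition ip_frame e := forall i j, ip B (e i) (e j) = (i == j)%:R.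

Lemma frame_expansion e u : ip_frame e -> u = \sum_i ip B u (e i) *: e i.
Proof.
move=> oe; pose E : 'M[R]_n := \matrix_i e i.
have EB : E *m (B *m E^T) = 1%:M.
  apply/matrixP => i j; rewrite mulmxA [RHS]mxE -(oe i j) /ip.
  transitivity (row i (E *m B *m E^T) 0 j); first by rewrite [RHS]mxE.
  by rewrite !row_mul rowK !mxE; apply: eq_bigr => k _; rewrite !mxE.
have EB' := mulmx1C EB.
rewrite -[LHS]mulmx1 -EB' !mulmxA mulmx_sum_row; apply: eq_bigr => i _.
rewrite rowK; congr (_ *: _); rewrite /ip !mxE; apply: eq_bigr => k _.
by rewrite !mxE.
Qed.

Lemma parseval e u v : ip_frame e ->
  \sum_i ip B u (e i) * ip B v (e i) = ip B u v.
Proof.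
move=> oe; rewrite [in RHS](frame_expansion v oe) ip_sumr; apply: eq_bigr => i _.
by rewrite ipZr mulrC.
Qed.

(** Values in a module [W] are allowed so that the vector [tau] and the scalar traces are covered
    alike. *)
Lemma frame_trace (W : lmodType R) (T : 'rV[R]_n -> 'rV[R]_n -> W) e f :
  (forall a u u' v, T (a *: u + u') v = a *: T u v + T u' v) ->
  (forall a u v v', T u (a *: v + v') = a *: T u v + T u v') ->
  ip_frame e -> ip_frame f -> \sum_i T (e i) (e i) = \sum_i T (f i) (f i).
Proof.
move=> Tl Tr oe of_.
have T0l v : T 0 v = 0.
  have := Tl 1 0 0 v; rewrite scaler0 add0r scale1r => /esym/eqP.
  by rewrite -subr_eq0 addrK => /eqP.
have T0r v : T v 0 = 0.
  have := Tr 1 v 0 0; rewrite scaler0 add0r scale1r => /esym/eqP.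
  by rewrite -subr_eq0 addrK => /eqP.
have sl (a : 'I_n -> R) v : T (\sum_i a i *: f i) v = \sum_i a i *: T (f i) v.
  by elim/big_rec2: _ => [|i x y _ <-] //.
have sr (a : 'I_n -> R) v : T v (\sum_i a i *: f i) = \sum_i a i *: T v (f i).
  by elim/big_rec2: _ => [|i x y _ <-] //.
transitivity (\sum_j \sum_k (\sum_i ip B (e i) (f j) * ip B (e i) (f k)) *: T (f j) (f k)).
  under eq_bigr => i _.
    rewrite {1 2}(frame_expansion (e i) of_) sl.
    under eq_bigr => j _ do rewrite sr scaler_sumr.
    over.
  rewrite exchange_big; apply: eq_bigr => j _; rewrite exchange_big.
  apply: eq_bigr => k _; rewrite scaler_suml; apply: eq_bigr => i _.
  by rewrite scalerA.
have D j k : \sum_i ip B (e i) (f j) * ip B (e i) (f k) = (j == k)%:R.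
  rewrite -of_ -(parseval (f j) (f k) oe); apply: eq_bigr => i _.
  by rewrite !(ip_sym (e i) _ symB).
apply: eq_bigr => j _; rewrite (bigD1 j)//= D eqxx scale1r big1 ?addr0// => k kj.
by rewrite D eq_sym (negbTE kj) scale0r.
Qed.

(** The reflection exchanging [e i0] and [X] carries [e] to a frame through [X]. *)
Lemma frame_through e X (i0 : 'I_n) : ip_frame e -> ip B X X = 1 ->
  exists2 f, ip_frame f & f i0 = X.
Proof.
move=> oe X1; have [w wE] : exists w, w = X - e i0 by exists (X - e i0).
have [w0|w0] := eqVneq w 0.
  by exists e => //; apply/esym/subr0_eq; rewrite -wE.
have ww : ip B w w != 0 by rewrite gt_eqF// posB.
have e00 : ip B (e i0) (e i0) = 1 by rewrite oe eqxx.
pose r v := v - (2 * ip B v w / ip B w w) *: w.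
exists (r \o e) => [i j|] /=.
  rewrite -oe /r !ip_lin (ip_sym w _ symB); field; exact: ww.
rewrite /r; suff -> : 2 * ip B (e i0) w / ip B w w = -1.
  by rewrite scaleN1r opprK wE addrC subrK.
have -> : ip B w w = - (2 * ip B (e i0) w).
  rewrite wE !ip_lin X1 e00 (ip_sym X _ symB); ring.
have n0 : 2 * ip B (e i0) w != 0.
  move: ww; apply: contra_neq => E.
  rewrite wE !ip_lin X1 e00 (ip_sym X _ symB).
  by move: E; rewrite wE !ip_lin e00; lra.
by rewrite invrN mulrN divff.
Qed.

End OrthonormalFrames.

(** The [n + p = d] orthonormal rows are independent, hence they span, so [w] is orthogonal to
    everything. It is applied to values of [h] to pass from components to vectors. *)
Lemma orthonormal_complete (R : realType) (n p d : nat) (G : 'M[R]_d)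
    (a : 'I_n -> 'rV[R]_d) (b : 'I_p -> 'rV[R]_d) (w : 'rV[R]_d) :
  (n + p = d)%N -> (forall v : 'rV[R]_d, v != 0 -> 0 < ip G v v) -> G^T = G ->
  (forall i j, ip G (a i) (a j) = (i == j)%:R) ->
  (forall i j, ip G (b i) (b j) = (i == j)%:R) ->
  (forall i j, ip G (a i) (b j) = 0) ->
  (forall i, ip G w (a i) = 0) -> (forall j, ip G w (b j) = 0) -> w = 0.
Proof.
move=> npd posG symG aa bb ab wa wb.
pose M : 'M[R]_(n + p, d) := col_mx (\matrix_i a i) (\matrix_j b j).
have gM k l : ip G (row k M) (row l M) = (k == l)%:R.
  rewrite /M; case: (split_ordP k) => i ->; case: (split_ordP l) => j ->.
  - by rewrite !rowKu !rowK aa eq_lshift.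
  - by rewrite rowKu rowKd !rowK ab eq_lrshift.
  - by rewrite rowKu rowKd !rowK (ip_sym _ _ symG) ab eq_rlshift.
  - by rewrite !rowKd !rowK bb eq_rshift.
have MG : M *m (G *m M^T) = 1%:M.
  apply/matrixP => k l; rewrite mulmxA [RHS]mxE.
  rewrite -gM /ip.
  transitivity (row k (M *m G *m M^T) 0 l); first by rewrite [RHS]mxE.
  by rewrite !row_mul mxE [RHS]mxE; apply: eq_bigr => i _; rewrite !mxE.
have fM : row_full M.
  have rf : row_free M by apply/row_freeP; exists (G *m M^T).
  by move: rf; rewrite /row_free /row_full => /eqP ->; rewrite npd.
have /row_fullP[D DM] := fM.
have Mw : M *m (G *m w^T) = 0.
  apply/matrixP => k l; rewrite mulmxA [RHS]mxE (ord1 l).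
  transitivity (ip G (row k M) w).
    rewrite /ip; transitivity (row k (M *m G *m w^T) 0 0); first by rewrite [RHS]mxE.
    by rewrite !row_mul.
  rewrite ip_sym//; case: (split_ordP k) => i ->; first by rewrite rowKu rowK wa.
  by rewrite rowKd rowK wb.
have Gw : G *m w^T = 0 by rewrite -[LHS]mul1mx -DM -mulmxA Mw mulmx0.
apply/eqP/negPn/negP => /posG; by rewrite /ip -mulmxA Gw mulmx0 mxE ltxx.
Qed.

(** * The Ricci inequality *)

Section RicciAlgebra.
Variables (R : realType) (n d : nat) (I : 'M[R]_n) (G : 'M[R]_d).
Hypothesis symI : I^T = I.
Hypothesis posI : forall w : 'rV[R]_n, w != 0 -> 0 < ip I w w.
Hypothesis symG : G^T = G.
Hypothesis posG : forall w : 'rV[R]_d, w != 0 -> 0 < ip G w w.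
Variables (psh : 'rV[R]_n -> 'rV[R]_d) (tan : 'rV[R]_d -> 'rV[R]_n).
Variables (xi : 'rV[R]_d) (phi hp : 'rV[R]_d -> 'rV[R]_d) (eta pi : 'rV[R]_d -> R).
Variables (al be : 'rV[R]_d -> 'rV[R]_d -> R) (hh : 'rV[R]_n -> 'rV[R]_n -> 'rV[R]_d).
Variables (sec : 'rV[R]_n -> 'rV[R]_n -> R) (kappa mu c l1 l2 : R).
Local Notation g := (ip G).
Hypothesis pshL : forall a u v, psh (a *: u + v) = a *: psh u + psh v.
Hypothesis I_ip : forall u v, ip I u v = g (psh u) (psh v).
Hypothesis tan_ip : forall w t, ip I (tan w) t = g w (psh t).
Hypothesis hpL : forall a u v, hp (a *: u + v) = a *: hp u + hp v.
Hypothesis phiL : forall a u v, phi (a *: u + v) = a *: phi u + phi v.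
Hypothesis hp_sym : forall u v, g (hp u) v = g u (hp v).
Hypothesis phi_skew : forall u, g (phi u) u = 0.
Hypothesis etaE : forall u, g u xi = eta u.
Hypothesis piL : forall a u v, pi (a *: u + v) = a * pi u + pi v.
Hypothesis alL : forall a u v w, al (a *: u + v) w = a * al u w + al v w.
Hypothesis alR : forall a u v w, al w (a *: u + v) = a * al w u + al w v.
Hypothesis hhL : forall a u v w, hh (a *: u + v) w = a *: hh u w + hh v w.
Hypothesis hh_sym : forall u v, hh u v = hh v u.
Hypothesis secE : forall X Y, ip I X X = 1 -> ip I Y Y = 1 -> ip I X Y = 0 ->
  let u := psh X in let v := psh Y in let eta u := g u xi in
  let phi_h u := phi (hp u) in
  sec X Y =
  ((c + 3) / 4 * (g u u * g v v - g u v ^+ 2)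
  + (c + 3 - 4 * kappa) / 4 * (2 * (eta u * eta v * g u v)
      - eta v ^+ 2 * g u u - eta u ^+ 2 * g v v)
  + 3 * (c - 1) / 4 * g (phi u) v ^+ 2
  + 2^-1 * (g (hp v) v * g (hp u) u - g (hp u) v ^+ 2
            + g (phi_h u) v ^+ 2 - g (phi_h v) v * g (phi_h u) u)
  - g u v * g (hp v) u + g v v * g (hp u) u
  + eta u * eta v * g (hp v) u - eta v ^+ 2 * g (hp u) u
  - g (hp u) v * g u v + g (hp v) v * g u u
  - g (hp v) v * eta u ^+ 2 + g (hp u) v * eta u * eta v
  + mu * (eta v ^+ 2 * g (hp u) u - eta u * eta v * g (hp v) u
          + g (hp v) v * eta u ^+ 2 - g (hp u) v * eta u * eta v))
  - l1 * al v v - l2 * al u u - l2 * (l1 - l2) * be u u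
  + g (hh X X) (hh Y Y) - g (hh X Y) (hh X Y) - (l1 - l2) * pi (hh Y Y).
Variables (e v : 'I_n -> 'rV[R]_n) (X : 'rV[R]_n) (i0 : 'I_n).
Hypothesis oe : ip_frame I e.
Hypothesis ov : ip_frame I v.
Hypothesis vX : v i0 = X.
Local Notation H := (n%:R^-1 *: \sum_i hh (e i) (e i)).
Local Notation nt w := (ip I (tan w) (tan w)).
Local Notation tr A := (\sum_i ip I (e i) (tan (A (psh (e i))))).

Definition abstract_bound : R :=
  (n%:R - 1) * (c + 3) / 4 + 3 * (c - 1) / 4 * nt (phi (psh X))
  - (c + 3 - 4 * kappa) / 4 * ((n%:R - 2) * eta (psh X) ^+ 2 + nt xi)
  + 2^-1 * (nt (phi (hp (psh X))) - nt (hp (psh X))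
            + g (psh X) (hp (psh X)) * tr hp
            - g (psh X) (phi (hp (psh X))) * tr (fun v => phi (hp v)))
  + (n%:R - 2 - nt xi + mu * nt xi) * g (psh X) (hp (psh X))
  + (1 - eta (psh X) ^+ 2 + mu * eta (psh X) ^+ 2) * tr hp
  + (2 - 2 * mu) * eta (psh X) * g (psh X) (hp (psh (tan xi)))
  - l1 * (\sum_i al (psh (e i)) (psh (e i)))
  + (l1 - l2 * (n%:R - 1)) * al (psh X) (psh X)
  - l2 * (l1 - l2) * (n%:R - 1) * be (psh X) (psh X)
  - n%:R * (l1 - l2) * pi H
  + (l1 - l2) * pi (hh X X)
  + n%:R ^+ 2 / 4 * g H H.

Local Notation tau := (\sum_i hh (e i) (e i)).

Let hhR a u w t : hh t (a *: u + w) = a *: hh t u + hh t w.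
Proof. by rewrite !(hh_sym t) hhL. Qed.

Lemma trace_frame_v (T : 'rV[R]_n -> 'rV[R]_n -> R) :
  (forall a u u' w, T (a *: u + u') w = a * T u w + T u' w) ->
  (forall a u w w', T u (a *: w + w') = a * T u w + T u w') ->
  \sum_i T (e i) (e i) = \sum_i T (v i) (v i).
Proof. by move=> Tl Tr; exact: (frame_trace symI (W := R^o) Tl Tr oe ov). Qed.

Lemma ricci_gap :
  abstract_bound - \sum_(j | j != i0) sec X (v j) =
  4^-1 * g (tau - 2 *: hh X X) (tau - 2 *: hh X X)
  + \sum_(j | j != i0) g (hh X (v j)) (hh X (v j)).
Proof.
have n0 : n%:R != 0 :> R by rewrite pnatr_eq0 -lt0n (leq_trans _ (ltn_ord i0)).
have XX : ip I X X = 1 by rewrite -vX ov eqxx.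
have par a b : \sum_j g a (psh (v j)) * g b (psh (v j)) = ip I (tan a) (tan b).
  by rewrite -(parseval _ _ ov); apply: eq_bigr => j _; rewrite !tan_ip.
have tauE : tau = \sum_i hh (v i) (v i).
  exact: (frame_trace symI hhL (fun a u w w' => hhR a w w' u) oe ov).
have trE A : (forall a u w, A (a *: u + w) = a *: A u + A w) ->
    tr A = \sum_j g (A (psh (v j))) (psh (v j)).
  move=> AL; transitivity (\sum_i g (A (psh (e i))) (psh (e i))).
    by apply: eq_bigr => i _; rewrite (ip_sym _ _ symI) tan_ip.
  apply: (trace_frame_v (T := fun a b => g (A (psh a)) (psh b))) => [a u u' w|a u w w'].
    by rewrite pshL AL ipDl ipZl.
  by rewrite pshL ipDr ipZr.
have alE : \sum_i al (psh (e i)) (psh (e i)) = \sum_j al (psh (v j)) (psh (v j)).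
  apply: (trace_frame_v (T := fun a b => al (psh a) (psh b))) => [a u u' w|a u w w'].
    by rewrite pshL alL.
  by rewrite pshL alR.
have pi0 : pi 0 = 0.
  have := piL 1 0 0; rewrite scaler0 addr0 mul1r => /esym/eqP.
  by rewrite -subr_eq0 addrK => /eqP.
have piZ a w : pi (a *: w) = a * pi w by rewrite -[a *: w]addr0 piL pi0 addr0.
have pi_sum : pi tau = \sum_j pi (hh (v j) (v j)).
  rewrite tauE; elim/big_rec2: _ => [|i x y _ <-]; first exact: pi0.
  by rewrite -[hh (v i) (v i)]scale1r piL mul1r scale1r.
set u := psh X.
have uu : g u u = 1 by rewrite -I_ip.
have [C CE] : exists C, C = (c + 3) / 4 + g (hp u) u - (c + 3 - 4 * kappa) / 4 * eta u ^+ 2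
    - l2 * al u u - l2 * (l1 - l2) * be u u.
  by eexists.
(* The sectional value rewritten with [g u (psh (v j)) = 0] and [v j] of unit length substituted, so
   that it also makes sense at [i0]. The sum over all [j] is then a matter of traces and Parseval,
   and [Q i0] is subtracted at the end. *)
pose Q j := C
  + (mu * g (hp u) u - g (hp u) u - (c + 3 - 4 * kappa) / 4)
     * (g xi (psh (v j)) * g xi (psh (v j)))
  + 3 * (c - 1) / 4 * (g (phi u) (psh (v j)) * g (phi u) (psh (v j)))
  + (2^-1 * g (hp u) u + 1 - eta u ^+ 2 + mu * eta u ^+ 2)
     * g (hp (psh (v j))) (psh (v j))
  + (- 2^-1) * (g (hp u) (psh (v j)) * g (hp u) (psh (v j)))
  + 2^-1 * (g (phi (hp u)) (psh (v j)) * g (phi (hp u)) (psh (v j)))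
  + (- (2^-1 * g (phi (hp u)) u)) * g (phi (hp (psh (v j)))) (psh (v j))
  + ((2 - 2 * mu) * eta u) * (g xi (psh (v j)) * g (hp u) (psh (v j)))
  + (- l1) * al (psh (v j)) (psh (v j))
  + g (hh X X) (hh (v j) (v j))
  - g (hh X (v j)) (hh X (v j))
  + (- (l1 - l2)) * pi (hh (v j) (v j)).
have SQ : \sum_(j | j != i0) sec X (v j) = \sum_(j | j != i0) Q j.
  apply: eq_bigr => j ji.
  have Xj : ip I X (v j) = 0 by rewrite -vX ov eq_sym (negbTE ji).
  have jj : ip I (v j) (v j) = 1 by rewrite ov eqxx.
  rewrite (secE XX jj Xj) /Q CE /= -/u uu -!I_ip jj Xj -/u.
  have -> : g (hp (psh (v j))) u = g (hp u) (psh (v j)).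
    by rewrite hp_sym (ip_sym _ _ symG).
  rewrite (ip_sym (psh (v j)) xi symG) !etaE; ring.
have xiE : g u (hp (psh (tan xi))) = ip I (tan xi) (tan (hp u)).
  by rewrite -hp_sym -tan_ip (ip_sym _ _ symI).
have SumQ : \sum_j Q j = n%:R * C
  + (mu * g (hp u) u - g (hp u) u - (c + 3 - 4 * kappa) / 4) * nt xi
  + 3 * (c - 1) / 4 * nt (phi u)
  + (2^-1 * g (hp u) u + 1 - eta u ^+ 2 + mu * eta u ^+ 2) * tr hp
  + (- 2^-1) * nt (hp u) + 2^-1 * nt (phi (hp u))
  + (- (2^-1 * g (phi (hp u)) u)) * tr (fun v => phi (hp v))
  + ((2 - 2 * mu) * eta u) * g u (hp (psh (tan xi)))
  + (- l1) * (\sum_i al (psh (e i)) (psh (e i)))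
  + g (hh X X) tau - \sum_j g (hh X (v j)) (hh X (v j))
  + (- (l1 - l2)) * pi tau.
  rewrite /Q !big_split /= -!mulr_sumr sumr_const cardT size_enum_ord.
  have phpL a w w' : phi (hp (a *: w + w')) = a *: phi (hp w) + phi (hp w').
    by rewrite hpL phiL.
  rewrite !par -(trE hp hpL) -(trE (fun w => phi (hp w)) phpL).
  by rewrite -alE -pi_sum tauE ip_sumr sumrN xiE -[C *+ n]mulr_natl.
have Qi0 : \sum_j Q j = Q i0 + \sum_(j | j != i0) Q j by rewrite (bigD1 i0).
have Ni0 : \sum_j g (hh X (v j)) (hh X (v j)) = g (hh X X) (hh X X)
    + \sum_(j | j != i0) g (hh X (v j)) (hh X (v j)).
  by rewrite (bigD1 i0)//= vX.
rewrite SQ; move: Qi0; rewrite SumQ /= {1}/Q vX -/u phi_skew Ni0 (ip_sym xi u symG) etaE.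
rewrite /abstract_bound -/u piZ !ip_lin (ip_sym u (hp u) symG) (ip_sym u (phi (hp u)) symG).
rewrite (ip_sym tau (hh X X) symG).
set s1 := \sum_(j | j != i0) Q j; set s2 := \sum_(j | j != i0) _.
set t1 := tr hp; set t2 := tr (fun v => phi (hp v)).
set t3 := \sum_i al (psh (e i)) (psh (e i)); clearbody s1 s2 t1 t2 t3 => E.
have sub (x y z : R) : x = y + z -> z = x - y by move=> ->; rewrite addrAC subrr add0r.
rewrite (sub _ _ _ E).
rewrite CE.
have -> : n%:R * (l1 - l2) * (n%:R^-1 * pi tau) = (l1 - l2) * pi tau by field.
have -> (x : R) : n%:R ^+ 2 / 4 * (n%:R^-1 * (n%:R^-1 * x)) = 4^-1 * x by field.
by field.
Qed.

End RicciAlgebra.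

(** * The inequality and its equality cases, from the gap identity *)

Section EqualityCases.
Variables (R : realType) (n d : nat) (I : 'M[R]_n) (G : 'M[R]_d).
Hypothesis symI : I^T = I.
Hypothesis posI : forall w : 'rV[R]_n, w != 0 -> 0 < ip I w w.
Hypothesis posG : forall w : 'rV[R]_d, w != 0 -> 0 < ip G w w.
Variable hh : 'rV[R]_n -> 'rV[R]_n -> 'rV[R]_d.
Hypothesis hhL : forall a u v w, hh (a *: u + v) w = a *: hh u w + hh v w.
Hypothesis hh_sym : forall u v, hh u v = hh v u.
Variables (e : 'I_n -> 'rV[R]_n) (ric bnd : 'rV[R]_n -> R) (i0 : 'I_n).
Hypothesis n3 : (3 <= n)%N.
Hypothesis oe : ip_frame I e.
Local Notation g := (ip G).
Local Notation tau := (\sum_i hh (e i) (e i)).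
Hypothesis gap : forall X, ip I X X = 1 -> exists v, [/\ ip_frame I v, v i0 = X &
  bnd X - ric X = 4^-1 * g (tau - 2 *: hh X X) (tau - 2 *: hh X X)
    + \sum_(j | j != i0) g (hh X (v j)) (hh X (v j))].

Let g_ge0 w : 0 <= g w w.
Proof. by have [->|/posG/ltW//] := eqVneq w 0; rewrite ip0l. Qed.

Let g_eq0 w : g w w = 0 -> w = 0.
Proof. by move=> w0; apply/eqP/negPn/negP => /posG; rewrite w0 ltxx. Qed.

Let hh0 w : hh w 0 = 0.
Proof.
have := hhL 1 0 0 w; rewrite scaler0 addr0 scale1r => /esym/eqP.
by rewrite -subr_eq0 addrK hh_sym => /eqP.
Qed.

Let hh_sum X (a : 'I_n -> R) (v : 'I_n -> 'rV[R]_n) :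
  hh X (\sum_i a i *: v i) = \sum_i a i *: hh X (v i).
Proof.
elim/big_rec2: _ => [|i x y _ <-]; first exact: hh0.
by rewrite hh_sym hhL !(hh_sym _ X).
Qed.

Lemma ricci_le_bound X : ip I X X = 1 -> ric X <= bnd X.
Proof.
move=> X1; have [v [_ _ E]] := gap X1; rewrite -subr_ge0 E addr_ge0//.
  by rewrite mulr_ge0.
exact: sumr_ge0.
Qed.

Lemma ricci_eq_boundP X : ip I X X = 1 ->
  ric X = bnd X <-> tau = 2 *: hh X X /\ forall Y, ip I Y X = 0 -> hh X Y = 0.
Proof.
move=> X1; have [v [ov vX E]] := gap X1; split=> [EX|[t0 hX]].
  move: E; rewrite EX subrr => /esym/eqP.
  have s0 : 0 <= \sum_(j | j != i0) g (hh X (v j)) (hh X (v j)) by exact: sumr_ge0.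
  have q0 : 0 <= 4^-1 * g (tau - 2 *: hh X X) (tau - 2 *: hh X X) by rewrite mulr_ge0.
  rewrite paddr_eq0// => /andP[/eqP E1 /eqP E2]; split.
    apply/eqP; rewrite -subr_eq0; apply/eqP/g_eq0.
    by move/eqP: E1; rewrite mulf_eq0 invr_eq0 pnatr_eq0 /= => /eqP.
  have hv j : j != i0 -> hh X (v j) = 0.
    have := psumr_eq0P _ E2; move=> /(_ (fun j _ => g_ge0 _)) H ji.
    by apply: g_eq0; exact: H.
  move=> Y YX; rewrite (frame_expansion Y ov) hh_sum big1// => j _.
  have [->|ji] := eqVneq j i0; first by rewrite vX YX scale0r.
  by rewrite hv// scaler0.
apply/eqP; rewrite eq_sym -subr_eq0 E t0 subrr ip0l mulr0 add0r big1// => j ji.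
by rewrite hX ?ip0l// -vX ov (negbTE ji).
Qed.

Lemma minimal_equality X : tau = 0 -> ip I X X = 1 ->
  ric X = bnd X <-> forall Y, hh X Y = 0.
Proof.
move=> t0 X1; rewrite ricci_eq_boundP// t0; split=> [[/esym hX h0] Y|h0]; last first.
  by rewrite h0 scaler0; split.
have hXX : hh X X = 0.
  by move/eqP: hX; rewrite scaler_eq0 pnatr_eq0 /= => /eqP.
(* With [h(X, X) = 0] already known, only the part of [Y] orthogonal to [X] matters. *)
have -> : Y = ip I Y X *: X + (Y - ip I Y X *: X) by rewrite addrC subrK.
rewrite hh_sym hhL !(hh_sym _ X) hXX scaler0 add0r h0//.
by rewrite !ip_lin X1 mulr1 subrr.
Qed.

Lemma total_equality :
  (forall X, ip I X X = 1 -> ric X = bnd X) <-> forall i j, hh (e i) (e j) = 0.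
Proof.
have e1 i : ip I (e i) (e i) = 1 by rewrite oe eqxx.
split=> [EX|h0 X X1].
  have F i := (ricci_eq_boundP (e1 i)).1 (EX _ (e1 i)).
  have t0 : tau = 0.
    (* Each index gives [tau = 2 h(e_i, e_i)]; summing over [i] yields [n tau = 2 tau], and [3 <= n]
       forces [tau = 0]. *)
    have : 2 *: tau = n%:R *: tau.
      rewrite scaler_sumr; transitivity (\sum_(i < n) tau).
        by apply: eq_bigr => i _; rewrite (F i).1.
      by rewrite sumr_const cardT size_enum_ord scaler_nat.
    move/eqP; rewrite -subr_eq0 -scalerBl scaler_eq0 => /orP[|/eqP//].
    rewrite subr_eq0 eqr_nat => n2.
    by have := leq_trans n3 (eq_leq (esym (eqP n2))).
  move=> i j; have [<-|ij] := eqVneq i j; last first.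
    by apply: (F i).2; rewrite oe eq_sym (negbTE ij).
  have := (F i).1; rewrite t0 => /esym/eqP.
  by rewrite scaler_eq0 pnatr_eq0 /= => /eqP.
have hz Y Z : hh Y Z = 0.
  rewrite (frame_expansion Z oe) hh_sum big1// => j _.
  rewrite hh_sym (frame_expansion Y oe) hh_sum big1 ?scaler0// => i _.
  by rewrite h0 scaler0.
by apply/(ricci_eq_boundP X1); split=> [|Y _]; rewrite ?hz ?scaler0 ?big1.
Qed.

End EqualityCases.

(** * The three assertions in a pair of charts *)

Section LocalRicci.
Variables (R : realType) (n p d : nat) (U : set 'rV[R]_d) (V : set 'rV[R]_n).
Hypothesis oU : open U.
Hypothesis oV : open V.
Variable G : 'rV[R]_d -> 'M[R]_d.
Hypothesis sG : smooth_mx_on U G.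
Hypothesis symG : forall z, U z -> (G z)^T = G z.
Hypothesis posG : forall z, U z -> forall v : 'rV[R]_d, v != 0 -> 0 < ip (G z) v v.
Variables (phi : 'rV[R]_d -> 'M[R]_d) (xi : 'rV[R]_d -> 'rV[R]_d)
  (eta : 'rV[R]_d -> 'cV[R]_d).
Hypothesis sphi : smooth_mx_on U phi.
Hypothesis sxi : smooth_mx_on U xi.
Hypothesis seta : smooth_mx_on U eta.
Hypothesis phi2 : forall y (v : 'rV[R]_d), U y ->
  v *m phi y *m phi y = - v + form_ev (eta y) v *: xi y.
Hypothesis eta_xi : forall y, U y -> form_ev (eta y) (xi y) = 1.
Hypothesis phi_xi : forall y, U y -> xi y *m phi y = 0.
Hypothesis phi_skew : forall y (u v : 'rV[R]_d), U y ->
  ip (G y) u (v *m phi y) = - ip (G y) (u *m phi y) v.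
Hypothesis gxi : forall y (v : 'rV[R]_d), U y ->
  ip (G y) v (xi y) = form_ev (eta y) v.
Hypothesis contact : forall y (u v : 'rV[R]_d), U y ->
  ip (G y) u (v *m phi y) = ext_deriv eta (cst u) (cst v) y.
Variables kappa mu c : R.
Hypothesis kmu : forall y (u v : 'rV[R]_d), U y ->
  lc_curvature G y u v (xi y) =
  kappa *: (form_ev (eta y) v *: u - form_ev (eta y) u *: v)
  + mu *: (form_ev (eta y) v *: hprime phi xi y u - form_ev (eta y) u *: hprime phi xi y v).
Hypothesis hol : forall y (u : 'rV[R]_d), U y ->
  ip (G y) u u = 1 -> ip (G y) u (xi y) = 0 -> sectional G y u (u *m phi y) = c.
Variable P : 'rV[R]_d -> 'rV[R]_d.
Hypothesis sP : smooth_mx_on U P.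
Variables l1 l2 : R.
Variable F : 'rV[R]_n -> 'rV[R]_d.
Hypothesis sF : smooth_mx_on V F.
Hypothesis FVU : forall z, V z -> U (F z).
Hypothesis immF : forall z, V z -> row_free (jacobian F z).
Variable y : 'rV[R]_n.
Hypothesis Vy : V y.
Variables (e : 'I_n -> 'rV[R]_n) (nu : 'I_p -> 'rV[R]_d).
Hypothesis n3 : (3 <= n)%N.
Hypothesis npd : (n + p = d)%N.
Hypothesis oe : tangent_frame G F y e.
Hypothesis onu : normal_frame G F y nu.
Local Notation I := (induced_metric G F y).
Local Notation h := (second_form G P l1 l2 F y).
Local Notation hp := (hprime phi xi (F y)).
Local Notation bound := (ricci_bound G phi xi eta kappa mu c P l1 l2 F y e).

Let Uy : U (F y). Proof. exact: FVU. Qed.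
Let i0 : 'I_n := Ordinal (ltn_trans (isT : (0 < 2)%N) n3).

Let symI : I^T = I.
Proof. by rewrite /induced_metric !trmx_mul trmxK symG// mulmxA. Qed.

Let posI (w : 'rV[R]_n) : w != 0 -> 0 < ip I w w.
Proof. exact: (induced_pos posG FVU immF Vy). Qed.

Let hpE v : hp v = v *m cov_plus_phi G phi xi (F y) *m phi (F y).
Proof.
exact: (hprimeE oU sG symG posG sphi sxi seta phi2 eta_xi phi_xi phi_skew gxi contact v Uy).
Qed.

Let hL a u v w : h (a *: u + v) w = a *: h u w + h v w.
Proof. exact: (second_form_linear oV G sF P l1 l2 a u v w Vy). Qed.

Let h_sym u v : h u v = h v u.
Proof. exact: (second_form_sym oU oV symG posG sF FVU immF P l1 l2 u v Vy). Qed.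

Let dP : differentiable P (F y).
Proof. exact: smooth_mx_differentiable sP Uy. Qed.

Let alE u v := alphaE oU sG symG posG l1 l2 u v Uy dP.

(** [adapted_basis] falls back on zero vectors when no suitable frame exists; the reflected frame of
    [frame_through] rules this out. *)
Lemma adapted_basisP X : ip I X X = 1 ->
  ip_frame I (adapted_basis G F y X) /\ adapted_basis G F y X i0 = X.
Proof.
move=> X1; have [f of_ fX] := frame_through symI posI i0 oe X1.
have [tf hf] : [set e : {ffun 'I_n -> 'rV[R]_n} | tangent_frame G F y e /\
    forall i : 'I_n, i = 0%N :> nat -> e i = X] (adapted_basis G F y X).
  apply: xgetPex; exists [ffun i => f i]; split=> [i j|i i_0]; rewrite !ffunE//.
  by rewrite -fX; congr f; exact: val_inj.
by split; [exact: tf|exact: hf].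
Qed.

Let sec X Y := curv4 G P l1 l2 F y X Y Y X.

Lemma local_gap X : ip I X X = 1 -> exists v, [/\ ip_frame I v, v i0 = X &
  bound X - ricci G P l1 l2 F y X =
  4^-1 * ip (G (F y)) (\sum_i h (e i) (e i) - 2 *: h X X) (\sum_i h (e i) (e i) - 2 *: h X X)
    + \sum_(j | j != i0) ip (G (F y)) (h X (v j)) (h X (v j))].
Proof.
move=> X1; have [ov vX] := adapted_basisP X1.
exists (adapted_basis G F y X); split=> //.
have -> : ricci G P l1 l2 F y X = \sum_(j | j != i0) sec X (adapted_basis G F y X j).
  by apply: eq_bigl => j; rewrite lt0n.
apply: (ricci_gap (I := I) (G := G (F y)) symI (symG Uy) (psh := push F y)
  (tan := tangential G F y) (xi := xi (F y)) (phi := fun w => w *m phi (F y))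
  (hp := hp) (eta := form_ev (eta (F y))) (pi := pi_form G P (F y))
  (al := alpha G P l1 l2 (F y)) (be := beta G P (F y)) (hh := h) (sec := sec)
  (kappa := kappa) (mu := mu) (c := c) (l1 := l1) (l2 := l2) _ _ _ _ _ _ _ _ _ _ _ hL h_sym _ oe ov vX).
- by move=> a u v; rewrite pushD pushZ.
- by move=> u v; exact: induced_ip.
- by move=> w t; exact: (tangential_ip posG FVU immF w t Vy).
- by move=> a u v; rewrite !hpE !mulmxDl -!scalemxAl.
- by move=> a u v; rewrite mulmxDl -scalemxAl.
- move=> u v.
  exact: (hprime_sym oU sG symG posG sphi sxi seta phi2 eta_xi phi_xi phi_skew gxi contact u v Uy).
- by move=> u; have := phi_skew u u Uy; rewrite (ip_sym _ _ (symG Uy)); lra.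
- by move=> u; exact: gxi Uy.
- by move=> a u v; rewrite /pi_form ipDr ipZr.
- move=> a u v w; apply: etrans (alE _ _) _.
  apply: etrans _ (esym (congr2 (fun s t => a * s + t) (alE u w) (alE v w))).
  rewrite (rcov_linear G a u v dP) /pi_form.
  generalize (rcov G u P (F y)) (rcov G v P (F y)) => r1 r2.
  rewrite !(ipDl, ipDr, ipZl, ipZr); ring.
- move=> a u v w; apply: etrans (alE _ _) _.
  apply: etrans _ (esym (congr2 (fun s t => a * s + t) (alE w u) (alE w v))).
  generalize (rcov G w P (F y)) => r; rewrite /pi_form !(ipDr, ipZr); ring.
- move=> A B A1 B1 AB /=.
  apply: etrans (gauss_sectional oU oV sG symG posG sF FVU immF sP l1 l2 Vy A1 B1 AB) _.
  have := space_form_sectional oU sG symG posG sphi sxi seta phi2 eta_xi phi_xi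
    phi_skew gxi contact kmu hol (push F y A) (push F y B) Uy.
  by move=> /= ->.
Qed.

Let h_normal i j :
  (forall r, ip (G (F y)) (h (e i) (e j)) (nu r) = 0) -> h (e i) (e j) = 0.
Proof.
have [nn en] := onu => h0.
apply: (orthonormal_complete npd (posG Uy) (symG Uy) (a := fun i => push F y (e i)) (b := nu)) => //.
- by move=> k l; rewrite -induced_ip; exact: oe.
- by move=> k; exact: (second_form_orth posG FVU immF P l1 l2 (e i) (e j) (e k) Vy).
Qed.

Lemma local_ricci :
  [/\ (forall X, ip I X X = 1 -> ricci G P l1 l2 F y X <= bound X),
      (mean_curvature G P l1 l2 F y e = 0 -> forall X, ip I X X = 1 ->
         (ricci G P l1 l2 F y X = bound X <-> forall Y, h X Y = 0))
    & ((forall X, ip I X X = 1 -> ricci G P l1 l2 F y X = bound X) <->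
       (forall i j r, ip (G (F y)) (h (e i) (e j)) (nu r) = 0))].
Proof.
have gap := local_gap; split.
- by move=> X; exact: (ricci_le_bound (posG Uy) gap).
- move=> H0 X X1; apply: (minimal_equality (posG Uy) hL h_sym gap) X1.
  have n0 : n%:R^-1 != 0 :> R by rewrite invr_eq0 pnatr_eq0 -lt0n (leq_trans _ n3).
  by move/eqP: H0; rewrite /mean_curvature scaler_eq0 (negbTE n0) => /eqP.
- apply: iff_trans (total_equality (posG Uy) hL h_sym n3 oe gap) _.
  split=> [h0 i j r|h0 i j]; first by rewrite h0 ip0l.
  by apply: h_normal => r; exact: h0.
Qed.

End LocalRicci.

(** The calculus along the immersion differentiates on this set; it is open by continuity of [f] and
    of the inverse chart. *)
Lemma local_expr_dom_open (R : realType) (n d : nat) (M : manifold R n)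
    (N : manifold R d) (f : submanifold M N) (a : chart M) (b : chart N) :
  open (chart_map a @` (chart_dom a `&` f @^-1` chart_dom b)).
Proof.
rewrite openE => _ [x [xa xb] <-].
have yU : chart_codom a (chart_map a x) by exists x.
have c1 : \forall z \near chart_map a x, chart_codom a z.
  by apply: open_nbhs_nbhs; split; [exact: chart_codom_open|exact: yU].
have c2 : \forall z \near chart_map a x, chart_dom b (f (chart_inv a z)).
  have nx : nbhs (chart_inv a (chart_map a x)) (f @^-1` chart_dom b).
    rewrite chart_mapK//; apply: (@incl_continuous _ _ _ _ _ f x).
    by apply: open_nbhs_nbhs; split=> //; exact: chart_dom_open.
  exact: (chart_inv_continuous yU nx).
apply: filterS2 c1 c2 => z [x' x'a <-]; rewrite chart_mapK// => x'b.
by exists x'.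
Qed.

Theorem theorem3p3 (R : realType) (m n p : nat)
  (hn : (3 <= n)%N) (hnp : (n + p = (2 * m).+1)%N)
  (N : manifold R (2 * m).+1) (S : almost_contact_metric N)
  (kappa mu c : R) (hN : kappa_mu_space_form S kappa mu c)
  (P : vector_field N) (lambda1 lambda2 : R)
  (M : manifold R n) (f : submanifold M N)
  (x : M) (a : chart M) (b : chart N)
  (hxa : chart_dom a x) (hxb : chart_dom b (f x))
  (e : 'I_n -> 'rV[R]_n) (nu : 'I_p -> 'rV[R]_(2 * m).+1) :
  let F := local_expr f a b in
  let y := chart_map a x in
  tangent_frame (S b) F y e ->
  normal_frame (S b) F y nu ->
  let unit_vector (X : 'rV[R]_n) := ip (induced_metric (S b) F y) X X = 1 in
  let h := second_form (S b) (P b) lambda1 lambda2 F y in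
  let H := mean_curvature (S b) (P b) lambda1 lambda2 F y e in
  let Ric := ricci (S b) (P b) lambda1 lambda2 F y in
  let bound := ricci_bound (S b) (acm_phi S b) (acm_xi S b) (acm_eta S b)
                 kappa mu c (P b) lambda1 lambda2 F y e in
  [/\ (forall X, unit_vector X -> Ric X <= bound X),
      (H = 0 -> forall X, unit_vector X ->
         (Ric X = bound X <-> forall Y, h X Y = 0))
    & ((forall X, unit_vector X -> Ric X = bound X) <->
       (forall i j r, ip (S b (F y)) (h (e i) (e j)) (nu r) = 0))].
Proof.
move=> F y te nf; have [[contact kmu] hol] := hN.
refine (local_ricci (U := chart_codom b)
  (V := chart_map a @` (chart_dom a `&` f @^-1` chart_dom b))
  (@chart_codom_open _ _ N b) (@local_expr_dom_open _ _ _ _ _ f a b)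
  (@metric_smooth _ _ _ S b) (@Defs.metric_sym _ _ _ S b) (@metric_pos _ _ _ S b)
  (@endo_smooth _ _ _ (acm_phi S) b) (@vf_smooth _ _ _ (acm_xi S) b)
  (@form_smooth _ _ _ (acm_eta S) b)
  (@acm_phi2 _ _ _ S b) (@acm_eta_xi _ _ _ S b) (@acm_phi_xi _ _ _ S b)
  (@acm_skew _ _ _ S b) (@acm_g_xi _ _ _ S b)
  (contact b) (kmu b) (hol b) (@vf_smooth _ _ _ P b) lambda1 lambda2
  (@incl_smooth _ _ _ _ _ f a b) _ (@incl_immersive _ _ _ _ _ f a b)
  _ hn hnp te nf).
- move=> _ [x' [x'a x'b] <-]; exists (f x') => //.
  by rewrite /F /local_expr /= chart_mapK.
- by exists x.
Qed.
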